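(* Let $\mu>0$ and let $\psi$ be a nondegenerate multifront solution (as described in the context) of $$-\psi''+\mu V(x)\psi+\omega\psi+\psi^3=0.\qquad(\ast)$$ Assume that $\psi$ connects to the same periodic end state $v\in H^2_{\rm per}(0,T)$ as $x\to\pm\infty$. Then there exists $N\in\mathbb N$ such that for all $n\in\mathbb N$ with $n\ge N$ there exists an $nT$-periodic solution $\psi_n$ of $(\ast)$ given by $$\psi_n(x)=\chi_n(x)\psi(x)+(1-\chi_n(x))v(x)+a_n(x),\qquad x\in[-\tfrac n2T,\tfrac n2T),$$ where $\{a_n\}_n$ is a sequence with $a_n\in H^2_{\rm per}(0,nT)$ satisfying $\|a_n\|_{H^2_{\rm per}(0,nT)}\to0$ as $n\to\infty$.
   Context: Let $\omega<0$, $T>0$, and let $V\in C^1(\mathbb R)$ be even, $T$-periodic and real-valued. Equation $(\ast)$ describes real-valued stationary solutions of the defocusing Gross–Pitaevskii equation. A real-valued bounded solution $\psi$ of $(\ast)$ is nondegenerate if the operator $\varphi\mapsto-\varphi''+\mu V\varphi+\omega\varphi+3\psi^2\varphi$ on $L^2(\mathbb R)$ with domain $H^2(\mathbb R)$ is invertible. $H^2_{\rm per}(0,L)$: $L$-periodic, locally $H^2$ functions with the $H^2(0,L)$-norm. $\chi_\pm:\mathbb R\to[0,1]$ is a smooth partition of unity with $\chi_+$ supported on $(-1,\infty)$, $\chi_-$ on $(-\infty,1)$, $\chi_+(x)=\chi_-(-x)$. Primary fronts. Let $\psi_0(x)=\sqrt{-\omega}\tanh(\sqrt{-\omega/2}\,x)$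 and assume $\int_{\mathbb R}V'\psi_0\psi_0'\,dx\ne0$. Then there are $C,\mu_0>0$ such that for $\mu\in(0,\mu_0)$ there is a nondegenerate odd solution $\psi(\mu)$ of $(\ast)$ with $\|\psi(\mu)-\psi_0\|_{L^\infty}\le C\mu$ and $\chi_\pm(\psi(\mu)-v_\pm(\mu))\in H^2(\mathbb R)$, where $v_\pm(\mu)\in H^2_{\rm per}(0,T)$, $v_-(\mu)=-v_+(\mu)$, are even solutions of $(\ast)$ with $\|v_\pm(\mu)\mp\sqrt{-\omega}\|_{H^2_{\rm per}(0,T)}\le C\mu$. The primary fronts are $\psi(\mu)$ and $-\psi(\mu)$ (the latter connects $v_+(\mu)$ at $-\infty$ to $v_-(\mu)$ at $+\infty$). Multifronts. For $M\in\mathbb N$ and primary fronts $\psi_1,\dots,\psi_M$ (same $\mu$) such that the end state of $\psi_j$ at $+\infty$ equals that of $\psi_{j+1}$ at $-\infty$ for $j=1,\dots,M-1$, there is $N_0$ such that for each $\tilde n\ge N_0$ there is a nondegenerate solution $a_{\tilde n}+\sum_{j=1}^M\chi_{j,\tilde n}\psi_j(\cdot-j\tilde nT)$ of $(\ast)$ with $a_{\tilde n}\in H^2(\mathbb R)$, $\|a_{\tilde n}\|_{H^2}\to0$ as $\tilde n\to\infty$; here $\chi_{j,\tilde n}$, $j=1,\dots,M$, is a smooth partition of unity with $\tilde n$-uniformly bounded $W^{2,\infty}$-norms, $\chi_{1,\tilde n}$ supported on $(-\infty,\frac32\tilde nT+1)$, $\chi_{M,\tilde n}$ on $((M-\frac12)\tilde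 nT-1,\infty)$, $\chi_{j,\tilde n}$ on $((j-\frac12)\tilde nT-1,(j+\frac12)\tilde nT+1)$ for $2\le j\le M-1$ (and $\chi_{1,\tilde n}\equiv1$ if $M=1$). The multifront $\psi$ of the claim is one of these solutions (fixed $M$, $\tilde n$); it connects to the same end state $v$ at $\pm\infty$ if the end state of $\psi_1$ at $-\infty$ and that of $\psi_M$ at $+\infty$ both equal $v$ (so $\psi-v\in H^2(\mathbb R)$). For each (sufficiently large) $n$, $\chi_n:\mathbb R\to[0,1]$ is a smooth $nT$-periodic cut-off with $\|\chi_n\|_{W^{2,\infty}}\le1$ (maximum of sup norms of derivatives of order $\le2$), $\chi_n=1$ on $[-\frac n6T,\frac n6T]$, $\chi_n=0$ on $[-\frac n2T,-\frac n3T]\cup[\frac n3T,\frac n2T]$. *)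

(* Defs.v *)
From mathcomp Require Import all_boot all_order all_algebra.
From mathcomp Require Import all_classical all_reals all_analysis.

Set Implicit Arguments.
Unset Strict Implicit.
Unset Printing Implicit Defensive.

Import Order.TTheory GRing.Theory Num.Theory.
Import numFieldNormedType.Exports.

Local Open Scope classical_set_scope.
Local Open Scope ring_scope.

Definition C1 (R : realType) (f : R -> R) : Prop :=
  (forall x, derivable f x 1) /\ continuous (f^`())%classic.

Definition smooth (R : realType) (f : R -> R) : Prop :=
  forall (k : nat) (x : R), derivable (f^`(k))%classic x 1.

Definition even_function (R : realType) (f : R -> R) : Prop :=
  forall x, f (- x) = f x.

Definition odd_function (R : realType) (f : R -> R) : Prop :=
  forall x, f (- x) = - f x.

Definition vanishes_outside (R : realType) (f : R -> R) (D : set R) : Prop :=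
  forall x, ~ D x -> f x = 0.

Definition takes_values_in_01 (R : realType) (f : R -> R) : Prop :=
  forall x, 0 <= f x <= 1.

(* Bound on the W^{2,oo}-norm (maximum of the sup norms of the derivatives of
   order at most 2); it is only applied to smooth functions. *)
Definition W2oo_norm_le (R : realType) (f : R -> R) (K : R) : Prop :=
  forall (k : nat) (x : R), (k <= 2)%N -> `|(f^`(k))%classic x| <= K.

(* Elements of L^2 and H^2 are represented by Borel measurable functions; the
   notions below do not depend on the representative. *)
Definition L2 (R : realType) (D : set R) : set (R -> R) :=
  [set f | (f \_ D)%FUN \in Lfun (@lebesgue_measure R) 2%:E].

Definition L2norm (R : realType) (D : set R) (f : R -> R) : R :=
  fine (Lnorm (@lebesgue_measure R) 2%:E (EFin \o (f \_ D)%FUN)).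

Definition test_function (R : realType) (phi : R -> R) : Prop :=
  C1 phi /\ exists r : R, vanishes_outside phi `[- r, r].

(* g is a weak derivative of f on the real line. As in Brezis' "Functional
   Analysis, Sobolev Spaces and Partial Differential Equations", the test
   functions are the compactly supported C^1 functions. *)
Definition is_wderiv (R : realType) (f g : R -> R) : Prop :=
  [/\ locally_integrable setT f, locally_integrable setT g &
      forall phi : R -> R, test_function phi ->
        \int[@lebesgue_measure R]_(x in setT) (f x * (phi^`())%classic x) =
        - \int[@lebesgue_measure R]_(x in setT) (g x * phi x)].

Definition weakly_differentiable (R : realType) (f : R -> R) : Prop :=
  exists g, is_wderiv f g.

(* A weak derivative of f, chosen among the almost everywhere equal ones;
   0 when f is not weakly differentiable. *)
Definition wderiv (R : realType) (f : R -> R) : R -> R :=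
  xget (cst 0) [set g | is_wderiv f g].

Definition twice_weakly_differentiable (R : realType) (f : R -> R) : Prop :=
  weakly_differentiable f /\ weakly_differentiable (wderiv f).

Definition L2_upto_order2 (R : realType) (D : set R) (f : R -> R) : Prop :=
  [/\ L2 D f, L2 D (wderiv f) & L2 D (wderiv (wderiv f))].

Definition H2 (R : realType) : set (R -> R) :=
  [set f | twice_weakly_differentiable f /\ L2_upto_order2 setT f].

Definition H2per (R : realType) (L : R) : set (R -> R) :=
  [set f | [/\ periodic f L, twice_weakly_differentiable f &
               forall a b : R, L2_upto_order2 `[a, b] f]].

Definition H2norm_on (R : realType) (D : set R) (f : R -> R) : R :=
  Num.sqrt (L2norm D f ^+ 2 + L2norm D (wderiv f) ^+ 2
            + L2norm D (wderiv (wderiv f)) ^+ 2).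

Definition H2norm (R : realType) (f : R -> R) : R := H2norm_on setT f.

Definition H2per_norm (R : realType) (L : R) (f : R -> R) : R :=
  H2norm_on `[0, L] f.

Definition GP_solution (R : realType) (omega : R) (V : R -> R) (mu : R)
    (psi : R -> R) : Prop :=
  [/\ forall x, derivable psi x 1, forall x, derivable (psi^`())%classic x 1 &
      forall x, - (psi^`(2))%classic x + mu * V x * psi x + omega * psi x
                + psi x ^+ 3 = 0].

Definition linearization (R : realType) (omega : R) (V : R -> R) (mu : R)
    (psi phi : R -> R) : R -> R :=
  fun x => - wderiv (wderiv phi) x + mu * V x * phi x + omega * phi x
           + 3 * psi x ^+ 2 * phi x.

(* Invertibility on L^2(R) of an unbounded operator with domain H^2(R), that
   is, 0 belongs to its resolvent set: it is injective and surjective, with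
   bounded inverse. *)
Definition invertible_on_L2 (R : realType) (A : (R -> R) -> (R -> R)) : Prop :=
  [/\ forall phi, H2 phi ->
        {ae @lebesgue_measure R, forall x, A phi x = 0} ->
        {ae @lebesgue_measure R, forall x, phi x = 0},
      forall f, L2 setT f -> exists2 phi, H2 phi &
        {ae @lebesgue_measure R, forall x, A phi x = f x} &
      exists K : R, forall phi, H2 phi ->
        L2norm setT phi <= K * L2norm setT (A phi)].

Definition nondegenerate_solution (R : realType) (omega : R) (V : R -> R)
    (mu : R) (psi : R -> R) : Prop :=
  [/\ GP_solution omega V mu psi, exists K : R, forall x, `|psi x| <= K &
      invertible_on_L2 (linearization omega V mu psi)].

Definition tanh (R : realType) (x : R) : R :=
  (expR x - expR (- x)) / (expR x + expR (- x)).

Definition psi0 (R : realType) (omega : R) (x : R) : R :=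
  Num.sqrt (- omega) * tanh (Num.sqrt (- omega / 2) * x).

Definition end_partition (R : realType) (chip chim : R -> R) : Prop :=
  [/\ smooth chip /\ smooth chim,
      takes_values_in_01 chip /\ takes_values_in_01 chim,
      forall x, chip x + chim x = 1,
      vanishes_outside chip `]-1, +oo[ /\ vanishes_outside chim `]-oo, 1[ &
      forall x, chip x = chim (- x)].

Record front (R : realType) := Front {
  profile : R -> R;
  state_minus : R -> R;  (* end state at -oo *)
  state_plus : R -> R    (* end state at +oo *)
}.

Definition primary_family (R : realType) (omega T : R) (V chip chim : R -> R)
    (C mu0 : R) (Psi Vp Vm : R -> R -> R) : Prop :=
  forall mu : R, 0 < mu < mu0 ->
  [/\ nondegenerate_solution omega V mu (Psi mu) /\ odd_function (Psi mu),
      (Lnorm (@lebesgue_measure R) +oo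
         (fun x => (Psi mu x - psi0 omega x)%:E) <= (C * mu)%:E)%E,
      H2 (fun x => chip x * (Psi mu x - Vp mu x)) /\
      H2 (fun x => chim x * (Psi mu x - Vm mu x)),
      (forall x, Vm mu x = - Vp mu x) /\
      [/\ H2per T (Vp mu), even_function (Vp mu),
          GP_solution omega V mu (Vp mu) &
          H2per_norm T (fun x => Vp mu x - Num.sqrt (- omega)) <= C * mu] &
      [/\ H2per T (Vm mu), even_function (Vm mu),
          GP_solution omega V mu (Vm mu) &
          H2per_norm T (fun x => Vm mu x + Num.sqrt (- omega)) <= C * mu]].

Definition primary_fronts (R : realType) (Psi Vp Vm : R -> R -> R) (mu : R) :
    set (front R) :=
  [set phi | phi = Front (Psi mu) (Vm mu) (Vp mu) \/
             phi = Front (fun x => - Psi mu x) (Vp mu) (Vm mu)].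

(* The functions chi j, 1 <= j <= M, for a given separation parameter n; for
   M = 1 the support conditions are void and the sum condition is chi 1 = 1. *)
Definition multifront_partition (R : realType) (T : R) (M n : nat)
    (chi : nat -> R -> R) : Prop :=
  [/\ forall j, (1 <= j <= M)%N -> smooth (chi j) /\ takes_values_in_01 (chi j),
      forall x, \sum_(1 <= j < M.+1) chi j x = 1,
      forall j, (1 < j <= M)%N ->
        vanishes_outside (chi j) `](j%:R - 1 / 2) * n%:R * T - 1, +oo[ &
      forall j, (1 <= j < M)%N ->
        vanishes_outside (chi j) `]-oo, (j%:R + 1 / 2) * n%:R * T + 1[].

Definition multifront_profile (R : realType) (T : R) (M n : nat)
    (chi : nat -> R -> R) (phi : nat -> front R) (a : R -> R) : R -> R :=
  fun x => a x + \sum_(1 <= j < M.+1)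
                   chi j x * profile (phi j) (x - j%:R * n%:R * T).

Definition multifront_family (R : realType) (omega T : R) (V : R -> R) (mu : R)
    (M : nat) (phi : nat -> front R) (N0 : nat) (chi : nat -> nat -> R -> R)
    (a : nat -> R -> R) : Prop :=
  [/\ forall n, (N0 <= n)%N -> multifront_partition T M n (chi n),
      exists K : R, forall n j, (N0 <= n)%N -> (1 <= j <= M)%N ->
        W2oo_norm_le (chi n j) K,
      forall n, (N0 <= n)%N -> H2 (a n) /\
        nondegenerate_solution omega V mu
          (multifront_profile T M n (chi n) phi (a n)) &
      H2norm (a n) @[n --> \oo] --> (0 : R)].

Definition multifront (R : realType) (omega T : R) (V chip chim : R -> R)
    (mu : R) (psi vminus vplus : R -> R) : Prop :=
  exists (C mu0 : R) (Psi Vp Vm : R -> R -> R) (M : nat) (phi : nat -> front R)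
    (N0 : nat) (chi : nat -> nat -> R -> R) (a : nat -> R -> R) (n : nat),
  [/\ [/\ 0 < C, 0 < mu0 & primary_family omega T V chip chim C mu0 Psi Vp Vm],
      0 < mu < mu0,
      [/\ (1 <= M)%N,
          forall j, (1 <= j <= M)%N -> primary_fronts Psi Vp Vm mu (phi j) &
          forall j, (1 <= j < M)%N ->
            state_plus (phi j) = state_minus (phi j.+1)],
      multifront_family omega T V mu M phi N0 chi a /\
      ((N0 <= n)%N /\ psi = multifront_profile T M n (chi n) phi (a n)) &
      state_minus (phi 1%N) = vminus /\ state_plus (phi M) = vplus].

Definition periodic_cutoff (R : realType) (T : R) (n : nat) (chi : R -> R) :
    Prop :=
  [/\ smooth chi /\ takes_values_in_01 chi, periodic chi (n%:R * T),
      W2oo_norm_le chi 1,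
      forall x, - (n%:R / 6 * T) <= x <= n%:R / 6 * T -> chi x = 1 &
      forall x, - (n%:R / 2 * T) <= x <= - (n%:R / 3 * T) \/
                n%:R / 3 * T <= x <= n%:R / 2 * T -> chi x = 0].

(* Main.v *)
(** Put [W = mu V + omega], [S = nT] and [d = psi - v].  Of the nondegeneracy
    of [psi] only the bound [|phi| <= K |L phi|] in [L^2(R)], with
    [L phi = - phi'' + (W + 3 psi^2) phi], is needed.  The equation turns
    [d \in L^2] near [+oo] and [-oo] into decay of [d] and [d'].  Gluing [psi]
    and [v] gives an [S]-periodic function [w] whose residual is bounded by the
    tails of [d], and [w] is uniformly close to [psi] on [-S/2, 5S/6].  Two
    bumps of width proportional to [S], centred at [0] and [S/2], cover a period
    and live in that interval, so cutting off transfers the bound to the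
    [S]-periodic linearization at [w], with a constant independent of [S].  The
    periodic linear problem is then injective, hence solvable because it reduces
    to a 2 x 2 system for the initial data, and a contraction in the [L^2] and
    sup norms produces the correction [a]. *)

Require Import Defs.
From mathcomp Require Import all_boot all_order all_algebra.
From mathcomp Require Import all_classical all_reals all_analysis.
From mathcomp Require Import measurable_realfun ring lra.
Import Order.TTheory GRing.Theory Num.Theory.
Import numFieldNormedType.Exports.
Local Open Scope classical_set_scope.
Local Open Scope ring_scope.
Set Implicit Arguments.
Unset Strict Implicit.
Unset Printing Implicit Defensive.

(** The obstacle is uniformity: the bound for the periodic linearization must not degrade as the
    period grows. Cutting off at scale [S] gives every commutator term a factor [1/S], and the first
    derivative in these terms is controlled by the energy identity. The bump centred at [S/2] lives
    where [psi] is already close to [v], so it still sees the linearization at [psi] up to a small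
    error. This is why [w] is compared with [psi] on ]S/2, 5S/6] too, although [w] is there a
    translate of its values on the left tail. The functions estimated are all C^2, so the analysis
    runs on primitives of continuous functions and squared integrals over segments. Weak derivatives
    and Lebesgue norms enter only at the two ends: to read off the bound for [L] and the square
    integrability of [d] from the hypotheses, and to express the H^2-norm of the correction. Apart
    from the residual, the remainder is at least quadratic in the correction, so the one-dimensional
    sup bound, obtained from the L^2 bounds of [a] and [a'], closes the contraction. *)

(** * Differentiation and continuity on the line *)

Definition hasder (R : realType) (f f' : R -> R) : Prop :=
  forall x : R, is_derive x (1 : R) f (f' x).

Section hasder_theory.
Context {R : realType}.
Implicit Types (f g : R -> R) (c : R).

Lemma hasder_eq f f' g' : hasder f f' -> (forall x, f' x = g' x) -> hasder f g'.
Proof. by move=> h e x; rewrite -e; exact: h. Qed.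

Lemma hasder_derivable f f' : hasder f f' -> forall x, derivable f x 1.
Proof. by move=> h x; have [] := h x. Qed.

Lemma hasder_derive1 f f' : hasder f f' -> (f^`())%classic = f'.
Proof.
by move=> h; apply/funext => x; rewrite derive1E; have [] := h x.
Qed.

Lemma derivable_hasder f : (forall x, derivable f x 1) -> hasder f (f^`())%classic.
Proof. by move=> h x; rewrite derive1E; apply/derivableP/h. Qed.

Lemma hasder_cont f f' : hasder f f' -> continuous f.
Proof.
move=> h x; apply: differentiable_continuous; apply/derivable1_diffP.
exact: hasder_derivable h x.
Qed.

Lemma hasder_near f g f' : hasder f f' ->
  forall x, (\forall y \near x, f y = g y) -> is_derive x (1 : R) g (f' x).
Proof. by move=> h x e; apply: near_eq_is_derive e (h x). Qed.

Lemma hasder_cst c : hasder (fun=> c) (fun=> 0).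
Proof. by move=> x; exact: is_derive_cst. Qed.

Lemma hasder_id : hasder (fun x : R => x) (fun=> 1).
Proof. by move=> x; exact: is_derive_id. Qed.

Lemma hasderD f g f' g' : hasder f f' -> hasder g g' ->
  hasder (fun x => f x + g x) (fun x => f' x + g' x).
Proof. by move=> hf hg x; apply: is_deriveD. Qed.

Lemma hasderN f f' : hasder f f' -> hasder (fun x => - f x) (fun x => - f' x).
Proof. by move=> hf x; apply: is_deriveN. Qed.

Lemma hasderM f g f' g' : hasder f f' -> hasder g g' ->
  hasder (fun x => f x * g x) (fun x => f x * g' x + g x * f' x).
Proof. by move=> hf hg x; apply: is_deriveM. Qed.

Lemma hasderX f f' n : hasder f f' ->
  hasder (fun x => f x ^+ n) (fun x => n%:R * f x ^+ n.-1 * f' x).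
Proof.
move=> hf x; elim: n => [|n IH].
  by under eq_fun do rewrite expr0; rewrite !mul0r; exact: is_derive_cst.
under eq_fun do rewrite exprS.
have -> : n.+1%:R * f x ^+ n.+1.-1 * f' x
  = f x *: (n%:R * f x ^+ n.-1 * f' x) + f x ^+ n *: f' x.
  rewrite /GRing.scale /=; case: n {IH} => [|n] /=; first by rewrite !expr0; ring.
  by rewrite -natr1 exprS; ring.
exact: is_deriveM.
Qed.

Lemma hasder_comp f g f' g' : hasder f f' -> hasder g g' ->
  hasder (fun x => f (g x)) (fun x => f' (g x) * g' x).
Proof. by move=> hf hg x; apply: is_derive1_comp. Qed.

Lemma hasder_expR : hasder (@expR R) (@expR R).
Proof. by move=> x; exact: is_derive_expR. Qed.

Lemma hasder_shift f f' c : hasder f f' ->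
  hasder (fun x => f (x + c)) (fun x => f' (x + c)).
Proof.
move=> hf; apply: (hasder_eq (hasder_comp hf (hasderD hasder_id (hasder_cst c)))).
by move=> x; rewrite addr0 mulr1.
Qed.

Lemma hasder_opp_arg f f' : hasder f f' ->
  hasder (fun x => f (- x)) (fun x => - f' (- x)).
Proof.
move=> hf; apply: (hasder_eq (hasder_comp hf (hasderN hasder_id))).
by move=> x; rewrite mulrN1.
Qed.

Lemma hasder_unique f f' g' : hasder f f' -> hasder f g' -> f' = g'.
Proof. by move=> /hasder_derive1 <- /hasder_derive1. Qed.

Lemma cont_cst c : continuous (fun _ : R => c).
Proof. by move=> x; exact: cst_continuous. Qed.

Lemma cont_id : continuous (fun x : R => x).
Proof. by move=> x; exact: cvg_id. Qed.

Lemma contD f g : continuous f -> continuous g -> continuous (fun x => f x + g x).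
Proof. by move=> hf hg x; apply: continuousD; [exact: hf|exact: hg]. Qed.

Lemma contN f : continuous f -> continuous (fun x => - f x).
Proof. by move=> hf x; apply: continuousN; exact: hf. Qed.

Lemma contM f g : continuous f -> continuous g -> continuous (fun x => f x * g x).
Proof. by move=> hf hg x; apply: continuousM; [exact: hf|exact: hg]. Qed.

Lemma contX f n : continuous f -> continuous (fun x => f x ^+ n).
Proof.
move=> hf; elim: n => [|n IH]; first by under eq_fun do rewrite expr0; exact: cont_cst.
by under eq_fun do rewrite exprS; exact: contM.
Qed.

Lemma cont_comp f g : continuous f -> continuous g -> continuous (fun x => f (g x)).
Proof. by move=> hf hg x; apply: continuous_comp; [exact: hg|exact: hf]. Qed.

Lemma cont_norm f : continuous f -> continuous (fun x => `|f x|).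
Proof. by move=> hf x; apply: cvg_norm; exact: hf. Qed.

End hasder_theory.

Ltac cont :=
  first [ match goal with
          | h : continuous ?f |- continuous ?f => exact: h
          | h : continuous ?f |- continuous (fun x => ?f x) => exact: h
          | h : hasder ?f _ |- continuous ?f => exact: (hasder_cont h)
          | h : hasder ?f _ |- continuous (fun x => ?f x) => exact: (hasder_cont h)
          end
        | lazymatch goal with
          | |- continuous (fun=> ?c) => exact: cont_cst
          | |- continuous (fun x => x) => exact: cont_id
          | |- continuous (fun x => @?f x + @?g x) => apply: (@contD _ f g); cont
          | |- continuous (fun x => - @?f x) => apply: (@contN _ f); cont
          | |- continuous (fun x => @?f x * @?g x) => apply: (@contM _ f g); cont
          | |- continuous (fun x => @?f x ^+ ?n) => apply: (@contX _ f n); cont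
          | |- continuous (fun x => `|@?f x|) => apply: (@cont_norm _ f); cont
          end
        | match goal with
          | h : continuous ?f |- continuous (fun x => ?f (@?g x)) =>
              apply: (@cont_comp _ f g h); cont
          | h : hasder ?f _ |- continuous (fun x => ?f (@?g x)) =>
              apply: (@cont_comp _ f g (hasder_cont h)); cont
          end
        | assumption
        | idtac ].

Ltac hder0 :=
  first [ match goal with
          | h : hasder ?f _ |- hasder ?f _ => exact: h
          | h : hasder ?f _ |- hasder (fun x => ?f x) _ => exact: h
          | h : hasder ?f _ |- hasder (fun x => ?f (x + _)) _ => exact: (hasder_shift _ h)
          end
        | lazymatch goal with
          | |- hasder (fun=> ?c) _ => exact: hasder_cst
          | |- hasder (fun x => x) _ => exact: hasder_id
          | |- hasder (fun x => @?f x + @?g x) _ => apply: (@hasderD _ f g); hder0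
          | |- hasder (fun x => - @?f x) _ => apply: (@hasderN _ f); hder0
          | |- hasder (fun x => @?f x * @?g x) _ => apply: (@hasderM _ f g); hder0
          | |- hasder (fun x => @?f x ^+ ?n) _ => apply: (@hasderX _ f _ n); hder0
          end
        | eassumption
        | idtac ].
(** The derivative is left as an existential variable that [hder0] fills in by structure; what
    remains is a pointwise identity, usually settled by [ring]. *)
Ltac hder := apply: hasder_eq; [hder0|cbv beta].

Section monotone.
Context {R : realType}.
Implicit Types (f g F G : R -> R) (c a b : R).

Lemma hasder_MVT f f' a b : hasder f f' -> a <= b ->
  exists2 c, a <= c <= b & f b - f a = f' c * (b - a).
Proof.
move=> hf ab; have [|c] := @MVT_segment R f f' a b ab (fun x _ => hf x).
  by apply: continuous_subspaceT; exact: hasder_cont hf.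
by rewrite in_itv /= => hc e; exists c.
Qed.

Lemma hasder_ge0_le f f' a b : hasder f f' -> a <= b ->
  (forall x, a <= x <= b -> 0 <= f' x) -> f a <= f b.
Proof.
move=> hf ab h; have [c cab e] := hasder_MVT hf ab.
by rewrite -subr_ge0 e mulr_ge0 ?subr_ge0 // h.
Qed.

Lemma hasder0_cst f : hasder f (fun=> 0) -> forall x y, f x = f y.
Proof. by move=> h x y; exact: is_derive_0_is_cst. Qed.

Lemma hasder_itv0_cst f f' a b : hasder f f' -> a <= b ->
  (forall x, a <= x <= b -> f' x = 0) -> f a = f b.
Proof.
move=> hf ab h; have [c cab e] := hasder_MVT hf ab.
by apply/eqP; rewrite eq_sym -subr_eq0 e h ?mul0r.
Qed.

Lemma hasder_inj F G f : hasder F f -> hasder G f -> F 0 = G 0 -> F = G.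
Proof.
move=> hF hG e; apply/funext => x; apply/eqP; rewrite -subr_eq0; apply/eqP.
have h : hasder (fun x => F x - G x) (fun=> 0).
  by hder; move=> y; ring.
by rewrite (hasder0_cst h x 0) e subrr.
Qed.

End monotone.

(** * Integrals of continuous functions *)

Section antiderivative.
Context {R : realType}.
Notation mu := (@lebesgue_measure R).
Implicit Types (f g F G : R -> R) (a b c : R).

Lemma cont_integrable f a b : continuous f -> mu.-integrable `[a, b] (EFin \o f).
Proof.
move=> cf; apply: continuous_compact_integrable; first exact: segment_compact.
exact: continuous_subspaceT.
Qed.

(** The fundamental theorem gives an antiderivative inside each interval ]-r, r[. Normalised at 0,
    these agree on overlaps by the mean value theorem and glue to one function on the line. *)
Lemma antiderivative_exists f : continuous f -> exists2 F, F 0 = 0 & hasder F f.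
Proof.
move=> cf.
have loc r : exists2 F, F 0 = 0 & forall x, `|x| < r -> is_derive x (1 : R) F (f x).
  pose F0 x := \int[mu]_(t in `[- r, x]) f t.
  have dF0 x : `|x| < r -> is_derive x (1 : R) F0 (f x).
    rewrite ltr_norml => /andP[h1 h2].
    have [d1 d2] := @continuous_FTC1_closed R f (- r) x r h2 (cont_integrable _ _ cf) h1 (cf x).
    by rewrite -d2 derive1E; apply/derivableP.
  exists (fun x => F0 x - F0 0); first by rewrite subrr.
  move=> x hx; rewrite -[f x]subr0.
  exact: (@is_deriveB _ _ _ F0 (cst (F0 0)) x 1 _ _ (dF0 x hx) (is_derive_cst _ _ _)).
have /choice[G hG] r : exists F : R -> R, F 0 = 0 /\
    forall x, `|x| < r -> is_derive x (1 : R) F (f x).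
  by have [F F0 hF] := loc r; exists F.
have Geq r s x : `|x| < r -> r <= s -> G r x = G s x.
  move=> xr rs; pose D y := G r y - G s y.
  have dD y : `|y| <= `|x| -> is_derive y (1 : R) D 0.
    move=> yx; rewrite -(subrr (f y)).
    have yr : `|y| < r by exact: le_lt_trans xr.
    apply: (@is_deriveB _ _ _ (G r) (G s)); first by apply: (hG r).2.
    by apply: (hG s).2; exact: lt_le_trans rs.
  apply/eqP; rewrite -subr_eq0; apply/eqP; rewrite -/(D x).
  have D0 : D 0 = 0 by rewrite /D (hG r).1 (hG s).1 subrr.
  have Dc a b : `|a| <= `|x| -> `|b| <= `|x| -> a <= b -> D a = D b.
    move=> ax bx ab.
    have inab y : a <= y <= b -> `|y| <= `|x|.
      move: ax bx; rewrite !ler_norml => /andP[? ?] /andP[? ?] /andP[? ?].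
      by apply/andP; split; lra.
    have [|||c _ e] := @MVT_segment R D (fun=> 0) a b.
    - by [].
    - by move=> y; rewrite in_itv /= => /andP[h1 h2]; apply: dD; apply: inab; rewrite !ltW.
    - apply: derivable_within_continuous => y; rewrite in_itv /= => h.
      by have [] := dD _ (inab _ h).
    - by move: e; rewrite mul0r => /eqP; rewrite subr_eq0 => /eqP.
  rewrite -D0; case: (leP 0 x) => hx.
    by apply/esym; apply: Dc; rewrite ?normr0.
  by apply: Dc; rewrite ?normr0 // ltW.
(* The radius varies with the point, but near [x] this function coincides with the single function
   [G (|x| + 2)]. *)
exists (fun x => G (`|x| + 1) x); first by rewrite (hG _).1.
move=> x; have hx : is_derive x (1 : R) (G (`|x| + 2)) (f x).
  by apply: (hG _).2; lra.
apply: near_eq_is_derive hx.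
have B : \forall y \near x, ball x 1 y by apply: nbhsx_ballx.
near=> y.
have : ball x 1 y by near: y.
rewrite /ball /= => h.
apply/esym; apply: Geq; first by lra.
have := ler_normD (y - x) x; rewrite subrK (distrC y x); lra.
Unshelve. all: by end_near. Qed.

(* The antiderivative of a continuous f that vanishes at 0 (junk value 0 when f
   has no antiderivative). *)
Definition prim f : R -> R := xget (cst 0) [set F | F 0 = 0 /\ hasder F f].

Lemma primP f : continuous f -> prim f 0 = 0 /\ hasder (prim f) f.
Proof.
move=> cf; have [F F0 hF] := antiderivative_exists cf.
by apply: (@xgetPex _ (cst 0) [set F | F 0 = 0 /\ hasder F f]); exists F.
Qed.

Lemma prim0 f : continuous f -> prim f 0 = 0.
Proof. by move=> /primP[]. Qed.

Lemma hasder_prim f : continuous f -> hasder (prim f) f.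
Proof. by move=> /primP[]. Qed.

Lemma prim_unique F f : continuous f -> hasder F f -> F 0 = 0 -> F = prim f.
Proof.
by move=> cf hF F0; apply: (hasder_inj hF (hasder_prim cf)); rewrite prim0.
Qed.

(* For continuous f this is the integral of f from a to b, also when b < a. *)
Definition ig a b f : R := prim f b - prim f a.

Lemma ig_ftc F f a b : continuous f -> hasder F f -> ig a b f = F b - F a.
Proof.
move=> cf hF; rewrite /ig -(@prim_unique (fun x => F x - F 0) f) //.
- by ring.
- by hder; move=> x; ring.
- by rewrite subrr.
Qed.

Lemma igD f g a b : continuous f -> continuous g ->
  ig a b (fun x => f x + g x) = ig a b f + ig a b g.
Proof.
move=> cf cg; have hf := hasder_prim cf; have hg := hasder_prim cg.
rewrite (@ig_ftc (fun x => prim f x + prim g x)); [by rewrite /ig; ring|by cont|].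
exact: hasderD.
Qed.

Lemma igZ c f a b : continuous f -> ig a b (fun x => c * f x) = c * ig a b f.
Proof.
move=> cf; have hf := hasder_prim cf.
rewrite (@ig_ftc (fun x => c * prim f x)); [by rewrite /ig; ring|by cont|].
by hder; move=> x; ring.
Qed.

Lemma ig_cst c a b : ig a b (fun=> c) = c * (b - a).
Proof.
rewrite (@ig_ftc (fun x => c * x)); [by ring|by cont|].
by hder; move=> x; ring.
Qed.

Lemma ig_le f g a b : continuous f -> continuous g -> a <= b ->
  (forall x, a <= x <= b -> f x <= g x) -> ig a b f <= ig a b g.
Proof.
move=> cf cg ab fg; have hf := hasder_prim cf; have hg := hasder_prim cg.
have h : hasder (fun x => prim g x - prim f x) (fun x => g x - f x).
  by hder; move=> x; ring.
have := hasder_ge0_le h ab; rewrite /ig => H.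
suff : prim g a - prim f a <= prim g b - prim f b by lra.
by apply: H => x /fg; rewrite subr_ge0.
Qed.

Lemma ig_ge0 f a b : continuous f -> a <= b ->
  (forall x, a <= x <= b -> 0 <= f x) -> 0 <= ig a b f.
Proof.
move=> cf ab h; have := @ig_le (fun=> 0) f a b (@cont_cst R 0) cf ab h.
by rewrite ig_cst mul0r.
Qed.

Lemma ig_eq f g a b : continuous f -> continuous g -> a <= b ->
  (forall x, a <= x <= b -> f x = g x) -> ig a b f = ig a b g.
Proof.
move=> cf cg ab h; apply/eqP; rewrite eq_le.
by apply/andP; split; apply: ig_le => // x /h ->.
Qed.

Lemma ig_split f a b c : ig a c f = ig a b f + ig b c f.
Proof. by rewrite /ig; ring. Qed.

Lemma ig_subset f a b c d : continuous f -> (forall x, 0 <= f x) ->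
  c <= a -> a <= b -> b <= d -> ig a b f <= ig c d f.
Proof.
move=> cf f0 ca ab bd.
have := @ig_ge0 f c a cf ca (fun x _ => f0 x).
have := @ig_ge0 f b d cf bd (fun x _ => f0 x).
by rewrite /ig; lra.
Qed.

Lemma ig_shift f a b c : continuous f ->
  ig a b (fun x => f (x + c)) = ig (a + c) (b + c) f.
Proof.
move=> cf; have hf := hasder_prim cf.
by rewrite (@ig_ftc (fun x => prim f (x + c))) //; [cont; cont|hder].
Qed.

Lemma ig_periodic f S a : continuous f -> periodic f S ->
  ig a (a + S) f = ig 0 S f.
Proof.
move=> cf pf; have hf := hasder_prim cf.
have h : hasder (fun x => prim f (x + S) - prim f x) (fun=> 0).
  by hder; move=> x; rewrite pf; ring.
by rewrite /ig (hasder0_cst h a 0) add0r.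
Qed.

Lemma ig_integral f a b : continuous f -> a < b ->
  (\int[mu]_(x in `[a, b]) (f x)%:E = (ig a b f)%:E)%E.
Proof.
move=> cf ab; have hf := hasder_prim cf.
rewrite (continuous_FTC2 ab (continuous_subspaceT cf) (F := prim f)).
- by rewrite /ig EFinB.
- split.
  + by move=> x _; exact: hasder_derivable hf x.
  + by apply: cvg_at_right_filter; exact: (hasder_cont hf).
  + by apply: cvg_at_left_filter; exact: (hasder_cont hf).
- by move=> x _; rewrite (hasder_derive1 hf).
Qed.

End antiderivative.

(** * Limits at geometric rate and periodic functions *)

Section limits.
Context {R : realType}.
Implicit Types (f g : R -> R) (a b c x : R).

Lemma half_pow_small (C e : R) : 0 < e -> exists k : nat, C * 2^-1 ^+ k < e.
Proof.
move=> e0; have [n hn] : exists n : nat, C / e < n%:R.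
  exists (Num.bound (C / e)); have [h|h] := leP 0 (C / e); first exact: archi_boundP.
  exact: lt_le_trans h (ler0n _ _).
exists n; rewrite exprVn ltr_pdivrMr ?exprn_gt0 // mulrC -ltr_pdivrMr //.
apply: (lt_le_trans hn); rewrite -natrX ler_nat; exact/ltnW/ltn_expl.
Qed.

Lemma le_half_pow (a b C : R) : (forall k : nat, a <= b + C * 2^-1 ^+ k) -> a <= b.
Proof.
move=> h; rewrite leNgt; apply/negP => ba.
have [k hk] := @half_pow_small C (a - b) ltac:(lra).
by have := h k; lra.
Qed.

Lemma eq_half_pow (a b C : R) : (forall k : nat, `|a - b| <= C * 2^-1 ^+ k) -> a = b.
Proof.
move=> h; have : `|a - b| <= 0 by apply: (@le_half_pow _ _ C) => k; rewrite add0r.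
by rewrite normr_le0 subr_eq0 => /eqP.
Qed.

(** At each point [u k - 2 W 2^-k] increases with [k], [u k + 2 W 2^-k] decreases, and the former
    stays below the latter; the limit is the supremum of the lower sequence. [W] may depend on the
    point, as the weighted Picard iteration requires. *)
Lemma geometric_limit (u : nat -> R -> R) (W : R -> R) :
  (forall k x, `|u k.+1 x - u k x| <= W x * 2^-1 ^+ k) ->
  exists l : R -> R, forall k x, `|u k x - l x| <= 2 * W x * 2^-1 ^+ k.
Proof.
move=> hu; pose v x k := u k x - 2 * W x * 2^-1 ^+ k.
have W0 x : 0 <= W x by apply: le_trans (normr_ge0 _) _; have := hu 0%N x; rewrite expr0 mulr1; exact.
have p0 k : 0 <= (2^-1 : R) ^+ k by rewrite exprn_ge0.
pose w x k := u k x + 2 * W x * 2^-1 ^+ k.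
have vS x k : v x k <= v x k.+1.
  by have := hu k x; rewrite /v exprS ler_norml => /andP[]; lra.
have wS x k : w x k.+1 <= w x k.
  by have := hu k x; rewrite /w exprS ler_norml => /andP[]; lra.
have vm x k m : v x k <= v x (k + m)%N.
  by elim: m => [|m IH]; rewrite ?addn0 // addnS (le_trans IH).
have wm x k m : w x (k + m)%N <= w x k.
  by elim: m => [|m IH]; rewrite ?addn0 // addnS (le_trans _ IH).
have vw x k m : v x k <= w x m.
  apply: (le_trans (vm x k m)); apply: le_trans (wm x m k); rewrite addnC /v /w.
  by have := mulr_ge0 (W0 x) (p0 (m + k)%N); lra.
pose E x := [set v x k | k in [set: nat]].
have ubE x k : ubound (E x) (w x k) by move=> _ [m _ <-].
exists (fun x => sup (E x)) => k x.
have h1 : v x k <= sup (E x).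
  by apply: ub_le_sup; [exists (w x 0%N); exact: ubE|exists k].
have h2 : sup (E x) <= w x k by apply: ge_sup; [exists (v x 0%N); exists 0%N|exact: ubE].
by move: h1 h2; rewrite /v /w ler_norml => h1 h2; apply/andP; split; lra.
Qed.

(** Continuity of [W] makes it locally bounded, so the convergence is locally uniform. *)
Lemma geometric_limit_cont (u : nat -> R -> R) (W l : R -> R) :
  (forall k, continuous (u k)) -> continuous W ->
  (forall k x, `|u k x - l x| <= W x * 2^-1 ^+ k) -> continuous l.
Proof.
move=> cu cW h x; apply/cvgrPdist_lt => e e0.
have [k hk] := @half_pow_small (W x + 1) (e / 3) ltac:(lra).
have /cvgrPdist_lt/(_ 1 ltr01) hW := cW x.
have /cvgrPdist_lt/(_ (e / 3) ltac:(lra)) hU := cu k x.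
near=> y.
have h1 : `|W x - W y| < 1 by near: y; exact: hW.
have h2 : `|u k x - u k y| < e / 3 by near: y; exact: hU.
have p0 : 0 <= (2^-1 : R) ^+ k by rewrite exprn_ge0.
have h3 : W y * 2^-1 ^+ k <= (W x + 1) * 2^-1 ^+ k.
  by apply: ler_wpM2r => //; move: h1; rewrite ltr_norml => /andP[]; lra.
have h4 : W x * 2^-1 ^+ k <= (W x + 1) * 2^-1 ^+ k by apply: ler_wpM2r => //; lra.
have := h k x; have := h k y; move: h2.
rewrite !ler_norml !ltr_norml => /andP[? ?] /andP[? ?] /andP[? ?].
by apply/andP; split; lra.
Unshelve. all: by end_near. Qed.

End limits.

Section periodic.
Context {R : realType}.
Implicit Types (f g : R -> R) (a b c x S : R).

Lemma periodicz f S : periodic f S -> forall (k : int) x, f (x + k%:~R * S) = f x.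
Proof.
move=> pf; have pos (n : nat) x : f (x + n%:R * S) = f x.
  elim: n => [|n IH]; first by rewrite mul0r addr0.
  by rewrite -natr1 mulrDl mul1r addrA pf IH.
move=> [n|n] x; first by rewrite -pmulrn pos.
by rewrite NegzE mulrNz -pmulrn mulNr -[LHS](pos n.+1) subrK.
Qed.

Lemma period_reduce S x a : 0 < S ->
  exists k : int, a <= x - k%:~R * S < a + S.
Proof.
move=> S0; exists (Num.floor ((x - a) / S)).
have := Num.Theory.floor_itv ((x - a) / S); move: (Num.floor _) => k.
rewrite intrD ler_pdivlMr // ltr_pdivrMr // mulr1z mulrDl mul1r => /andP[h1 h2].
by apply/andP; split; lra.
Qed.

Lemma cont_periodic_bounded f S : continuous f -> 0 < S -> periodic f S ->
  exists2 K : R, 0 <= K & forall x : R, `|f x| <= K.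
Proof.
move=> cf S0 pf.
have cn : {within `[0, S], continuous (fun x => `|f x|)}.
  by apply: continuous_subspaceT; cont.
have [c _ hc] := EVT_max (ltW S0) cn.
exists `|f c| => // x; have [k /andP[h1 h2]] := period_reduce x 0 S0.
rewrite -(subrK (k%:~R * S) x) (periodicz pf).
by apply: hc; rewrite in_itv /= h1 ltW //; lra.
Qed.

End periodic.

(** * Linear equations of second order *)

Section linear_ode.
Context {R : realType}.
Implicit Types (f g q y h : R -> R) (a b c x S C F Q s : R).

Lemma convex_min0 h h1 h2 : hasder h h1 -> hasder h1 h2 ->
  (forall x, 0 <= h2 x) -> h1 0 = 0 -> forall x, h 0 <= h x.
Proof.
move=> dh dh1 h2_ge0 h10 x.
have mono a b : a <= b -> h1 a <= h1 b by move=> ab; apply: (hasder_ge0_le dh1 ab).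
case: (leP 0 x) => x0.
  by apply: (hasder_ge0_le dh x0) => z /andP[z0 _]; rewrite -h10 mono.
have dn : hasder (fun t => - h t) (fun t => - h1 t) by exact: hasderN.
rewrite -lerN2; apply: (hasder_ge0_le dn (ltW x0)) => z /andP[_ z0].
by rewrite oppr_ge0 -h10 mono.
Qed.

(* wgt'' = c^2 wgt: in the norm weighted by 1/wgt, integrating twice has norm at
   most c^-2, so the Picard iteration contracts on the whole line for large c. *)
Definition wgt (c x : R) : R := expR (c * x) + expR (- (c * x)).

Lemma hasder_wgt c :
  hasder (wgt c) (fun x => c * (expR (c * x) - expR (- (c * x)))).
Proof.
have e := @hasder_expR R.
have l : hasder (fun x : R => c * x) (fun=> c).
  by hder; move=> x; ring.
apply: (hasder_eq (hasderD (hasder_comp e l) (hasder_comp e (hasderN l)))).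
by move=> x; ring.
Qed.

Lemma hasder2_wgt c :
  hasder (fun x => c * (expR (c * x) - expR (- (c * x)))) (fun x => c ^+ 2 * wgt c x).
Proof.
have e := @hasder_expR R.
have l : hasder (fun x : R => c * x) (fun=> c).
  by hder; move=> x; ring.
have h1 := hasder_comp e l; have h2 := hasder_comp e (hasderN l).
by hder; move=> x; rewrite /wgt; ring.
Qed.

Lemma wgt_ge1 c x : 1 <= wgt c x.
Proof.
rewrite /wgt; have := expR_ge1Dx (c * x); have := expR_ge1Dx (- (c * x)).
by lra.
Qed.

Lemma wgt_ge_norm c x : 1 <= c -> `|x| <= wgt c x.
Proof.
move=> c1; rewrite /wgt; have := expR_ge1Dx (c * x); have := expR_ge1Dx (- (c * x)).
have := expR_gt0 (c * x); have := expR_gt0 (- (c * x)).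
by case: (ger0P x) => x0; nra.
Qed.

(** For either sign, [C / c^2 wgt] minus the signed double primitive of [g] is convex with slope
    zero at 0, hence minimal there, and its value at 0 is non-negative. *)
Lemma prim2_bound c C g : 0 < c -> 0 <= C -> continuous g ->
  (forall x, `|g x| <= C * wgt c x) ->
  forall x, `|prim (prim g) x| <= C / c ^+ 2 * wgt c x.
Proof.
move=> c0 C0 cg hg x.
have h1 := hasder_prim cg; have cp : continuous (prim g) by cont.
have h2 := hasder_prim cp; have w1 := hasder_wgt c; have w2 := hasder2_wgt c.
have c2 : c ^+ 2 != 0 by rewrite expf_neq0 // gt_eqF.
have side (s : R) : `|s| = 1 -> s * prim (prim g) x <= C / c ^+ 2 * wgt c x.
  move=> s1; pose h z := C / c ^+ 2 * wgt c z - s * prim (prim g) z.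
  pose h' z := C / c ^+ 2 * (c * (expR (c * z) - expR (- (c * z)))) - s * prim g z.
  pose h'' z := C * wgt c z - s * g z.
  have dh : hasder h h'.
    by rewrite /h; hder; move=> z; rewrite /h'; ring.
  have dh' : hasder h' h''.
    by rewrite /h'; hder; move=> z; rewrite /h''; field; rewrite gt_eqF.
  have h''0 z : 0 <= h'' z.
    rewrite subr_ge0; apply: le_trans (hg z).
    by rewrite (le_trans (ler_norm _)) // normrM s1 mul1r.
  have h'0 : h' 0 = 0 by rewrite /h' !mulr0 oppr0 subrr prim0 // !mulr0 subrr.
  have := convex_min0 dh dh' h''0 h'0 x; rewrite /h prim0 // mulr0 subr0 => hh.
  suff : 0 <= C / c ^+ 2 * wgt c 0 by lra.
  have W1 := wgt_ge1 c 0; apply: mulr_ge0; last by lra.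
  by apply: divr_ge0 => //; rewrite exprn_ge0 // ltW.
have := side 1 (normr1 _); have := side (-1) ltac:(by rewrite normrN1).
by rewrite mul1r mulN1r ler_norml => ? ?; apply/andP; split; lra.
Qed.

Lemma primB f g : continuous f -> continuous g ->
  prim (fun x => f x - g x) = (fun x => prim f x - prim g x).
Proof.
move=> cf cg; have hf := hasder_prim cf; have hg := hasder_prim cg.
apply/esym/prim_unique; [by cont|exact: hasderD hf (hasderN hg)|].
by rewrite !prim0 // subrr.
Qed.

(** Fixed point of [G], which sends [y] to [p + s x] plus the double primitive of [q y - f]. Because
    the weight is global, no continuation of local solutions is needed. *)
Lemma linear_ivp q f Q F (p : R) s : continuous q -> continuous f ->
  (forall x, `|q x| <= Q) -> (forall x, `|f x| <= F) ->
  exists y y1, [/\ hasder y y1, hasder y1 (fun x => q x * y x - f x),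
    y 0 = p & y1 0 = s].
Proof.
move=> cq cf hq hf.
have Q0 : 0 <= Q by exact: le_trans (normr_ge0 _) (hq 0).
have F0 : 0 <= F by exact: le_trans (normr_ge0 _) (hf 0).
(* With this rate the contraction factor [Q / c^2] is at most 1/2, which matches the geometric rate
   expected by [geometric_limit]. *)
pose c := 1 + Q; have c1 : 1 <= c by rewrite /c; lra.
have c0 : 0 < c by lra.
have Qc : Q / c ^+ 2 <= 2^-1.
  by rewrite ler_pdivrMr ?exprn_gt0 // /c; nra.
have c21 : 1 / c ^+ 2 <= 1 by rewrite ler_pdivrMr ?exprn_gt0 //; nra.
pose rhs y := fun x => q x * y x - f x.
pose G y := fun x => p + s * x + prim (prim (rhs y)) x.
have crhs y : continuous y -> continuous (rhs y) by move=> cy; rewrite /rhs; cont.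
have cpr y : continuous y -> continuous (prim (rhs y)).
  by move=> cy; exact: hasder_cont (hasder_prim (crhs _ cy)).
have dG y : continuous y -> hasder (G y) (fun x => s + prim (rhs y) x).
  by move=> cy; have h := hasder_prim (cpr _ cy); rewrite /G; hder; move=> x; ring.
have cG y : continuous y -> continuous (G y) by move=> /dG; exact: hasder_cont.
have w1 x := wgt_ge1 c x.
have GB y z C : continuous y -> continuous z -> 0 <= C ->
    (forall x, `|y x - z x| <= C * wgt c x) ->
    forall x, `|G y x - G z x| <= C / 2 * wgt c x.
  move=> cy cz C0 hyz x.
  have -> : G y x - G z x = prim (prim (fun x => q x * (y x - z x))) x.
    have -> : (fun x => q x * (y x - z x)) = (fun x => rhs y x - rhs z x).
      by apply/funext => u; rewrite /rhs; ring.
    rewrite primB; [|exact: crhs|exact: crhs].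
    by rewrite primB; [rewrite /G; ring|exact: cpr|exact: cpr].
  have hb u : `|q u * (y u - z u)| <= (Q * C) * wgt c u.
    by rewrite normrM -mulrA; apply: ler_pM.
  apply: (le_trans (prim2_bound c0 (mulr_ge0 Q0 C0) _ hb x)); first by cont.
  apply: ler_wpM2r; first by have := w1 x; lra.
  by rewrite mulrAC mulrC; apply: ler_wpM2l.
pose y_ := fix y_ k := if k is k'.+1 then G (y_ k') else (fun _ : R => 0 : R).
have cy k : continuous (y_ k) by elim: k => [|k IH] /=; [exact: cont_cst|exact: cG].
pose C0 := `|p| + `|s| + F.
have C00 : 0 <= C0 by rewrite !addr_ge0.
have base x : `|y_ 1%N x - y_ 0%N x| <= C0 * wgt c x.
  rewrite /= subr0 /G; have -> : rhs (fun=> 0) = (fun x => - f x).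
    by apply/funext => u; rewrite /rhs mulr0 add0r.
  have hb u : `|- f u| <= F * wgt c u.
    by rewrite normrN (le_trans (hf u)) // ler_peMr.
  have b1 := prim2_bound c0 F0 (contN cf) hb x.
  have b2 : F / c ^+ 2 * wgt c x <= F * wgt c x.
    apply: ler_wpM2r; first by have := w1 x; lra.
    by rewrite -[leRHS]mulr1 ler_wpM2l // -div1r.
  have b3 : `|s * x| <= `|s| * wgt c x by rewrite normrM ler_wpM2l // wgt_ge_norm.
  have b4 : `|p| <= `|p| * wgt c x by rewrite ler_peMr.
  rewrite (le_trans (ler_normD _ _)) // (le_trans (lerD (ler_normD _ _) (lexx _))) //.
  by rewrite /C0; lra.
have step k x : `|y_ k.+1 x - y_ k x| <= C0 * wgt c x * 2^-1 ^+ k.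
  elim: k x => [x|k IH x]; first by rewrite expr0 mulr1; exact: base.
  have := GB _ _ (C0 * 2^-1 ^+ k) (cy k.+1) (cy k); rewrite mulr_ge0 ?exprn_ge0 //.
  move=> /(_ isT) h; rewrite exprS (le_trans (h _ x)) //.
    by move=> u; rewrite mulrAC; exact: IH.
  by rewrite le_eqVlt; apply/orP; left; apply/eqP; ring.
have [y hy] := geometric_limit step.
have cyl : continuous y.
  have cw := hasder_cont (hasder_wgt c).
  by apply: (geometric_limit_cont cy _ hy); cont.
have fix_y x : G y x = y x.
  apply: (@eq_half_pow _ _ _ (2 * (C0 * wgt c x))) => k.
  have b1 := hy k.+1 x.
  have b2 : `|G y x - y_ k.+1 x| <= (2 * C0 * 2^-1 ^+ k) / 2 * wgt c x.
    apply: GB => //; first by rewrite !mulr_ge0 ?exprn_ge0.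
    by move=> u; rewrite distrC (le_trans (hy k u)) // le_eqVlt; apply/orP; left; apply/eqP; ring.
  have := ler_distD (y_ k.+1 x) (G y x) (y x); move: b1 b2; rewrite exprS.
  by move: (wgt c x) (2^-1 ^+ k) => W P; lra.
exists y, (fun x => s + prim (rhs y) x); split.
- have Gy : G y = y by apply/funext.
  by rewrite -[X in hasder X _]Gy; exact: dG.
- have h := hasder_prim (crhs _ cyl); hder.
  by move=> x; rewrite /rhs; ring.
- by rewrite -fix_y /G prim0 ?mulr0 ?addr0 //; exact: cpr.
- by rewrite prim0 ?addr0 //; exact: crhs.
Qed.

(** Gronwall: [exp(-(1 + P) t) (u^2 + u1^2)] does not increase, since [2 u u1 (1 + p)] is at most
    [(1 + P)(u^2 + u1^2)]. Negative arguments follow by reflection. *)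
Lemma homogeneous_ivp_unique q Q (z : R -> R) (z1 : R -> R) : (forall x, `|q x| <= Q) ->
  hasder z z1 -> hasder z1 (fun x => q x * z x) -> z 0 = 0 -> z1 0 = 0 ->
  forall x, z x = 0.
Proof.
have pos (p : R -> R) (P : R) (u u1 : R -> R) : (forall x, `|p x| <= P) -> hasder u u1 ->
    hasder u1 (fun x => p x * u x) -> u 0 = 0 -> u1 0 = 0 ->
    forall x : R, 0 <= x -> u x = 0.
  move=> hp du du1 u0 u10 x x0.
  have l : hasder (fun x : R => - ((1 + P) * x)) (fun=> - (1 + P)).
    by hder; move=> t; ring.
  have de := hasder_comp (@hasder_expR R) l.
  pose E t := - (expR (- ((1 + P) * t)) * (u t ^+ 2 + u1 t ^+ 2)).
  have dE : hasder E (fun t => expR (- ((1 + P) * t)) *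
     ((1 + P) * (u t ^+ 2 + u1 t ^+ 2) - 2 * u t * u1 t * (1 + p t))).
    by rewrite /E; hder; move=> t; rewrite /= ?expr1; ring.
  have := hasder_ge0_le dE x0; rewrite {1}/E u0 u10 expr0n /= addr0 mulr0 oppr0 => H.
  have : 0 <= E x.
    apply: H => t _; rewrite mulr_ge0 ?expR_ge0 //.
    have := hp t; rewrite ler_norml => /andP[h1 h2].
    have hs1 : 0 <= (u t - u1 t) ^+ 2 by rewrite sqr_ge0.
    have hs2 : 0 <= (u t + u1 t) ^+ 2 by rewrite sqr_ge0.
    by nra.
  rewrite /E oppr_ge0 pmulr_rle0 ?expR_gt0 // => h.
  apply/eqP; rewrite -sqrf_eq0 eq_le sqr_ge0 andbT.
  by have := sqr_ge0 (u1 x); lra.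
move=> hq dz dz1 z0 z10 x; case: (leP 0 x) => x0; first exact: (pos q Q z z1).
have := pos (fun t => q (- t)) Q (fun t => z (- t)) (fun t => - z1 (- t)).
move=> /(_ _ _ _ _ _ (- x)); rewrite opprK; apply => //.
- exact: hasder_opp_arg.
- have h := hasder_opp_arg dz1; hder.
  by move=> t; ring.
- by rewrite oppr0.
- by rewrite oppr0 z10 oppr0.
- by rewrite oppr_ge0 ltW.
Qed.

End linear_ode.

(** * Linear equations with periodic coefficients *)

Section periodic_linear.
Context {R : realType}.
Implicit Types (f g q : R -> R) (a b c x S C K Q s : R).

Lemma periodic_hasder f (f' : R -> R) S : hasder f f' -> periodic f S -> periodic f' S.
Proof.
move=> df pf x; have h := hasder_shift S df.
have e : (fun x => f (x + S)) = f by apply/funext => y; exact: pf.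
by rewrite e in h; have := congr1 (fun F => F x) (hasder_unique df h).
Qed.

(** With [E] the integral of [d^2 + d1^2], which dominates any partial integral of [2 d d1] up to
    sign, [d(x)^2 - E <= d(y)^2] for all [y] in the unit interval; averaging over [y] gives the
    factor 2. *)
Lemma sobolev_sup (d d1 : R -> R) a x : hasder d d1 -> continuous d1 ->
  a <= x <= a + 1 ->
  d x ^+ 2 <= 2 * (ig a (a + 1) (fun t => d t ^+ 2) + ig a (a + 1) (fun t => d1 t ^+ 2)).
Proof.
move=> dd cd1 /andP[ax xa].
have cd := hasder_cont dd.
rewrite -igD; [|by cont|by cont].
set E := ig _ _ _.
have cE : continuous (fun t => d t ^+ 2 + d1 t ^+ 2) by cont.
have E0 (t : R) : 0 <= d t ^+ 2 + d1 t ^+ 2 by rewrite addr_ge0 ?sqr_ge0.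
have dsq : hasder (fun t => d t ^+ 2) (fun t => 2 * d t * d1 t).
  by hder; move=> t; rewrite /= ?expr1; ring.
have key y : a <= y <= a + 1 -> d x ^+ 2 - E <= d y ^+ 2.
  move=> /andP[ay ya]; case: (leP y x) => xy.
    have := @ig_ftc R _ _ y x _ dsq.
    have h : ig y x (fun t => 2 * d t * d1 t) <= ig y x (fun t => d t ^+ 2 + d1 t ^+ 2).
      apply: ig_le => //; first by cont.
      by move=> t _; have := sqr_ge0 (d t - d1 t); nra.
    have h2 : ig y x (fun t => d t ^+ 2 + d1 t ^+ 2) <= E by exact: ig_subset.
    by move=> H; have := H ltac:(cont); lra.
  have := @ig_ftc R _ _ x y _ dsq.
  have h : ig x y (fun t => - 1 * (2 * d t * d1 t)) <= ig x y (fun t => d t ^+ 2 + d1 t ^+ 2).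
    apply: ig_le => //; [by cont|exact: ltW|].
    by move=> t _; have := sqr_ge0 (d t + d1 t); nra.
  have h2 : ig x y (fun t => d t ^+ 2 + d1 t ^+ 2) <= E by apply: ig_subset => //; exact: ltW.
  move=> H; have := H ltac:(cont); move: h; rewrite igZ; last by cont.
  by lra.
have : ig a (a + 1) (fun=> d x ^+ 2 - E) <= ig a (a + 1) (fun t => d t ^+ 2).
  by apply: ig_le; [cont|cont|lra|exact: key].
have : ig a (a + 1) (fun t => d t ^+ 2) <= E.
  by apply: ig_le; [cont|cont|lra|move=> t _; rewrite lerDl sqr_ge0].
by rewrite ig_cst; lra.
Qed.

(** Energy identity: multiply the equation by [a] and integrate over a period. The boundary term
    [a a1] cancels, and [a f] is split as [a^2 / 2 + f^2 / 2]. *)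
Lemma periodic_deriv_bound q S Q (a a1 f : R -> R) : continuous q -> 0 <= S ->
  (forall x, `|q x| <= Q) ->
  continuous f -> hasder a a1 -> hasder a1 (fun x => q x * a x - f x) ->
  periodic a S ->
  ig 0 S (fun x => a1 x ^+ 2) <=
    (1 / 2 + Q) * ig 0 S (fun x => a x ^+ 2) + 1 / 2 * ig 0 S (fun x => f x ^+ 2).
Proof.
move=> cq S0 hq cf da da1 pa.
have ca := hasder_cont da; have ca1 := hasder_cont da1.
have pa1 := periodic_hasder da pa.
have dp : hasder (fun x => a x * a1 x)
   (fun x => a1 x ^+ 2 + (q x * a x ^+ 2 + -1 * (a x * f x))).
  by hder; move=> x; ring.
have e0 : ig 0 S (fun x => a1 x ^+ 2 + (q x * a x ^+ 2 + -1 * (a x * f x))) = 0.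
  by rewrite (ig_ftc _ _ _ dp); [rewrite -[S]add0r pa pa1 subrr|cont].
have le1 : ig 0 S (fun x => a1 x ^+ 2) <= ig 0 S (fun x =>
     (a1 x ^+ 2 + (q x * a x ^+ 2 + -1 * (a x * f x))) +
     ((1 / 2 + Q) * a x ^+ 2 + 1 / 2 * f x ^+ 2)).
  apply: ig_le; [by cont|by cont|exact: S0|move=> x _ /=].
  have := hq x; rewrite ler_norml => /andP[q1 _].
  have q2 : 0 <= q x + Q by lra.
  have := mulr_ge0 q2 (sqr_ge0 (a x)); have := sqr_ge0 (a x - f x).
  by rewrite sqrrB; lra.
move: le1; rewrite igD; [|by cont|by cont].
rewrite e0 add0r igD; [|by cont|by cont].
by rewrite !igZ; [|by cont|by cont].
Qed.

(* A lower bound in L^2(0, S) for the operator - a'' + q a on S-periodic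
   functions; f is the value - a'' + q a. *)
Definition coercive q S K := forall a a1 f : R -> R, continuous f ->
  hasder a a1 -> hasder a1 (fun x => q x * a x - f x) -> periodic a S ->
  ig 0 S (fun x => a x ^+ 2) <= K * ig 0 S (fun x => f x ^+ 2).

(** [C] is twice the sum of the L^2 constants for [a] and [a1]; the factor 2 is the one in
    [sobolev_sup]. *)
Lemma coercive_bounds q S K Q (a a1 f : R -> R) : coercive q S K -> continuous q ->
  1 <= S -> 0 <= K -> (forall x, `|q x| <= Q) ->
  continuous f -> hasder a a1 -> hasder a1 (fun x => q x * a x - f x) ->
  periodic a S ->
  let C := 2 * (K + (1 / 2 + (1 / 2 + Q) * K)) in
  let F := ig 0 S (fun x => f x ^+ 2) in
  [/\ forall x, a x ^+ 2 <= C * F, ig 0 S (fun x => a x ^+ 2) <= C * F &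
      ig 0 S (fun x => a1 x ^+ 2) <= C * F].
Proof.
move=> co cq S1 K0 hq cf da da1 pa C F.
have ca := hasder_cont da; have ca1 := hasder_cont da1.
have Q0 : 0 <= Q by exact: le_trans (normr_ge0 _) (hq 0).
have F0 : 0 <= F by apply: ig_ge0; [cont|lra|move=> x _; exact: sqr_ge0].
have h0 : ig 0 S (fun x => a x ^+ 2) <= K * F by exact: (co _ _ _ cf da da1 pa).
have h1 : ig 0 S (fun x => a1 x ^+ 2) <= (1 / 2 + (1 / 2 + Q) * K) * F.
  apply: (le_trans (periodic_deriv_bound cq _ hq cf da da1 pa)); first by lra.
  have : (1 / 2 + Q) * ig 0 S (fun x => a x ^+ 2) <= (1 / 2 + Q) * (K * F).
    by apply: ler_wpM2l => //; lra.
  by rewrite -/F; lra.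
have KF : 0 <= K * F by exact: mulr_ge0.
have QKF : 0 <= (1 / 2 + (1 / 2 + Q) * K) * F.
  by apply: mulr_ge0 => //; apply: addr_ge0; [lra|apply: mulr_ge0 => //; lra].
have CE : C * F = 2 * (K * F + (1 / 2 + (1 / 2 + Q) * K) * F) by rewrite /C; ring.
rewrite CE; split; [|by lra..] => x.
have [k /andP[hk1 hk2]] := period_reduce x 0 (lt_le_trans ltr01 S1).
have x2 : a x = a (x - k%:~R * S) by rewrite -[RHS](periodicz pa k) subrK.
rewrite x2; move: (x - _) hk1 hk2 => y y0 yS {x2}.
(* Left end of a unit window that contains [y] and stays inside [0, S]; this is where [1 <= S] is
   used. *)
pose y' := Num.min y (S - 1).
have hy' : [/\ 0 <= y', y' <= y, y <= y' + 1 & y' + 1 <= S].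
  by rewrite /y'; case: (leP y (S - 1)) => ?; split; lra.
case: hy' => y1 y2 y3 y4.
apply: (le_trans (sobolev_sup (a := y') da ca1 _)); first by rewrite y2.
have : ig y' (y' + 1) (fun t => a t ^+ 2) <= ig 0 S (fun t => a t ^+ 2).
  by apply: ig_subset => //; [cont|move=> ?; exact: sqr_ge0|lra].
have : ig y' (y' + 1) (fun t => a1 t ^+ 2) <= ig 0 S (fun t => a1 t ^+ 2).
  by apply: ig_subset => //; [cont|move=> ?; exact: sqr_ge0|lra].
lra.
Qed.

(** The difference of [a] and its translate by [S] solves the homogeneous equation with zero initial
    data. *)
Lemma periodic_of_boundary_values q f S Q (a a1 : R -> R) :
  (forall x, `|q x| <= Q) -> periodic q S -> periodic f S ->
  hasder a a1 -> hasder a1 (fun x => q x * a x - f x) ->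
  a S = a 0 -> a1 S = a1 0 -> periodic a S.
Proof.
move=> hq pq pf da da1 e e1 x.
apply/eqP; rewrite -subr_eq0; apply/eqP.
apply: (@homogeneous_ivp_unique _ q Q (fun x => a (x + S) - a x)
   (fun x => a1 (x + S) - a1 x)) => //.
- by hder.
- by hder; move=> y; rewrite pq pf; ring.
- by rewrite add0r e subrr.
- by rewrite add0r e1 subrr.
Qed.

(** With [y], [z] the fundamental solutions and [u] a particular one, periodicity of [u + c y + d z]
    is a linear system whose determinant [D] is that of the monodromy matrix minus the identity. A
    kernel vector yields a periodic homogeneous solution, which coercivity makes zero. *)
Lemma periodic_solvable q S K f : coercive q S K -> continuous q -> periodic q S ->
  1 <= S -> 0 <= K -> continuous f -> periodic f S ->
  exists a a1 : R -> R, [/\ hasder a a1, hasder a1 (fun x => q x * a x - f x) & periodic a S].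
Proof.
move=> co cq pq S1 K0 cf pf.
have S0 : 0 < S by lra.
have [Q Q0 hq] := cont_periodic_bounded cq S0 pq.
have [F _ hf] := cont_periodic_bounded cf S0 pf.
have c0 : continuous (fun _ : R => 0 : R) by cont.
have p0 : periodic (fun _ : R => 0 : R) S by [].
have h0 (x : R) : `|cst (0 : R) x| <= 0 by rewrite /= normr0.
have [y [y1 [dy dy1 y0 y10]]] := linear_ivp 1 0 cq c0 hq h0.
have [z [z1 [dz dz1 z0 z10]]] := linear_ivp 0 1 cq c0 hq h0.
have [u [u1 [du du1 u0 u10]]] := linear_ivp 0 0 cq cf hq hf.
have null c d : c * (y S - 1) + d * z S = 0 -> c * y1 S + d * (z1 S - 1) = 0 ->
    c = 0 /\ d = 0.
  move=> e1 e2; pose a (x : R) : R := c * y x + d * z x; pose a1 x := c * y1 x + d * z1 x.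
  have da : hasder a a1 by rewrite /a; hder; move=> x; rewrite /a1; ring.
  have da1 : hasder a1 (fun x => q x * a x - 0).
    by rewrite /a1; hder; move=> x; rewrite /a; ring.
  have pa : periodic a S.
    apply: (periodic_of_boundary_values hq pq p0 da da1).
      by rewrite /a y0 z0; lra.
    by rewrite /a1 y10 z10; lra.
  have [+ _ _] := coercive_bounds co cq S1 K0 hq c0 da da1 pa.
  have -> : ig 0 S (fun x : R => (0 : R) ^+ 2) = 0 by rewrite ig_cst expr0n mul0r.
  rewrite mulr0 => az.
  have aE x : a x = 0 by apply/eqP; rewrite -sqrf_eq0 eq_le sqr_ge0 andbT.
  have a1E : a1 = fun=> 0.
    apply: (hasder_unique da); have -> : a = fun=> 0 by apply/funext.
    exact: hasder_cst.
  have := aE 0; have : a1 0 = 0 by rewrite a1E.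
  by rewrite /a /a1 y0 z0 y10 z10; lra.
pose D := (y S - 1) * (z1 S - 1) - z S * y1 S.
have D0 : D != 0.
  apply/eqP => D0.
  (* If [D = 0], the entries of each row give a kernel vector. Both must vanish, so the whole matrix
     is zero; then (1, 0) is in the kernel too, a contradiction. *)
  have [e1 e2] := null (z S) (- (y S - 1)) ltac:(ring) ltac:(rewrite -[RHS]oppr0 -D0 /D; ring).
  have [e3 e4] := null (z1 S - 1) (- y1 S) ltac:(rewrite -[RHS]D0 /D; ring) ltac:(ring).
  have [] := null 1 0 ltac:(lra) ltac:(lra).
  by move/eqP; rewrite oner_eq0.
pose c := (- u S * (z1 S - 1) + z S * u1 S) / D.
pose d := (- u1 S * (y S - 1) + y1 S * u S) / D.
pose a (x : R) : R := u x + (c * y x + d * z x); pose a1 x := u1 x + (c * y1 x + d * z1 x).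
have da : hasder a a1 by rewrite /a; hder; move=> x; rewrite /a1; ring.
have da1 : hasder a1 (fun x => q x * a x - f x).
  by rewrite /a1; hder; move=> x; rewrite /a; ring.
exists a, a1; split => //.
apply: (periodic_of_boundary_values hq pq pf da da1).
  suff : a S - a 0 = 0 by lra.
  by rewrite /a u0 y0 z0 /c /d; move: D0; rewrite /D => D0; field.
suff : a1 S - a1 0 = 0 by lra.
by rewrite /a1 u10 y10 z10 /c /d; move: D0; rewrite /D => D0; field.
Qed.

End periodic_linear.

(** * The nonlinear periodic problem *)

Section nonlinear.
Context {R : realType}.
Implicit Types (f g q w r : R -> R) (b c x S C K Q B s m : R).

(** Convergence of the functions and of their second derivatives is enough. Writing [u k] as an
    affine function plus the double primitive of [g k], the unknown slopes [u1 k 0] are recovered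
    from the limit itself. *)
Lemma hasder2_limit (u u1 g : nat -> R -> R) (l h : R -> R) (C : R) :
  (forall k, hasder (u k) (u1 k)) -> (forall k, hasder (u1 k) (g k)) ->
  (forall k, continuous (g k)) -> continuous h ->
  (forall k x, `|u k x - l x| <= C * 2^-1 ^+ k) ->
  (forall k x, `|g k x - h x| <= C * 2^-1 ^+ k) ->
  exists2 l1, hasder l l1 & hasder l1 h.
Proof.
move=> du du1 cg ch hu hg.
have C0 : 0 <= C by apply: le_trans (normr_ge0 _) _; have := hu 0%N 0; rewrite expr0 mulr1; exact.
have p0 k : 0 <= (2^-1 : R) ^+ k by rewrite exprn_ge0.
have cph : continuous (prim h) := hasder_cont (hasder_prim ch).
have cpg k : continuous (prim (g k)) := hasder_cont (hasder_prim (cg k)).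
have uE k x : u k x = u k 0 + u1 k 0 * x + prim (prim (g k)) x.
  have h1 : u1 k = fun x => u1 k 0 + prim (g k) x.
    apply: (@hasder_inj _ _ _ (g k)) => //; last by rewrite prim0 ?addr0.
    by have := hasder_prim (cg k) => H; hder; move=> y; ring.
  have dk := du k; rewrite h1 in dk.
  have H := hasder_prim (cpg k).
  have H2 : hasder (fun x => u k 0 + u1 k 0 * x + prim (prim (g k)) x)
              (fun x => u1 k 0 + prim (g k) x) by hder; move=> y; ring.
  have := hasder_inj dk H2; rewrite mulr0 prim0 // !addr0 => /(_ erefl) e.
  by rewrite {1}e.
pose z x := l x - l 0 - prim (prim h) x.
have zb k x : `|z x - u1 k 0 * x| <= (3 * C * wgt 1 x) * 2^-1 ^+ k.
  have hb y : `|g k y - h y| <= (C * 2^-1 ^+ k) * wgt 1 y.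
    apply: (le_trans (hg k y)); rewrite ler_peMr ?wgt_ge1 //; exact: mulr_ge0.
  have b1 := @prim2_bound R 1 (C * 2^-1 ^+ k) (fun y => g k y - h y) ltr01
    (mulr_ge0 C0 (p0 k)) (contD (cg k) (contN ch)) hb x.
  have b2 := hu k x; have b3 := hu k 0.
  have w1 := wgt_ge1 1 x.
  rewrite primB // primB // expr1n divr1 in b1.
  have -> : z x - u1 k 0 * x = (u k 0 - l 0) - (u k x - l x) + (prim (prim (g k)) x - prim (prim h) x).
    by rewrite /z (uE k x); ring.
  rewrite (le_trans (ler_normD _ _)) // (le_trans (lerD (ler_normB _ _) (lexx _))) //.
  have : C * 2^-1 ^+ k <= C * 2^-1 ^+ k * wgt 1 x by rewrite ler_peMr //; exact: mulr_ge0.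
  move: b1 b2 b3; move: (wgt 1 x) (2^-1 ^+ k) w1 => W P w1; lra.
(* [z] is a pointwise limit of the linear functions with slopes [u1 k 0], so it is linear with slope
   [z 1]. *)
have zE x : z x = z 1 * x.
  apply: (@eq_half_pow _ _ _ (3 * C * wgt 1 x + 3 * C * wgt 1 1 * `|x|)) => k.
  have b1 := zb k x; have := zb k 1; rewrite mulr1 => b2.
  have -> : z x - z 1 * x = (z x - u1 k 0 * x) - (z 1 - u1 k 0) * x by ring.
  rewrite (le_trans (ler_normB _ _)) // normrM mulrDl lerD //.
  by rewrite -mulrA [`|x| * _]mulrC mulrA ler_wpM2r.
have lE : l = fun x => l 0 + z 1 * x + prim (prim h) x.
  by apply/funext => x; rewrite -zE /z; ring.
exists (fun x => z 1 + prim h x).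
  by rewrite lE; have H := hasder_prim cph; hder; move=> x; ring.
by have H := hasder_prim ch; hder; move=> x; ring.
Qed.

(* If q = W + 3 w^2 and r = W w + w^3 - w'', then w + a solves u'' = W u + u^3 iff
   - a'' + q a = remainder w r a. *)
Definition remainder w r (a : R -> R) := fun x => - (r x + 3 * w x * a x ^+ 2 + a x ^+ 3).

(** One factor [a^2] of the squared nonlinear part is traded for the sup bound [m]; the rest stays
    integrable against the L^2 bound. *)
Lemma remainder_bound w r B m a (x : R) : `|w x| <= B -> a x ^+ 2 <= m -> 0 <= m ->
  remainder w r a x ^+ 2 <= 2 * r x ^+ 2 + 2 * (m * (18 * B ^+ 2 + 2 * m)) * a x ^+ 2.
Proof.
move=> hw ha m0; rewrite /remainder sqrrN.
have w2 : w x ^+ 2 <= B ^+ 2.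
  by rewrite -[w x ^+ 2]real_normK ?num_real // lerXn2r // nnegrE (le_trans (normr_ge0 _) hw).
set N := 3 * w x * a x ^+ 2 + a x ^+ 3.
have NE : N ^+ 2 = a x ^+ 2 * (a x ^+ 2 * (3 * w x + a x) ^+ 2) by rewrite /N; ring.
have h1 : (3 * w x + a x) ^+ 2 <= 18 * B ^+ 2 + 2 * m.
  by have := sqr_ge0 (3 * w x - a x); nra.
have h2 : N ^+ 2 <= a x ^+ 2 * (m * (18 * B ^+ 2 + 2 * m)).
  rewrite NE; apply: ler_wpM2l; first exact: sqr_ge0.
  by apply: ler_pM => //; exact: sqr_ge0.
rewrite -addrA -/N.
by have := sqr_ge0 (r x - N); nra.
Qed.

(** The difference factors as [c (a - a')] up to sign. The two pieces of [c] have squares at most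
    [36 B^2 m] and [9 m^2], and the square of a sum doubles their total. *)
Lemma remainder_diff_bound w r B m (a a' : R -> R) (x : R) :
  `|w x| <= B -> a x ^+ 2 <= m -> a' x ^+ 2 <= m ->
  (remainder w r a x - remainder w r a' x) ^+ 2
    <= m * (72 * B ^+ 2 + 18 * m) * (a x - a' x) ^+ 2.
Proof.
move=> hw ha ha'; rewrite /remainder.
have m0 : 0 <= m by apply: le_trans ha; exact: sqr_ge0.
have w2 : w x ^+ 2 <= B ^+ 2.
  by rewrite -[w x ^+ 2]real_normK ?num_real // lerXn2r // nnegrE (le_trans (normr_ge0 _) hw).
move: (a x) (a' x) ha ha' => {a a'} a a' ha ha'.
set D := leLHS.
pose c := 3 * w x * (a + a') + (a ^+ 2 + a * a' + a' ^+ 2).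
have -> : D = c ^+ 2 * (a - a') ^+ 2 by rewrite /D /c; ring.
apply: ler_wpM2r; first exact: sqr_ge0.
have s1 : (a + a') ^+ 2 <= 4 * m by have := sqr_ge0 (a - a'); nra.
have s2 : `|a ^+ 2 + a * a' + a' ^+ 2| <= 3 * m.
  by have := sqr_ge0 (a - a'); have := sqr_ge0 (a + a'); rewrite ler_norml => ? ?; apply/andP; split; nra.
have s3 : (a ^+ 2 + a * a' + a' ^+ 2) ^+ 2 <= (3 * m) ^+ 2.
  by rewrite -[X in X <= _]real_normK ?num_real // lerXn2r // nnegrE mulr_ge0.
have s4 : (3 * w x * (a + a')) ^+ 2 <= 9 * B ^+ 2 * (4 * m).
  rewrite exprMn; apply: ler_pM; rewrite ?sqr_ge0 //.
  by rewrite exprMn; nra.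
rewrite /c; have := sqr_ge0 (3 * w x * (a + a') - (a ^+ 2 + a * a' + a' ^+ 2)).
move: (a ^+ 2 + a * a' + a' ^+ 2) (3 * w x * (a + a')) s3 s4 => u t s3 s4.
nra.
Qed.

(** On the ball where [a^2] and its integral are at most [m], the squared remainder integrates to at
    most four times that of [r]: half from [r], half from the nonlinear part by smallness. The
    factor 4 in [m] thus makes the ball invariant. The same smallness contracts squared differences
    by 1/4, that is, differences by 1/2. *)
Lemma nonlinear_solvable q w r S K Q B : 1 <= S -> 0 <= K ->
  continuous q -> continuous w -> continuous r ->
  periodic q S -> periodic w S -> periodic r S ->
  (forall x, `|q x| <= Q) -> (forall x, `|w x| <= B) ->
  (forall f, continuous f -> periodic f S -> exists a a1 : R -> R,
    [/\ hasder a a1, hasder a1 (fun x => q x * a x - f x) & periodic a S]) ->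
  (forall a a1 f : R -> R, continuous f -> hasder a a1 ->
     hasder a1 (fun x => q x * a x - f x) -> periodic a S ->
     let F := ig 0 S (fun x => f x ^+ 2) in
     [/\ forall x, a x ^+ 2 <= K * F, ig 0 S (fun x => a x ^+ 2) <= K * F &
         ig 0 S (fun x => a1 x ^+ 2) <= K * F]) ->
  let m := 4 * K * ig 0 S (fun x => r x ^+ 2) in
  K * m * (72 * B ^+ 2 + 18 * m) <= 1 / 4 ->
  exists a a1 : R -> R, let a2 := fun x => q x * a x - remainder w r a x in
   [/\ hasder a a1, hasder a1 a2, periodic a S &
    [/\ ig 0 S (fun x => a x ^+ 2) <= m,
       ig 0 S (fun x => a1 x ^+ 2) <= m &
       ig 0 S (fun x => a2 x ^+ 2) <= 2 * Q ^+ 2 * m + 8 * ig 0 S (fun x => r x ^+ 2)]].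
Proof.
move=> S1 K0 cq cw cr pq pw pr hq hw solv bd m small.
set rho := ig _ _ _ in m small *.
have S0 : 0 <= S by lra.
have rho0 : 0 <= rho by apply: ig_ge0; [cont|lra|move=> x _; exact: sqr_ge0].
have m0 : 0 <= m by rewrite /m; apply: mulr_ge0 => //; apply: mulr_ge0.
have B0 : 0 <= B by exact: le_trans (normr_ge0 _) (hw 0).
have crem (a : R -> R) : continuous a -> continuous (remainder w r a) by move=> ca; rewrite /remainder; cont.
have prem (a : R -> R) : periodic a S -> periodic (remainder w r a) S.
  by move=> pa x; rewrite /remainder pw pr pa.
have inv (a : R -> R) : continuous a -> (forall x, a x ^+ 2 <= m) -> ig 0 S (fun x => a x ^+ 2) <= m ->
    ig 0 S (fun x => remainder w r a x ^+ 2) <= 4 * rho.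
  move=> ca ha ia.
  have cra := crem _ ca.
  have : ig 0 S (fun x => remainder w r a x ^+ 2) <=
     ig 0 S (fun x => 2 * r x ^+ 2 + 2 * (m * (18 * B ^+ 2 + 2 * m)) * a x ^+ 2).
    by apply: ig_le; [cont|cont|exact: S0|move=> x _; exact: remainder_bound].
  rewrite igD; [|by cont|by cont]; rewrite igZ; [|by cont]; rewrite igZ; [|by cont].
  rewrite -/rho; have c0 : 0 <= 2 * (m * (18 * B ^+ 2 + 2 * m)).
    by rewrite !mulr_ge0 // addr_ge0 // mulr_ge0 // sqr_ge0.
  have h1 : 2 * (m * (18 * B ^+ 2 + 2 * m)) * ig 0 S (fun x => a x ^+ 2) <= 2 * (m * (18 * B ^+ 2 + 2 * m)) * m.
    exact: ler_wpM2l.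
  have h2 : 2 * (m * (18 * B ^+ 2 + 2 * m)) * m = 2 * rho * (K * m * (72 * B ^+ 2 + 8 * m)).
    by rewrite {3}/m; ring.
  have h3 : K * m * (72 * B ^+ 2 + 8 * m) <= 1.
    apply: le_trans (_ : K * m * (72 * B ^+ 2 + 18 * m) <= 1); last by lra.
    by apply: ler_wpM2l; [exact: mulr_ge0|lra].
  by nra.
(* A solution operator defined on all functions; the pair [(f, f)] is a default value outside the
   continuous periodic ones. *)
have /choice[sol hsol] (f : R -> R) : exists p : (R -> R) * (R -> R), continuous f -> periodic f S ->
    [/\ hasder p.1 p.2, hasder p.2 (fun x => q x * p.1 x - f x) & periodic p.1 S].
  have [[cf pf]|nf] := pselect (continuous f /\ periodic f S).
    by have [a [a1 H]] := solv f cf pf; exists (a, a1).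
  by exists (f, f) => cf pf; exfalso; apply: nf.
pose u_ := fix u_ k := if k is k'.+1 then (sol (remainder w r (u_ k'))).1 else (fun _ : R => 0 : R).
pose v_ k := (sol (remainder w r (u_ k))).2.
have stepk (a : R -> R) : continuous a -> periodic a S -> (forall x, a x ^+ 2 <= m) -> ig 0 S (fun x => a x ^+ 2) <= m ->
    let p := sol (remainder w r a) in
    [/\ hasder p.1 p.2, hasder p.2 (fun x => q x * p.1 x - remainder w r a x), periodic p.1 S,
       forall x, p.1 x ^+ 2 <= m & ig 0 S (fun x => p.1 x ^+ 2) <= m].
  move=> ca pa ha ia p; have [d1 d2 pp] := hsol _ (crem _ ca) (prem _ pa).
  have [b1 b2 _] := bd _ _ _ (crem _ ca) d1 d2 pp.
  have hm : K * ig 0 S (fun x => remainder w r a x ^+ 2) <= m.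
    by have := ler_wpM2l K0 (inv a ca ha ia); rewrite /m; lra.
  by split => // [x|]; [exact: le_trans (b1 x) hm|exact: le_trans b2 hm].
have uinv k : [/\ continuous (u_ k), periodic (u_ k) S, forall x, u_ k x ^+ 2 <= m
    & ig 0 S (fun x => u_ k x ^+ 2) <= m].
  elim: k => [|k [c1 p1 b1 i1]] /=.
    split; [by cont|by []|by move=> x; rewrite expr0n|].
    by rewrite ig_cst expr0n mul0r.
  have [d1 d2 p2 b2 i2] := stepk _ c1 p1 b1 i1.
  by split => //; exact: hasder_cont d1.
have du k : hasder (u_ k.+1) (v_ k).
  by have [c1 p1 b1 i1] := uinv k; have [] := stepk _ c1 p1 b1 i1.
have dv k : hasder (v_ k) (fun x => q x * u_ k.+1 x - remainder w r (u_ k) x).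
  by have [c1 p1 b1 i1] := uinv k; have [] := stepk _ c1 p1 b1 i1.
have diff k : (forall x, (u_ k.+1 x - u_ k x) ^+ 2 <= m * (4^-1) ^+ k) /\
    ig 0 S (fun x => (u_ k.+1 x - u_ k x) ^+ 2) <= m * (4^-1) ^+ k.
  elim: k => [|k [_ IH]].
    have [c1 p1 b1 i1] := uinv 1%N; split => [x|]; first by rewrite expr0 mulr1 subr0.
    rewrite expr0 mulr1.
    have -> : (fun x => (u_ 1%N x - u_ 0%N x) ^+ 2) = (fun x => u_ 1%N x ^+ 2).
      by apply/funext => x; rewrite subr0.
    exact: i1.
  have [c0 p0 b0 i0] := uinv k; have [c1 p1 b1 i1] := uinv k.+1; have [c2 p2 b2 i2] := uinv k.+2.
  pose f x := remainder w r (u_ k.+1) x - remainder w r (u_ k) x.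
  have cr0 := crem _ c0; have cr1 := crem _ c1.
  have cf : continuous f by rewrite /f; cont.
  have d1 : hasder (fun x => u_ k.+2 x - u_ k.+1 x) (fun x => v_ k.+1 x - v_ k x).
    by have h1 := du k; have h2 := du k.+1; hder.
  have d2 : hasder (fun x => v_ k.+1 x - v_ k x) (fun x => q x * (u_ k.+2 x - u_ k.+1 x) - f x).
    by have h1 := dv k; have h2 := dv k.+1; hder; move=> x; rewrite /f; ring.
  have pd : periodic (fun x => u_ k.+2 x - u_ k.+1 x) S by move=> x; rewrite p2 p1.
  have [s1 s2 _] := bd _ _ _ cf d1 d2 pd.
  have cd : continuous (fun x => u_ k.+1 x - u_ k x) by cont.
  have fb : ig 0 S (fun x => f x ^+ 2) <= m * (72 * B ^+ 2 + 18 * m) * ig 0 S (fun x => (u_ k.+1 x - u_ k x) ^+ 2).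
    rewrite -igZ; last by cont.
    by apply: ig_le; [cont|cont|exact: S0|move=> x _; exact: remainder_diff_bound].
  have fb2 : K * ig 0 S (fun x => f x ^+ 2) <= m * 4^-1 ^+ k.+1.
    apply: (le_trans (ler_wpM2l K0 fb)); rewrite [4^-1 ^+ k.+1]exprS.
    have I0 : 0 <= ig 0 S (fun x => (u_ k.+1 x - u_ k x) ^+ 2).
      by apply: ig_ge0; [cont|exact: S0|move=> x _; exact: sqr_ge0].
    have := ler_pM _ I0 small IH; have Km : 0 <= K * m * (72 * B ^+ 2 + 18 * m).
      by rewrite !mulr_ge0 // addr_ge0 // mulr_ge0 // sqr_ge0.
    by move=> /(_ Km); lra.
  by split => [x|]; [exact: le_trans (s1 x) fb2|exact: le_trans s2 fb2].
have p0 k : 0 <= (2^-1 : R) ^+ k by rewrite exprn_ge0.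
(* Since [m <= (1 + m)^2], the bound [m 4^-k] on squares becomes [(1 + m) 2^-k] without a square
   root of [m]. *)
have diff1 k x : `|u_ k.+1 x - u_ k x| <= (1 + m) * 2^-1 ^+ k.
  have [h _] := diff k; rewrite -(@ler_pXn2r _ 2) ?nnegrE //; last by apply: mulr_ge0 => //; lra.
  rewrite real_normK ?num_real // (le_trans (h x)) //.
  have -> : (4^-1 : R) = 2^-1 ^+ 2 by field.
  rewrite [leRHS]exprMn [2^-1 ^+ 2 ^+ k]exprAC; apply: ler_wpM2r; first exact: sqr_ge0.
  by nra.
have [a ha] := @geometric_limit R u_ (fun=> 1 + m) diff1.
pose C1 := 2 * (1 + m); have C10 : 0 <= C1 by rewrite /C1; lra.
have ha' k x : `|u_ k x - a x| <= C1 * 2^-1 ^+ k by exact: ha.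
have cu k : continuous (u_ k) by have [] := uinv k.
have ca : continuous a by apply: (geometric_limit_cont cu _ ha'); cont.
have pa : periodic a S.
  move=> x; apply: (@eq_half_pow _ _ _ (2 * C1)) => k.
  have [_ pk _ _] := uinv k.
  have := ha' k (x + S); have := ha' k x; rewrite pk !ler_norml => /andP[? ?] /andP[? ?].
  by apply/andP; split; lra.
have m1 x : `|a x| <= 1 + m.
  apply: (@le_half_pow _ _ _ C1) => k; have [_ _ b _] := uinv k.
  have b' : `|u_ k x| <= 1 + m.
    rewrite -(@ler_pXn2r _ 2) ?nnegrE //; last by lra.
    by rewrite real_normK ?num_real // (le_trans (b x)) //; nra.
  by have := ler_distD (u_ k x) (a x) 0; rewrite !subr0 distrC; have := ha' k x; lra.
have sqk k x : `|a x ^+ 2 - u_ k x ^+ 2| <= (2 * (1 + m) * C1 + C1 ^+ 2) * 2^-1 ^+ k.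
  have hk := ha' k x.
  have -> : a x ^+ 2 - u_ k x ^+ 2 = 2 * a x * (a x - u_ k x) - (a x - u_ k x) ^+ 2 by ring.
  rewrite (le_trans (ler_normB _ _)) // normrM normrX normrM (ger0_norm (ler0n _ 2)) distrC.
  have t1 : 2 * `|a x| * `|u_ k x - a x| <= 2 * (1 + m) * (C1 * 2^-1 ^+ k).
    by apply: ler_pM => //; exact: ler_wpM2l.
  have t2 : `|u_ k x - a x| ^+ 2 <= C1 ^+ 2 * 2^-1 ^+ k.
    apply: (@le_trans _ _ ((C1 * 2^-1 ^+ k) ^+ 2)); first by rewrite lerXn2r // nnegrE mulr_ge0.
    rewrite exprMn; apply: ler_wpM2l; first exact: sqr_ge0.
    by rewrite expr2 ler_piMr // exprn_ile1 // invf_le1 // ler1n.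
  by lra.
have am x : a x ^+ 2 <= m.
  apply: (@le_half_pow _ _ _ (2 * (1 + m) * C1 + C1 ^+ 2)) => k; have [_ _ b _] := uinv k.
  by have := sqk k x; have := b x; rewrite ler_norml => ? /andP[? ?]; lra.
have iam : ig 0 S (fun x => a x ^+ 2) <= m.
  apply: (@le_half_pow _ _ _ ((2 * (1 + m) * C1 + C1 ^+ 2) * S)) => k; have [_ _ _ i] := uinv k.
  have : ig 0 S (fun x => a x ^+ 2) <= ig 0 S (fun x => u_ k x ^+ 2 + (2 * (1 + m) * C1 + C1 ^+ 2) * 2^-1 ^+ k).
    apply: ig_le; [by cont|by have := cu k => h; cont|exact: S0|move=> x _ /=].
    by have := sqk k x; rewrite ler_norml => /andP[? ?]; lra.
  rewrite igD; [|by have := cu k => h; cont|by cont]; rewrite ig_cst subr0; lra.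
have cra := crem _ ca.
pose E := m * (72 * B ^+ 2 + 18 * m).
have remk k x : `|remainder w r (u_ k) x - remainder w r a x| <= ((1 + E) * C1) * 2^-1 ^+ k.
  have [_ _ b _] := uinv k.
  have E0 : 0 <= E by rewrite /E mulr_ge0 // addr_ge0 // mulr_ge0 // sqr_ge0.
  have h := @remainder_diff_bound w r B m (u_ k) a x (hw x) (b x) (am x).
  have h2 : `|remainder w r (u_ k) x - remainder w r a x| <= (1 + E) * `|u_ k x - a x|.
    rewrite -(@ler_pXn2r _ 2) ?nnegrE //; last by apply: mulr_ge0 => //; lra.
    rewrite exprMn !real_normK ?num_real // (le_trans h) //.
    by apply: ler_wpM2r; [exact: sqr_ge0|rewrite -/E; nra].
  apply: (le_trans h2); rewrite -mulrA; apply: ler_wpM2l => //; lra.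
have Q0 : 0 <= Q by exact: le_trans (normr_ge0 _) (hq 0).
have E0 : 0 <= E by rewrite /E mulr_ge0 // addr_ge0 // mulr_ge0 // sqr_ge0.
pose C2 := Q * C1 + (1 + E) * C1.
have [a1 da da1] : exists2 a1, hasder a a1 & hasder a1 (fun x => q x * a x - remainder w r a x).
  (* The sequence is shifted by one because [v_ k] is the derivative of [u_ k.+1]. *)
  apply: (@hasder2_limit (fun k => u_ k.+1) v_ (fun k x => q x * u_ k.+1 x - remainder w r (u_ k) x) _ _ (C1 + C2)) => //.
  - by move=> k; have h1 := cu k.+1; have h2 := crem _ (cu k); cont.
  - by cont.
  - move=> k x; have := ha' k.+1 x; rewrite exprS => h; apply: (le_trans h).
    have C20 : 0 <= C2 by rewrite addr_ge0 // mulr_ge0 //; lra.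
    have := p0 k; nra.
  - move=> k x.
    have -> : q x * u_ k.+1 x - remainder w r (u_ k) x - (q x * a x - remainder w r a x)
      = q x * (u_ k.+1 x - a x) - (remainder w r (u_ k) x - remainder w r a x) by ring.
    rewrite (le_trans (ler_normB _ _)) // normrM.
    have t1 : `|q x| * `|u_ k.+1 x - a x| <= Q * (C1 * 2^-1 ^+ k.+1) by apply: ler_pM.
    have t2 : Q * (C1 * 2^-1 ^+ k.+1) <= Q * (C1 * 2^-1 ^+ k).
      apply: ler_wpM2l => //; apply: ler_wpM2l => //; rewrite exprS; have := p0 k; lra.
    have t3 := remk k x; have t4 : 0 <= C1 * 2^-1 ^+ k by exact: mulr_ge0.
    by rewrite /C2; lra.
exists a, a1; split => //; split => //.
  have [_ _ b3] := bd _ _ _ cra da da1 pa; apply: (le_trans b3).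
  by have := ler_wpM2l K0 (inv a ca am iam); rewrite /m; lra.
have : ig 0 S (fun x => (q x * a x - remainder w r a x) ^+ 2) <=
    ig 0 S (fun x => 2 * Q ^+ 2 * a x ^+ 2 + 2 * remainder w r a x ^+ 2).
  apply: ig_le; [by cont|by cont|exact: S0|move=> x _ /=].
  have q2 : q x ^+ 2 <= Q ^+ 2 by rewrite -[X in X <= _]real_normK ?num_real // lerXn2r // nnegrE.
  have := ler_wpM2r (sqr_ge0 (a x)) q2.
  by have := sqr_ge0 (q x * a x + remainder w r a x); lra.
rewrite igD; [|by cont|by cont]; rewrite igZ; [|by cont]; rewrite igZ; [|by cont].
have := ler_wpM2l (mulr_ge0 (ler0n R 2) (sqr_ge0 Q)) iam; have := inv a ca am iam; lra.
Qed.

End nonlinear.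

(** * Weak derivatives of classical functions *)

Section truncated_powers.
Context {R : realType}.

(** Truncated powers give cut-offs of finite smoothness by pure algebra: squares for C^1 test
    functions, cubes for the C^2 [bump]. *)
Definition tpow (n : nat) (x : R) : R := Num.max x 0 ^+ n.

Lemma cont_tpow n : continuous (tpow n).
Proof.
apply: contX; have -> : (fun x : R => Num.max x 0) = fun x => 2^-1 * (x + `|x|).
  by apply/funext => x; case: (leP x 0) => h; [rewrite ler0_norm|rewrite gtr0_norm] => //; lra.
by cont; exact: cont_id.
Qed.

Lemma tpow_le0 n x : x <= 0 -> tpow n.+1 x = 0.
Proof. by move=> x0; rewrite /tpow max_r // expr0n. Qed.

Lemma tpow_ge0E n x : 0 <= x -> tpow n x = x ^+ n.
Proof. by move=> x0; rewrite /tpow max_l. Qed.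

Lemma tpow_ge0 n x : 0 <= tpow n x.
Proof. by rewrite exprn_ge0 // le_max lexx orbT. Qed.

(** The function is identified with the primitive of its expected derivative, separately on each
    half-line, so differentiability at 0 needs no argument of its own. *)
Lemma hasder_tpow n : hasder (tpow n.+2) (fun x => n.+2%:R * tpow n.+1 x).
Proof.
have cg : continuous (fun x => n.+2%:R * tpow n.+1 x).
  by apply: contM; [exact: cont_cst|exact: cont_tpow].
have h := hasder_prim cg.
have -> : tpow n.+2 = prim (fun x => n.+2%:R * tpow n.+1 x); last exact: h.
apply/funext => x; case: (leP x 0) => x0.
  rewrite tpow_le0 // -(prim0 cg); apply/esym.
  by apply: (hasder_itv0_cst h x0) => y /andP[_ y0]; rewrite tpow_le0 // mulr0.
rewrite tpow_ge0E ?ltW //.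
have d : hasder (fun x => prim (fun x => n.+2%:R * tpow n.+1 x) x - x ^+ n.+2)
   (fun x => n.+2%:R * tpow n.+1 x - n.+2%:R * x ^+ n.+1).
  by have i := @hasder_id R; have i2 := hasderX n.+2 i; hder; move=> y; rewrite /= mulr1.
have := hasder_itv0_cst d (ltW x0); rewrite prim0 // expr0n subrr => H.
suff : 0 = prim (fun x => n.+2%:R * tpow n.+1 x) x - x ^+ n.+2 by lra.
by apply: H => y /andP[y0 _]; rewrite tpow_ge0E // subrr.
Qed.

(** A C^1 transition from 0 to 1 across [0, 1]; nesting two truncated squares makes the slope vanish
    at both ends. *)
Definition ramp (x : R) : R := 1 - tpow 2 (1 - tpow 2 x).

Lemma ramp_le0 x : x <= 0 -> ramp x = 0.
Proof. by move=> x0; rewrite /ramp (@tpow_le0 1 x) // subr0 tpow_ge0E // expr1n subrr. Qed.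

Lemma ramp_ge1 x : 1 <= x -> ramp x = 1.
Proof.
move=> x1; rewrite /ramp (@tpow_ge0E 2 x); last by lra.
have : 1 <= x ^+ 2 by rewrite exprn_ege1.
by move=> h; rewrite tpow_le0 ?subr0 //; lra.
Qed.

Lemma ramp_itv x : 0 <= ramp x <= 1.
Proof.
rewrite /ramp; have := tpow_ge0 2 (1 - tpow 2 x); set t := 1 - _.
have t1 : t <= 1 by rewrite /t; have := tpow_ge0 2 x; lra.
case: (leP t 0) => t0; first by move=> _; rewrite tpow_le0 // subr0 lexx ler01.
rewrite (tpow_ge0E _ (ltW t0)) => _; apply/andP; split; last by have := sqr_ge0 t; lra.
by have := exprn_ile1 2 (ltW t0) t1; lra.
Qed.

Lemma hasder_ramp : exists ramp1, [/\ hasder ramp ramp1, continuous ramp1 &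
  forall x, `|ramp1 x| <= 4].
Proof.
have h := hasder_tpow 0; have c1 := @cont_tpow 1; have c2 := @cont_tpow 2.
exists (fun x => (2 * tpow 1 (1 - tpow 2 x)) * (2 * tpow 1 x)); split.
- have h2 : hasder (fun x => 1 - tpow 2 x) (fun x => - (2 * tpow 1 x)).
    by hder; move=> x; rewrite add0r.
  have h3 := hasder_comp h h2; rewrite /ramp; hder; move=> x; ring.
- by cont.
move=> x; have t1 := tpow_ge0 1 x; have t2 := tpow_ge0 2 x.
have u1 := tpow_ge0 1 (1 - tpow 2 x).
have u2 : tpow 1 (1 - tpow 2 x) <= 1.
  have [y0|y0] := leP (1 - tpow 2 x) 0; first by rewrite tpow_le0.
  by rewrite tpow_ge0E ?expr1; lra.
rewrite ger0_norm; last by rewrite !mulr_ge0.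
have [x1|x1] := leP x 1.
  have t3 : tpow 1 x <= 1.
    have [x0|x0] := leP x 0; first by rewrite tpow_le0.
    by rewrite tpow_ge0E ?expr1; lra.
  have : tpow 1 (1 - tpow 2 x) * tpow 1 x <= 1 * 1 by apply: ler_pM.
  by lra.
suff -> : tpow 1 (1 - tpow 2 x) = 0 by rewrite mulr0 mul0r.
by apply: tpow_le0; rewrite tpow_ge0E; nra.
Qed.

End truncated_powers.

(** * Functions orthogonal to all test functions *)

Section weak_derivative.
Context {R : realType}.
Notation mu := (@lebesgue_measure R).
Implicit Types (f g h k phi : R -> R) (a b c x : R).

Lemma cont_measurable f : continuous f -> measurable_fun setT f.
Proof. exact: continuous_measurable_fun. Qed.

Lemma cont_locally_integrable f : continuous f -> locally_integrable setT f.
Proof.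
move=> cf; split; [exact: cont_measurable|exact: openT|] => K _ cK.
have : mu.-integrable K (EFin \o f).
  by apply: continuous_compact_integrable => //; exact: continuous_subspaceT.
by move=> /integrableP[_].
Qed.

Lemma locally_integrable_itv f a b : locally_integrable setT f ->
  mu.-integrable `[a, b] (EFin \o f).
Proof.
move=> [mf _ h]; apply/integrableP; split.
  by apply/measurable_EFinP; exact: measurable_funS mf.
by apply: h => //; exact: segment_compact.
Qed.

Lemma Rintegral_supp f a b : continuous f -> a < b ->
  (forall x, ~~ (a <= x <= b) -> f x = 0) -> \int[mu]_(x in setT) f x = ig a b f.
Proof.
move=> cf ab h; rewrite [X in Rintegral _ _ X](_ : _ = f \_ `[a, b]); last first.
  apply/funext => x; rewrite patchE; case: ifPn => // /negP hx; apply: h.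
  by apply/negP => hx'; apply: hx; rewrite inE /= in_itv.
by rewrite -Rintegral_mkcond /Rintegral ig_integral.
Qed.


(* Lebesgue's differentiation theorem, applied to x |-> \int_[-n, x] k = 0. *)
Lemma zero_mean_ae_zero k : locally_integrable setT k ->
  (forall a b, a < b -> (\int[mu]_(x in `]a, b[) (k x)%:E = 0)%E) ->
  {ae mu, forall x, k x = 0}.
Proof.
move=> lk h; have [mk _ _] := lk.
have Nn (n : nat) : {ae mu, forall x, - n%:R < x -> k x = 0}.
  have := @FTC1 R k (BLeft (- n%:R)) (fun y => locally_integrable_itv _ y lk) lk.
  apply: filterS; first exact: (ae_filter_ringOfSetsType mu).
  move=> x /= H nx.
  have {H}[_ <-] := H nx.
  rewrite derive1E (@near_eq_derive _ _ _ _ (fun=> 0)) ?derive_cst //.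
  near=> y; rewrite /Rintegral.
  have ny : - n%:R < y by near: y; exact: lt_nbhsr.
  rewrite (@integral_itv_bndoo _ _ _ _ true false) ?h //.
  by apply/measurable_EFinP; exact: measurable_funS mk.
have := ae_foralln Nn; apply: filterS => x H.
apply: (H (Num.bound `|x|)).
have := archi_boundP (normr_ge0 x); have := ler_norm (- x); rewrite normrN; lra.
Unshelve. all: by end_near. Qed.

(* The products of two ramps of slope m are test functions converging boundedly
   to the indicator of ]a, b[. *)
Lemma test_zero_ae_zero k : locally_integrable setT k ->
  (forall phi, test_function phi -> \int[mu]_(x in setT) (k x * phi x) = 0) ->
  {ae mu, forall x, k x = 0}.
Proof.
move=> lk h; have [mk _ _] := lk; apply: zero_mean_ae_zero => // a b ab.
have [r1 [dr cr1 _]] := @hasder_ramp R; have cr := hasder_cont dr.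
pose phi (m : nat) x := ramp (m%:R * (x - a)) * ramp (m%:R * (b - x)).
have dphi m : exists2 phi1, hasder (phi m) phi1 & continuous phi1.
  have l1 : hasder (fun x => m%:R * (x - a)) (fun=> m%:R).
    by hder; move=> x; ring.
  have l2 : hasder (fun x => m%:R * (b - x)) (fun=> - m%:R).
    by hder; move=> x; ring.
  have e1 := hasder_comp dr l1; have e2 := hasder_comp dr l2.
  have c1 := hasder_cont e1; have c2 := hasder_cont e2.
  have c3 := cont_comp cr1 (hasder_cont l1); have c4 := cont_comp cr1 (hasder_cont l2).
  by eexists; [exact: (hasderM e1 e2)|cont].
have cphi m : continuous (phi m) by have [phi1 d _] := dphi m; exact: hasder_cont d.
have phi0 m x : ~~ (a < x < b) -> phi m x = 0.
  move=> hx; rewrite /phi; have [xa|xa] := leP x a.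
    by rewrite ramp_le0 ?mul0r // mulr_ge0_le0 // subr_le0.
  rewrite [X in _ * X]ramp_le0 ?mulr0 // mulr_ge0_le0 // subr_le0.
  by move: hx; rewrite xa /= -leNgt.
have phi01 m x : `|phi m x| <= 1.
  have /andP[? ?] := ramp_itv (m%:R * (x - a)); have /andP[? ?] := ramp_itv (m%:R * (b - x)).
  by rewrite ger0_norm ?mulr_ge0 // mulr_ile1.
have tphi m : test_function (phi m).
  have [phi1 d c] := dphi m; split.
    by split; [exact: hasder_derivable d|rewrite (hasder_derive1 d)].
  exists (`|a| + `|b|) => x hx; apply: phi0; apply/negP => /andP[ax xb]; apply: hx.
  rewrite /= in_itv /=; have := ler_norm (- a); have := ler_norm b; rewrite normrN.
  by have := normr_ge0 a; have := normr_ge0 b => *; apply/andP; split; lra.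
have mab : measurable_fun `]a, b[ (EFin \o k).
  by apply/measurable_EFinP; exact: measurable_funS mk.
have int0 m : (\int[mu]_(x in `]a, b[) (k x * phi m x)%:E = 0)%E.
  have ik : mu.-integrable `]a, b[ (fun x => (k x * phi m x)%:E).
    apply: (@le_integrable _ _ _ mu _ _ _ (EFin \o k)) => //.
    - apply/measurable_EFinP; apply: measurable_funM; first exact: measurable_funS mk.
      by apply: measurable_funS (cont_measurable (cphi m)).
    - by move=> x _ /=; rewrite lee_fin normrM ler_piMr.
    - by apply: integrableS (locally_integrable_itv a b lk) => //; exact: subset_itv_oo_cc.
  have := h _ (tphi m); rewrite /Rintegral => H.
  rewrite -[LHS]fineK; last exact: integrable_fin_num.
  congr EFin; rewrite -[RHS]H; congr fine; rewrite [LHS]integral_mkcond; apply: eq_integral => x _.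
  rewrite patchE; case: ifPn => // /negP hx; rewrite phi0 ?mulr0 //.
  by apply/negP => hx'; apply: hx; rewrite inE /= in_itv.
have [||||||_ _] := @dominated_convergence _ _ _ mu `]a, b[ _
  (fun m x => (k x * phi m x)%:E) (EFin \o k) (EFin \o (fun x => `|k x|)).
- by [].
- move=> m; apply/measurable_EFinP; apply: measurable_funM; first exact: measurable_funS mk.
  by apply: measurable_funS (cont_measurable (cphi m)).
- by [].
- apply/nearW => x /=; rewrite in_itv /= => /andP[ax xb].
  (* From this rank on, [m (x - a)] and [m (b - x)] are both at least 1, so the two ramps equal 1 at
     [x]. *)
  apply: cvg_near_cst; pose N := Num.bound ((x - a)^-1 + (b - x)^-1).
  exists N => // m /= Nm.
  have i1 : 0 <= (x - a)^-1 by rewrite invr_ge0 subr_ge0 ltW.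
  have i2 : 0 <= (b - x)^-1 by rewrite invr_ge0 subr_ge0 ltW.
  have hN := archi_boundP (addr_ge0 i1 i2).
  have mN : (N%:R : R) <= m%:R by rewrite ler_nat.
  rewrite /phi !ramp_ge1 ?mulr1 //.
    by rewrite -ler_pdivrMr ?subr_gt0 // div1r -/N in hN *; lra.
  by rewrite -ler_pdivrMr ?subr_gt0 // div1r -/N in hN *; lra.
- apply: (@le_integrable _ _ _ mu _ _ _ (EFin \o k)) => //.
  + by apply/measurable_EFinP; apply: measurableT_comp => //; exact: measurable_funS mk.
  + by move=> x _ /=; rewrite lee_fin normr_id.
  + by apply: integrableS (locally_integrable_itv a b lk) => //; exact: subset_itv_oo_cc.
- apply/nearW => x m _ /=; by rewrite lee_fin normrM ler_piMr.
have -> : (fun n => \int[mu]_(x in `]a, b[) (k x * phi n x)%:E)%E = (fun=> 0%E).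
  by apply/funext => n; exact: int0.
by move=> H; apply/esym; apply: (cvg_unique _ _ H) => //; exact: cvg_cst.
Qed.

End weak_derivative.

(** * Weak derivatives and L^2-norms of C^2 functions *)

Section weak_derivative_classical.
Context {R : realType}.
Notation mu := (@lebesgue_measure R).
Implicit Types (f g h k phi : R -> R) (a b c x : R).

Lemma ae_imp (P Q : R -> Prop) : {ae mu, forall x, P x} -> (forall x, P x -> Q x) ->
  {ae mu, forall x, Q x}.
Proof.
by move=> + PQ; apply: filterS; [exact: (ae_filter_ringOfSetsType mu)|].
Qed.

Lemma test_functionP phi : test_function phi ->
  exists r B : R, [/\ 0 < r, hasder phi (phi^`())%classic, continuous (phi^`())%classic,
    forall x, `|phi x| <= B &
    forall x, ~~ (- r < x < r) -> phi x = 0 /\ (phi^`())%classic x = 0].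
Proof.
(* The margin 1 makes [phi] vanish near every point outside ]-r, r[, so its derivative vanishes
   there as well; the absolute value covers a negative [r0]. *)
move=> [[d c] [r0 hr0]]; pose r := `|r0| + 1.
have dphi := derivable_hasder d; have cphi := hasder_cont dphi.
have z x : ~~ (- r0 <= x <= r0) -> phi x = 0.
  by move=> hx; apply: hr0 => /=; rewrite in_itv /=; exact/negP.
have r0r : r0 < r by rewrite /r; have := ler_norm r0; lra.
have out x : ~~ (- r < x < r) -> ~~ (- r0 <= x <= r0).
  by apply: contraNN => /andP[? ?]; apply/andP; split; lra.
have r_gt0 : 0 < r by rewrite /r; have := normr_ge0 r0; lra.
have cn : {within `[- r, r], continuous (fun x => `|phi x|)}.
  by apply: continuous_subspaceT; cont.
have [m _ hm] := EVT_max (ltW (gtrN r_gt0)) cn.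
exists r, `|phi m|; split => //.
- move=> x; have [hx|hx] := boolP (- r <= x <= r); first by apply: hm; rewrite in_itv.
  rewrite z ?normr0 //; apply: contraNN hx => /andP[? ?]; apply/andP; split; lra.
- move=> x hx; split; first exact/z/out.
  rewrite derive1E (@near_eq_derive _ _ _ _ (fun=> 0)) ?derive_cst //.
  have [xr|xr] := ltP x (- r0).
    near=> y; apply: z; rewrite negb_and -ltNge; apply/orP; left.
    by near: y; exact: lt_nbhsl.
  have rx : r0 < x by have := out _ hx; rewrite negb_and -!ltNge => /orP[]; lra.
  near=> y; apply: z; rewrite negb_and -!ltNge; apply/orP; right.
  by near: y; exact: lt_nbhsr.
Unshelve. all: by end_near. Qed.

Lemma hasder_is_wderiv f g : hasder f g -> continuous g -> is_wderiv f g.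
Proof.
move=> d cg; have cf := hasder_cont d.
split; [exact: cont_locally_integrable|exact: cont_locally_integrable|].
move=> phi /test_functionP[r [B [r0 dphi cphi' _ z]]].
have cphi := hasder_cont dphi; have rr : - r < r by lra.
have w x : ~~ (- r <= x <= r) -> ~~ (- r < x < r).
  by apply: contraNN => /andP[? ?]; rewrite !ltW.
rewrite (@Rintegral_supp _ _ (- r) r) //; [|by cont|by move=> x /w/z[_ ->]; rewrite mulr0].
rewrite (@Rintegral_supp _ _ (- r) r) //; [|by cont|by move=> x /w/z[-> _]; rewrite mulr0].
apply/eqP; rewrite -subr_eq0 opprK -igD; [|by cont|by cont].
rewrite (@ig_ftc _ (fun x => f x * phi x)); [|by cont|by hder; move=> x; ring].
have [-> _] := z r ltac:(by rewrite ltxx andbF).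
by have [-> _] := z (- r) ltac:(by rewrite ltxx); rewrite !mulr0 subrr.
Qed.

Lemma wderiv_unique f g h : is_wderiv f g -> is_wderiv f h ->
  {ae mu, forall x, g x = h x}.
Proof.
move=> [lf lg hg] [_ lh hh].
have lk := locally_integrableB lg lh.
have : {ae mu, forall x, (g \- h)%R x = 0}.
  apply: (test_zero_ae_zero lk) => phi tphi.
  have e : \int[mu]_(x in setT) (g x * phi x) = \int[mu]_(x in setT) (h x * phi x).
    by apply: oppr_inj; rewrite -hg // -hh.
  have [r [B [r0 dphi cphi' hB z]]] := test_functionP tphi.
  have cphi := hasder_cont dphi.
  have ik (u : R -> R) : locally_integrable setT u -> mu.-integrable setT (EFin \o (fun x => u x * phi x)).
    move=> lu; have [mu' _ _] := lu.
    have -> : (fun x => u x * phi x) = (fun x => u x * phi x) \_ `[- r, r].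
      apply/funext => x; rewrite patchE; case: ifPn => // /negP hx.
      have [|-> _] := z x; last by rewrite mulr0.
      by apply/negP => /andP[h1 h2]; apply: hx; rewrite inE /= in_itv /= !ltW.
    rewrite -restrict_EFin -integrable_mkcond //.
    apply: (@le_integrable _ _ _ mu _ _ _ (fun x => B%:E * (EFin \o u) x)%E) => //.
    - apply/measurable_EFinP; apply: measurable_funM; first exact: measurable_funS mu'.
      by apply: measurable_funS (cont_measurable cphi).
    - move=> x _ /=; rewrite lee_fin !normrM mulrC ler_wpM2r //.
      by rewrite (le_trans (hB x)) // ler_norm.
    - by apply: integrableZl => //; exact: locally_integrable_itv.
  rewrite -(subrr (\int[mu]_(x in setT) (g x * phi x))) [X in _ - X]e.
  rewrite -RintegralB //; [|exact: ik|exact: ik].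
  by congr Rintegral; apply/funext => x /=; rewrite mulrBl.
by move=> /ae_imp; apply => x /eqP; rewrite subr_eq0 => /eqP.
Qed.

(** Needed for second derivatives: [wderiv f] is only almost everywhere the classical derivative,
    and it is this representative that is differentiated again. *)
Lemma is_wderiv_ae f h g : locally_integrable setT f ->
  {ae mu, forall x, f x = h x} -> is_wderiv h g -> is_wderiv f g.
Proof.
move=> lf fh [lh lg hg]; split => // phi tphi; rewrite -hg //.
have [r [B [_ _ cphi' _ _]]] := test_functionP tphi.
have [mf _ _] := lf; have [mh _ _] := lh.
rewrite /Rintegral; congr fine; apply: ae_eq_integral => //.
- by apply/measurable_EFinP; apply: measurable_funM => //; exact: cont_measurable.
- by apply/measurable_EFinP; apply: measurable_funM => //; exact: cont_measurable.
- by apply: (ae_imp fh) => x -> _.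
Qed.

Lemma wderivP f : weakly_differentiable f -> is_wderiv f (wderiv f).
Proof. by move=> [g hg]; apply: (@xgetPex _ (cst 0) [set g | is_wderiv f g]); exists g. Qed.

Lemma wderiv_ae f g : is_wderiv f g -> {ae mu, forall x, wderiv f x = g x}.
Proof. by move=> h; apply: (wderiv_unique (f := f)) => //; apply: wderivP; exists g. Qed.

(** The bridge from classical to weak derivatives. Measurability is recorded separately, because
    almost everywhere equality with a continuous function does not make the chosen representative
    Borel measurable. *)
Lemma C2_wderiv f g h : hasder f g -> hasder g h -> continuous h ->
  [/\ twice_weakly_differentiable f, {ae mu, forall x, wderiv f x = g x},
     {ae mu, forall x, wderiv (wderiv f) x = h x} &
     [/\ measurable_fun setT f, measurable_fun setT (wderiv f) &
      measurable_fun setT (wderiv (wderiv f))]].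
Proof.
move=> df dg ch; have cg := hasder_cont dg.
have w1 := hasder_is_wderiv df cg; have w2 := hasder_is_wderiv dg ch.
have wd1 : weakly_differentiable f by exists g.
have [_ l1 _] := wderivP wd1.
have e1 := wderiv_ae w1.
have w3 := is_wderiv_ae l1 e1 w2.
have wd2 : weakly_differentiable (wderiv f) by exists h.
have [_ l2 _] := wderivP wd2.
split => //; first exact: wderiv_ae.
by split; [exact: cont_measurable (hasder_cont df)|case: l1|case: l2].
Qed.

Lemma Lnorm2_supp f g a b : a < b -> continuous g -> measurable_fun setT f ->
  {ae mu, forall x, f x = (g \_ `[a, b]) x} ->
  Lnorm mu 2%:E (EFin \o f) = (Num.sqrt (ig a b (fun x => g x ^+ 2)))%:E.
Proof.
move=> ab cg mf fg; rewrite unlock /Lnorm.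
have -> : (\int[mu]_x (`|(EFin \o f) x| `^ 2) = (ig a b (fun x => g x ^+ 2))%:E)%E.
  rewrite -ig_integral //; last by cont.
  rewrite [RHS]integral_mkcond.
  have -> : (fun x => (g x ^+ 2)%:E) \_ `[a, b] = EFin \o (fun x => (g \_ `[a, b]) x ^+ 2).
    by apply/funext => x /=; rewrite !patchE; case: ifPn => // _; rewrite expr0n.
  have -> : (fun x => `|(EFin \o f) x| `^ 2)%E = EFin \o (fun x => f x ^+ 2).
    by apply/funext => x /=; rewrite powR_mulrn // real_normK ?num_real.
  have mg : measurable_fun setT (g \_ `[a, b]).
    apply/(measurable_restrictT _ _).1 => //.
    by apply: measurable_funS (cont_measurable cg).
  apply: ge0_ae_eq_integral => //.
  - by apply/measurable_EFinP; exact: measurable_funX.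
  - by apply/measurable_EFinP; exact: measurable_funX.
  - by move=> x _; rewrite lee_fin sqr_ge0.
  - by move=> x _; rewrite lee_fin sqr_ge0.
  - by apply: (ae_imp fg) => x /= -> _.
rewrite poweR_EFin powR12_sqrt //; apply: ig_ge0; [by cont|exact: ltW|].
by move=> x _; exact: sqr_ge0.
Qed.

Lemma L2_itv f g a b : a < b -> continuous g -> measurable_fun setT f ->
  {ae mu, forall x, f x = g x} ->
  L2 `[a, b] f /\ L2norm `[a, b] f ^+ 2 = ig a b (fun x => g x ^+ 2).
Proof.
move=> ab cg mf fg.
have i0 : 0 <= ig a b (fun x => g x ^+ 2).
  by apply: ig_ge0; [cont|exact: ltW|move=> x _; exact: sqr_ge0].
have mf' : measurable_fun setT (f \_ `[a, b]) by apply/(measurable_restrictT _ _).1 => //; exact: measurable_funS mf.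
have e : {ae mu, forall x, (f \_ `[a, b]) x = (g \_ `[a, b]) x}.
  by apply: (ae_imp fg) => x; rewrite !patchE => ->.
have N := Lnorm2_supp ab cg mf' e.
split; last by rewrite /L2norm N /= sqr_sqrtr.
rewrite /L2 /= inE; apply/andP; split; rewrite inE //=.
by rewrite /finite_norm N ltry.
Qed.

Lemma L2_supp f g a b : a < b -> continuous g -> measurable_fun setT f ->
  {ae mu, forall x, f x = g x} -> (forall x, ~~ (a <= x <= b) -> g x = 0) ->
  L2 setT f /\ L2norm setT f ^+ 2 = ig a b (fun x => g x ^+ 2).
Proof.
move=> ab cg mf fg g0.
have i0 : 0 <= ig a b (fun x => g x ^+ 2).
  by apply: ig_ge0; [cont|exact: ltW|move=> x _; exact: sqr_ge0].
have fT : f \_ setT = f by rewrite patch_setT.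
have e : {ae mu, forall x, f x = (g \_ `[a, b]) x}.
  apply: (ae_imp fg) => x ->; rewrite patchE; case: ifPn => // /negP hx; rewrite g0 //.
  by apply/negP => hx'; apply: hx; rewrite inE /= in_itv.
have N := Lnorm2_supp ab cg mf e.
split; last by rewrite /L2norm fT N /= sqr_sqrtr.
rewrite /L2 /= fT inE; apply/andP; split; rewrite inE //=.
by rewrite /finite_norm N ltry.
Qed.

(** The form in which square integrability is used from here on: a bound common to all segments. *)
Lemma L2_ig_bounded f : continuous f -> L2 setT f ->
  exists M, forall a b, a < b -> ig a b (fun x => f x ^+ 2) <= M.
Proof.
move=> cf; rewrite /L2 /= patch_setT inE => /andP[_]; rewrite inE /= /finite_norm unlock /Lnorm.
move=> /lty_poweRy; rewrite invr_eq0 pnatr_eq0 => /(_ isT) fin.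
set I := (\int[mu]_x _)%E in fin.
exists (fine I) => a b ab.
rewrite -lee_fin fineK; last first.
  by rewrite ge0_fin_numE //; apply: integral_ge0 => x _; exact: poweR_ge0.
rewrite -ig_integral //; last by cont.
have -> : I = (\int[mu]_x (f x ^+ 2)%:E)%E.
  apply: eq_integral => x _ /=.
  by rewrite powR_mulrn // real_normK ?num_real.
apply: ge0_subset_integral => //.
  by apply/measurable_EFinP; apply: cont_measurable; cont.
by move=> x _; rewrite lee_fin sqr_ge0.
Qed.

End weak_derivative_classical.

(** * Coercivity on the line and on long periods *)

Section line_coercivity.
Context {R : realType}.
Notation mu_ := (@lebesgue_measure R).
Implicit Types (f g q psi : R -> R) (a b c x S K Q : R).

Definition vanishes_off f a b := forall x, ~~ (a <= x <= b) -> f x = 0.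

Lemma vanishes_off_deriv f (f' : R -> R) a b : hasder f f' ->
  vanishes_off f a b -> vanishes_off f' a b.
Proof.
move=> df f0 x hx; have <- : (f^`())%classic x = f' x by rewrite (hasder_derive1 df).
rewrite derive1E (@near_eq_derive _ _ _ _ (fun=> 0)) ?derive_cst //.
move: hx; rewrite negb_and -!ltNge => /orP[] hx.
  near=> y; apply: f0; rewrite negb_and -!ltNge; apply/orP; left.
  by near: y; exact: lt_nbhsl.
near=> y; apply: f0; rewrite negb_and -!ltNge; apply/orP; right.
by near: y; exact: lt_nbhsr.
Unshelve. all: by end_near. Qed.

(** The lower bound for [- phi'' + q phi], restricted to compactly supported C^2 functions so that
    it involves only integrals over a segment carrying the support. *)
Definition line_coercive q K := forall (phi phi1 phi2 : R -> R) a b, a < b ->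
  hasder phi phi1 -> hasder phi1 phi2 -> continuous phi2 ->
  vanishes_off phi a b ->
  ig a b (fun x => phi x ^+ 2) <=
    K * ig a b (fun x => (q x * phi x - phi2 x) ^+ 2).

(** A compactly supported C^2 function belongs to [H2], and the operator takes its classical value
    almost everywhere, so the bounded inverse applies. The constant is squared because the integrals
    are squared norms. *)
Lemma invertible_line_coercive (omega mu : R) (V psi : R -> R) :
  continuous V -> continuous psi ->
  invertible_on_L2 (linearization omega V mu psi) ->
  exists2 K, 0 <= K & line_coercive (fun x => mu * V x + omega + 3 * psi x ^+ 2) K.
Proof.
move=> cV cpsi [_ _ [K hK]]; exists (K ^+ 2); first exact: sqr_ge0.
move=> phi phi1 phi2 a b ab d1 d2 c2 z.
have [tw e1 e2 [m0 m1 m2]] := C2_wderiv d1 d2 c2.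
have cphi := hasder_cont d1; have cphi1 := hasder_cont d2.
have z1 := vanishes_off_deriv d1 z; have z2 := vanishes_off_deriv d2 z1.
have e0 : {ae mu_, forall x, phi x = phi x} by apply: (ae_imp e1).
have [l0 n0] := L2_supp ab cphi m0 e0 z.
have [l1 _] := L2_supp ab cphi1 m1 e1 z1.
have [l2 _] := L2_supp ab c2 m2 e2 z2.
have Hphi : H2 phi by split.
have := hK _ Hphi.
set A := linearization _ _ _ _ _ => hA.
have mA : measurable_fun setT A.
  rewrite /A /linearization; apply: measurable_funD; [apply: measurable_funD|].
  - apply: measurable_funD; first exact: measurable_funN.
    by apply: cont_measurable; cont.
  - by apply: cont_measurable; cont.
  - by apply: cont_measurable; cont.
pose g x := (mu * V x + omega + 3 * psi x ^+ 2) * phi x - phi2 x.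
have eA : {ae mu_, forall x, A x = g x}.
  by apply: (ae_imp e2) => x h; rewrite /A /linearization h /g; ring.
have cg : continuous g by rewrite /g; cont.
have zg : vanishes_off g a b by move=> x hx; rewrite /g z // z2 // mulr0 subrr.
have [_ nA] := L2_supp ab cg mA eA zg.
have nn (f : R -> R) : 0 <= L2norm setT f by rewrite /L2norm fine_ge0 // Lnorm_ge0.
rewrite -n0 -nA -exprMn -[X in _ <= X]real_normK ?num_real //.
rewrite lerXn2r ?nnegrE //.
by rewrite (le_trans hA) // ler_norm.
Qed.

End line_coercivity.

(** * Transfer of coercivity from the line to long periods *)

Section periodic_coercivity.
Context {R : realType}.
Implicit Types (f g q : R -> R) (a b c x y t S K Q : R).

(* C^2, positive exactly on ]-1/3, 1/3[; the translates of [-1/4, 1/4] by 0 and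
   1/2 cover a period of length 1. *)
Definition bump (t : R) : R := tpow 3 (1 / 9 - t ^+ 2).
Definition bump1 (t : R) : R := 3 * tpow 2 (1 / 9 - t ^+ 2) * (- (2 * t)).
Definition bump2 (t : R) : R :=
  3 * (2 * tpow 1 (1 / 9 - t ^+ 2) * (- (2 * t)) * (- (2 * t)) +
  tpow 2 (1 / 9 - t ^+ 2) * (- 2)).

Lemma hasder_bump : hasder bump bump1.
Proof.
have l : hasder (fun t : R => 1 / 9 - t ^+ 2) (fun t => - (2 * t)).
  by hder; move=> t; rewrite /= ?expr1; ring.
exact: (hasder_comp (@hasder_tpow R 1) l).
Qed.

Lemma hasder_bump1 : hasder bump1 bump2.
Proof.
have l : hasder (fun t : R => 1 / 9 - t ^+ 2) (fun t => - (2 * t)).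
  by hder; move=> t; rewrite /= ?expr1; ring.
have h := hasder_comp (@hasder_tpow R 0) l.
by rewrite /bump1; hder; move=> t; rewrite /bump2; ring.
Qed.

Lemma cont_bump2 : continuous bump2.
Proof.
have c1 := @cont_tpow R 1; have c2 := @cont_tpow R 2.
by rewrite /bump2; cont.
Qed.

Lemma bump_off t : 1 / 3 <= `|t| -> [/\ bump t = 0, bump1 t = 0 & bump2 t = 0].
Proof.
move=> ht; have t2 : 1 / 9 - t ^+ 2 <= 0.
  have : (1 / 3) ^+ 2 <= `|t| ^+ 2 by rewrite lerXn2r // nnegrE.
  by rewrite real_normK ?num_real //; lra.
by rewrite /bump /bump1 /bump2 !tpow_le0 //; split; ring.
Qed.

Lemma bump_bounds t : [/\ bump t ^+ 2 <= 1, bump1 t ^+ 2 <= 1 & bump2 t ^+ 2 <= 1].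
Proof.
have [ht|ht] := leP (1 / 3) `|t|.
  by have [-> -> ->] := bump_off ht; rewrite expr0n /=; split; lra.
have t2 : t ^+ 2 <= 1 / 9.
  have : `|t| ^+ 2 <= (1 / 3) ^+ 2 by rewrite lerXn2r ?nnegrE // ltW.
  by rewrite real_normK ?num_real //; lra.
have t0 := sqr_ge0 t.
rewrite /bump /bump1 /bump2 !tpow_ge0E; try lra.
move: ht; rewrite ltr_norml => /andP[h1 h2].
set u := 1 / 9 - t ^+ 2.
have u0 : 0 <= u by rewrite /u; lra.
have u1 : u <= 1 / 9 by rewrite /u; lra.
have u2 : u ^+ 2 <= 1 / 9 * u by rewrite expr2; apply: ler_wpM2r.
have u20 := sqr_ge0 u.
have sq1 (z : R) : -1 <= z -> z <= 1 -> z ^+ 2 <= 1 by move=> *; nra.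
split; apply: sq1.
- have u3 : 0 <= u ^+ 3 := exprn_ge0 3 u0.
  by lra.
- have ule1 : u <= 1 by lra.
  exact: (exprn_ile1 3 u0 ule1).
- have : 0 <= u ^+ 2 * (1 / 3 - t) by apply: mulr_ge0 => //; lra.
  by lra.
- have : 0 <= u ^+ 2 * (t - - (1 / 3)) by apply: mulr_ge0 => //; lra.
  by lra.
- have : 0 <= u * t ^+ 2 by exact: mulr_ge0.
  by rewrite expr1; lra.
- have : u * t ^+ 2 <= 1 / 9 * (1 / 9) by apply: ler_pM.
  by rewrite expr1; lra.
Qed.

(** On this interval [1/9 - t^2 >= 1/9 - 1/16 = 7/144]; the exponent 6 is the cube in [bump] times
    the square. *)
Lemma bump_low t : `|t| <= 1 / 4 -> (7 / 144) ^+ 6 <= bump t ^+ 2.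
Proof.
move=> ht; have t2 : t ^+ 2 <= 1 / 16.
  have : `|t| ^+ 2 <= (1 / 4) ^+ 2 by rewrite lerXn2r ?nnegrE.
  by rewrite real_normK ?num_real //; lra.
rewrite /bump tpow_ge0E; last by lra.
by rewrite -exprM lerXn2r ?nnegrE //; lra.
Qed.

Lemma ig_period f S y : continuous f -> periodic f S ->
  ig (y - S / 2) (y + S / 2) f = ig 0 S f.
Proof.
move=> cf pf; rewrite -(ig_periodic (y - S / 2) cf pf).
by congr ig; lra.
Qed.

(** The line estimate is applied to [bump((x - y)/S) a]. Four terms appear: the cut-off [f], the
    change of potential (cost [e]), and the commutators with [bump1] (cost [2/S]) and [bump2] (cost
    [1/S^2], weakened to [1/S]). Squaring their sum gives the 4 in front. *)
Lemma localized_estimate q qn K S (e : R) y (a a1 f : R -> R) :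
  line_coercive q K -> 0 <= K -> 1 <= S -> continuous q -> continuous qn ->
  (forall x, y - S / 3 <= x <= y + S / 3 -> `|qn x - q x| <= e) ->
  continuous f -> periodic f S ->
  hasder a a1 -> hasder a1 (fun x => qn x * a x - f x) -> periodic a S ->
  (7 / 144) ^+ 6 * ig (y - S / 4) (y + S / 4) (fun x => a x ^+ 2) <=
   4 * K * (ig 0 S (fun x => f x ^+ 2)
     + (e ^+ 2 + 1 / S ^+ 2) * ig 0 S (fun x => a x ^+ 2)
     + 4 / S ^+ 2 * ig 0 S (fun x => a1 x ^+ 2)).
Proof.
move=> lc K0 S1 cq cqn hq cf pf da da1 pa.
have pa1 := periodic_hasder da pa.
have ca := hasder_cont da; have ca1 := hasder_cont da1.
have S0 : 0 < S by lra.
have b := hasder_bump; have b1 := hasder_bump1; have cb2 := cont_bump2.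
have l : hasder (fun x : R => (x - y) / S) (fun=> 1 / S).
  by hder; move=> x; ring.
have e0 := hasder_comp b l; have e1 := hasder_comp b1 l.
have cl := hasder_cont l; have ce2 := cont_comp cb2 cl.
have ce0 := hasder_cont e0; have ce1 := hasder_cont e1.
pose phi x := bump ((x - y) / S) * a x.
pose phi1 x := bump1 ((x - y) / S) / S * a x + bump ((x - y) / S) * a1 x.
pose phi2 x := bump2 ((x - y) / S) / S ^+ 2 * a x + 2 * bump1 ((x - y) / S) / S * a1 x
   + bump ((x - y) / S) * (qn x * a x - f x).
have d1 : hasder phi phi1.
  by rewrite /phi; hder; move=> x; rewrite /phi1; ring.
have d2 : hasder phi1 phi2.
  by rewrite /phi1; hder; move=> x; rewrite /phi2; field; rewrite gt_eqF.
have c2 : continuous phi2 by rewrite /phi2; cont.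
have off x : ~~ (y - S / 3 <= x <= y + S / 3) -> 1 / 3 <= `|(x - y) / S|.
  move=> hx; rewrite normrM normfV (gtr0_norm S0) ler_pdivlMr //.
  move: hx; rewrite negb_and -!ltNge ler_normr => /orP[h|h]; apply/orP; [right|left]; lra.
have z : vanishes_off phi (y - S / 3) (y + S / 3).
  by move=> x /off/bump_off[bx _ _]; rewrite /phi bx mul0r.
have := lc _ _ _ (y - S / 3) (y + S / 3) ltac:(lra) d1 d2 c2 z.
have low : (7 / 144) ^+ 6 * ig (y - S / 4) (y + S / 4) (fun x => a x ^+ 2) <=
    ig (y - S / 3) (y + S / 3) (fun x => phi x ^+ 2).
  have cphi := hasder_cont d1.
  rewrite -igZ; last by cont.
  apply: (@le_trans _ _ (ig (y - S / 4) (y + S / 4) (fun x => phi x ^+ 2))).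
    apply: ig_le; [by cont|by cont|lra|move=> x /andP[h1 h2]].
    rewrite /phi [leRHS]exprMn; apply: ler_wpM2r; first exact: sqr_ge0.
    apply: bump_low; rewrite normrM normfV (gtr0_norm S0) ler_pdivrMr // ler_norml.
    by apply/andP; split; lra.
  by apply: ig_subset => //; [cont|move=> x; exact: sqr_ge0|lra..].
move=> up; apply: (le_trans low); apply: (le_trans up).
set F := fun x => f x ^+ 2; set A := fun x => a x ^+ 2; set A1 := fun x => a1 x ^+ 2.
have cF : continuous F by rewrite /F; cont.
have cA : continuous A by rewrite /A; cont.
have cA1 : continuous A1 by rewrite /A1; cont.
pose G x := 4 * (F x + (e ^+ 2 + 1 / S ^+ 2) * A x + 4 / S ^+ 2 * A1 x).
have cG : continuous G by rewrite /G; cont.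
have G0 x : 0 <= G x.
  have i2 : 0 <= 1 / S ^+ 2 by rewrite divr_ge0 // exprn_ge0 // ltW.
  have i4 : 0 <= 4 / S ^+ 2 by rewrite divr_ge0 // exprn_ge0 // ltW.
  rewrite /G mulr_ge0 // addr_ge0 //; last by rewrite mulr_ge0 // sqr_ge0.
  by rewrite addr_ge0 ?sqr_ge0 // mulr_ge0 ?sqr_ge0 // addr_ge0 // sqr_ge0.
have pG : periodic G S by move=> x; rewrite /G /F /A /A1 pf pa pa1.
have main : ig (y - S / 3) (y + S / 3) (fun x => (q x * phi x - phi2 x) ^+ 2) <= ig 0 S G.
  rewrite -(ig_period y cG pG).
  apply: (@le_trans _ _ (ig (y - S / 3) (y + S / 3) G)).
    have cphi := hasder_cont d1.
    apply: ig_le; [by cont|exact: cG|lra|move=> x hx].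
    have -> : q x * phi x - phi2 x = bump ((x - y) / S) * f x
       + (- (bump ((x - y) / S) * (qn x - q x) * a x)
       + (- (2 * bump1 ((x - y) / S) / S * a1 x) - bump2 ((x - y) / S) / S ^+ 2 * a x)).
      by rewrite /phi /phi2; ring.
    have [k0 k1 k2] := bump_bounds ((x - y) / S).
    move: (bump _) (bump1 _) (bump2 _) k0 k1 k2 => B B1 B2 k0 k1 k2.
    have hqx : (qn x - q x) ^+ 2 <= e ^+ 2.
      have h := hq x hx; rewrite -[X in X <= _]real_normK ?num_real // lerXn2r ?nnegrE //.
      exact: le_trans (normr_ge0 _) h.
    have s4 (u1 u2 u3 u4 : R) : (u1 + (u2 + (u3 + u4))) ^+ 2 <= 4 * (u1 ^+ 2 + u2 ^+ 2 + u3 ^+ 2 + u4 ^+ 2).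
      have := sqr_ge0 (u1 - u2); have := sqr_ge0 (u1 - u3); have := sqr_ge0 (u1 - u4).
      by have := sqr_ge0 (u2 - u3); have := sqr_ge0 (u2 - u4); have := sqr_ge0 (u3 - u4); nra.
    apply: (le_trans (s4 _ _ _ _)); rewrite /G; apply: ler_wpM2l => //.
    have f2 := sqr_ge0 (f x); have a2 := sqr_ge0 (a x); have a12 := sqr_ge0 (a1 x).
    have i2 : 0 <= (S^-1) ^+ 2 by exact: sqr_ge0.
    have S1' : (S^-1) ^+ 2 <= 1.
      by rewrite exprVn invf_le1 ?exprn_gt0 // expr2; nra.
    have t1 : (B * f x) ^+ 2 <= F x by rewrite exprMn ler_piMl.
    have t2 : (- (B * (qn x - q x) * a x)) ^+ 2 <= e ^+ 2 * A x.
      rewrite sqrrN !exprMn; apply: ler_wpM2r => //.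
      rewrite -[leRHS]mul1r; apply: ler_pM => //; exact: sqr_ge0.
    have t3 : (- (2 * B1 / S * a1 x)) ^+ 2 <= 4 / S ^+ 2 * A1 x.
      rewrite sqrrN exprMn; apply: ler_wpM2r => //; rewrite !exprMn -exprVn.
      apply: ler_wpM2r => //; lra.
    have t4 : (- (B2 / S ^+ 2 * a x)) ^+ 2 <= 1 / S ^+ 2 * A x.
      rewrite sqrrN exprMn; apply: ler_wpM2r => //; rewrite exprMn -exprVn mul1r.
      rewrite -[leRHS]mul1r; apply: ler_pM => //; try exact: sqr_ge0.
      by rewrite [leLHS]expr2 -[leRHS]mulr1; apply: ler_wpM2l.
    lra.
  by apply: ig_subset => //; lra.
have GE : ig 0 S G = 4 * (ig 0 S F + (e ^+ 2 + 1 / S ^+ 2) * ig 0 S A + 4 / S ^+ 2 * ig 0 S A1).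
  rewrite /G igZ; last by cont.
  by congr (_ * _); rewrite igD; [|by cont|by cont]; rewrite igD; [|by cont|by cont]; rewrite !igZ.
by have := ler_wpM2l K0 main; rewrite GE; lra.
Qed.

(** The estimates around 0 and [S/2] add up, since [-S/4, S/4] and [S/4, 3S/4] make one period.
    After [periodic_deriv_bound] eliminates [a1], the coefficient of the integral of [a^2] is at
    most half of [(7/144)^6] and is absorbed. That of [f^2] is at most [24 K], whence [48 K]. *)
Lemma periodic_coercive q qn K S Q (e : R) :
  line_coercive q K -> 0 <= K -> 1 <= S -> continuous q -> continuous qn ->
  periodic qn S -> (forall x, `|qn x| <= Q) ->
  (forall x, - (S / 2) <= x <= 5 / 6 * S -> `|qn x - q x| <= e) ->
  16 * K * (e ^+ 2 + (3 + 4 * Q) / S ^+ 2) <= (7 / 144) ^+ 6 ->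
  coercive qn S (48 * K / (7 / 144) ^+ 6).
Proof.
move=> lc K0 S1 cq cqn pqn hQ hq small a a1 f cf da da1 pa.
have pa1 := periodic_hasder da pa.
have pf : periodic f S.
  move=> x; have := periodic_hasder da1 pa1 x; rewrite /= pqn pa; lra.
have ca := hasder_cont da.
have S0 : 0 < S by lra.
have hq1 x : 0 - S / 3 <= x <= 0 + S / 3 -> `|qn x - q x| <= e.
  by move=> /andP[? ?]; apply: hq; apply/andP; split; lra.
have hq2 x : S / 2 - S / 3 <= x <= S / 2 + S / 3 -> `|qn x - q x| <= e.
  by move=> /andP[? ?]; apply: hq; apply/andP; split; lra.
have e1 := localized_estimate lc K0 S1 cq cqn hq1 cf pf da da1 pa.
have e2 := localized_estimate lc K0 S1 cq cqn hq2 cf pf da da1 pa.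
have e3 := periodic_deriv_bound cqn (ltW S0) hQ cf da da1 pa.
have pA : periodic (fun x => a x ^+ 2) S by move=> x; rewrite pa.
have cA : continuous (fun x => a x ^+ 2) by cont.
have sum : ig (0 - S / 4) (0 + S / 4) (fun x => a x ^+ 2) +
   ig (S / 2 - S / 4) (S / 2 + S / 4) (fun x => a x ^+ 2) = ig 0 S (fun x => a x ^+ 2).
  rewrite -(ig_periodic (0 - S / 4) cA pA).
  have -> : S / 2 - S / 4 = 0 + S / 4 by field.
  have -> : S / 2 + S / 4 = 0 - S / 4 + S by field.
  by rewrite -ig_split.
have A0 : 0 <= ig 0 S (fun x => a x ^+ 2).
  by apply: ig_ge0; [cont|exact: ltW|move=> x _; exact: sqr_ge0].
have F0 : 0 <= ig 0 S (fun x => f x ^+ 2).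
  by apply: ig_ge0; [cont|exact: ltW|move=> x _; exact: sqr_ge0].
move: sum e1 e2 e3 A0 F0.
move: (ig _ _ _) (ig _ _ _) (ig 0 S (fun x => a x ^+ 2)) (ig 0 S (fun x => a1 x ^+ 2))
  (ig 0 S (fun x => f x ^+ 2)) => I1 I2 A A1 F sum e1 e2 e3 A0 F0.
have i2 : 0 <= (S ^+ 2)^-1 by rewrite invr_ge0 sqr_ge0.
have i1 : (S ^+ 2)^-1 <= 1 by rewrite invf_le1 ?exprn_gt0 // expr2; nra.
set kap := (7 / 144) ^+ 6 in small e1 e2 *.
have k0 : 0 < kap by rewrite exprn_gt0 //; lra.
have h1 : kap * A <= 8 * K * (F + (e ^+ 2 + 1 / S ^+ 2) * A + 4 / S ^+ 2 * ((1 / 2 + Q) * A + 1 / 2 * F)).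
  have : 4 * K * (4 / S ^+ 2 * A1) <= 4 * K * (4 / S ^+ 2 * ((1 / 2 + Q) * A + 1 / 2 * F)).
    apply: ler_wpM2l; first exact: mulr_ge0.
    by apply: ler_wpM2l => //; rewrite mulr_ge0.
  have ks : kap * A = kap * I2 + kap * I1 by rewrite -sum mulrDr.
  by lra.
have h2 : 16 * K * (e ^+ 2 + (3 + 4 * Q) / S ^+ 2) * A <= kap * A by apply: ler_wpM2r.
have h3 : K * (S ^+ 2)^-1 * F <= K * F.
  by apply: ler_wpM2r => //; rewrite ler_piMr.
rewrite mulrAC ler_pdivlMr //.
move: h1 h2 h3; move: ((S ^+ 2)^-1) => s h1 h2 h3.
lra.
Qed.

End periodic_coercivity.

(** * Decay of psi - v *)

Section tails.
Context {R : realType}.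
Implicit Types (f g : R -> R) (a b c x y S P e : R).

(** The integrals from [X] are monotone and bounded; past a point where they come within [e] of
    their supremum, at most [e] is left. *)
Lemma bounded_integral_tail f (X M : R) : continuous f -> (forall x, 0 <= f x) ->
  (forall a b, X <= a -> a < b -> ig a b f <= M) ->
  forall e, 0 < e -> exists2 Y, X <= Y & forall a b, Y <= a -> a <= b -> ig a b f <= e.
Proof.
move=> cf f0 hM e e0.
pose E := [set ig X b f | b in [set b | X < b]].
have E0 : E !=set0 by exists (ig X (X + 1) f); exists (X + 1) => //=; lra.
have ubE : ubound E M by move=> _ [b /= Xb <-]; apply: hM.
have supE : has_sup E by split => //; exists M.
have [_ [Y /= XY <-] hY] := sup_adherent e0 supE.
exists Y => [|a b Ya ab]; first exact: ltW.
have hb : ig X (b + 1) f <= sup E.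
  by apply: ub_le_sup; [exists M|exists (b + 1) => //=; lra].
have h1 : ig a b f <= ig Y (b + 1) f by apply: ig_subset => //; lra.
by have := ig_split f X Y (b + 1); lra.
Qed.

(** The equation is tested with [eta^2 d], where [eta] is 1 on [a, b] and vanishes outside
    [a - 1, b + 1]. Absorbing the cross term costs [4 eta1^2 d^2]; ramps of slope at most 4 give
    [eta1^2 <= 64], whence 256. *)
Lemma caccioppoli (d d1 d2 : R -> R) P a b : hasder d d1 -> hasder d1 d2 ->
  continuous d2 -> (forall x, `|d2 x| <= P * `|d x|) -> a <= b ->
  ig a b (fun x => d1 x ^+ 2) <= (256 + 2 * P) * ig (a - 1) (b + 1) (fun x => d x ^+ 2).
Proof.
move=> dd dd1 cd2 hP ab.
have [r1 [dr cr1 br]] := @hasder_ramp R; have cr := hasder_cont dr.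
have cd := hasder_cont dd; have cd1 := hasder_cont dd1.
have la : hasder (fun x => x - (a - 1)) (fun=> 1) by hder; move=> x; ring.
have lb : hasder (fun x => b + 1 - x) (fun=> -1) by hder; move=> x; ring.
have ra := hasder_comp dr la; have rb := hasder_comp dr lb.
pose eta x := ramp (x - (a - 1)) * ramp (b + 1 - x).
pose eta1 x := ramp (x - (a - 1)) * (r1 (b + 1 - x) * -1) + ramp (b + 1 - x) * (r1 (x - (a - 1)) * 1).
have de : hasder eta eta1 := hasderM ra rb.
have ce := hasder_cont de.
have cla := hasder_cont la; have clb := hasder_cont lb.
have cea := cont_comp cr1 cla; have ceb := cont_comp cr1 clb.
have cra := hasder_cont ra; have crb := hasder_cont rb.
have ce1 : continuous eta1 by rewrite /eta1; cont.
have be x : eta1 x ^+ 2 <= 64.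
  have /andP[h1 h2] := ramp_itv (x - (a - 1)); have /andP[h3 h4] := ramp_itv (b + 1 - x).
  have n1 : `|ramp (x - (a - 1)) * (r1 (b + 1 - x) * -1)| <= 4.
    by rewrite normrM mulrN1 normrN (ger0_norm h1) -[4]mul1r; apply: ler_pM.
  have n2 : `|ramp (b + 1 - x) * (r1 (x - (a - 1)) * 1)| <= 4.
    by rewrite normrM mulr1 (ger0_norm h3) -[4]mul1r; apply: ler_pM.
  have n3 : `|eta1 x| <= 8.
    by rewrite /eta1 (le_trans (ler_normD _ _)) //; lra.
  have : `|eta1 x| ^+ 2 <= 8 ^+ 2 by rewrite lerXn2r ?nnegrE.
  by rewrite real_normK ?num_real //; lra.
have e2 x : 0 <= eta x ^+ 2 <= 1.
  have /andP[h1 h2] := ramp_itv (x - (a - 1)); have /andP[h3 h4] := ramp_itv (b + 1 - x).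
  rewrite sqr_ge0 /= expr_le1 // /eta ?mulr_ge0 // mulr_ile1 //.
have P0 x : 0 <= P * `|d x| by exact: le_trans (normr_ge0 _) (hP x).
pose I := a - 1; pose J := b + 1.
have IJ : I <= J by rewrite /I /J; lra.
have step1 : ig a b (fun x => d1 x ^+ 2) <= ig I J (fun x => eta x ^+ 2 * d1 x ^+ 2).
  apply: (@le_trans _ _ (ig a b (fun x => eta x ^+ 2 * d1 x ^+ 2))).
    apply: ig_le; [by cont|by cont|exact: ab|move=> x /andP[ax xb]].
    by rewrite /eta !ramp_ge1 ?mulr1 ?expr1n ?mul1r //; lra.
  apply: ig_subset; [by cont|by move=> x; rewrite mulr_ge0 // sqr_ge0|rewrite /I; lra|exact: ab|rewrite /J; lra].
have dE : hasder (fun x => eta x ^+ 2 * (d x * d1 x))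
  (fun x => eta x ^+ 2 * d1 x ^+ 2 + (2 * eta x * eta1 x * d x * d1 x + eta x ^+ 2 * d x * d2 x)).
  by hder; move=> x; rewrite /= ?expr1; ring.
have zero : ig I J (fun x => eta x ^+ 2 * d1 x ^+ 2 + (2 * eta x * eta1 x * d x * d1 x + eta x ^+ 2 * d x * d2 x)) = 0.
  rewrite (ig_ftc _ _ _ dE); last by cont.
  have -> : eta I = 0 by rewrite /eta /I subrr (@ramp_le0 _ 0) ?mul0r.
  have -> : eta J = 0 by rewrite /eta /J subrr (@ramp_le0 _ 0) ?mulr0.
  by rewrite expr0n /= !mul0r subrr.
have step2 : ig I J (fun x => eta x ^+ 2 * d1 x ^+ 2) <=
   ig I J (fun x => 2 * (eta x ^+ 2 * d1 x ^+ 2 + (2 * eta x * eta1 x * d x * d1 x + eta x ^+ 2 * d x * d2 x))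
     + (256 + 2 * P) * d x ^+ 2).
  apply: ig_le; [by cont|by cont|exact: IJ|move=> x _ /=].
  have b1 := be x; have /andP[b2 b3] := e2 x; have b4 := hP x.
  have h1 := sqr_ge0 (eta x * d1 x + 2 * (eta1 x * d x)).
  have h2 : eta1 x ^+ 2 * d x ^+ 2 <= 64 * d x ^+ 2 by apply: ler_wpM2r => //; exact: sqr_ge0.
  have h3 : - (eta x ^+ 2 * d x * d2 x) <= P * d x ^+ 2.
    rewrite (le_trans (ler_norm _)) // normrN -mulrA normrM [X in _ * X <= _]normrM.
    rewrite (ger0_norm b2) -[leRHS]mul1r; apply: ler_pM => //.
    rewrite -[d x ^+ 2]real_normK ?num_real // expr2 mulrCA.
    by apply: ler_wpM2l.
  have h4 : 0 <= eta1 x ^+ 2 * d x ^+ 2 by rewrite mulr_ge0 // sqr_ge0.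
  have h5 := sqr_ge0 (d x).
  lra.
apply: (le_trans step1); apply: (le_trans step2).
rewrite igD; [|by cont|by cont].
rewrite igZ; [|by cont]; rewrite zero mulr0 add0r igZ //; by cont.
Qed.

Lemma tail_decay (d d1 d2 : R -> R) P (X M : R) : hasder d d1 -> hasder d1 d2 ->
  continuous d2 -> 0 <= P -> (forall x, `|d2 x| <= P * `|d x|) ->
  (forall a b, X <= a -> a < b -> ig a b (fun x => d x ^+ 2) <= M) ->
  forall e, 0 < e -> exists Y, forall a b, Y <= a -> a <= b ->
    [/\ ig a b (fun x => d x ^+ 2) <= e, ig a b (fun x => d1 x ^+ 2) <= e & d a ^+ 2 <= e].
Proof.
move=> dd dd1 cd2 P0 hP hM e e0.
have cd := hasder_cont dd; have cd1 := hasder_cont dd1.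
pose C := 256 + 2 * P; have C0 : 0 < C by rewrite /C; lra.
(* This share is chosen so that the Sobolev bound, twice the sum of [e'] for [d] and [C e'] for
   [d1], is exactly [e]; the two integral bounds then follow as well. *)
have e'0 : 0 < e / (2 + 2 * C) by rewrite divr_gt0 //; lra.
have cf : continuous (fun x => d x ^+ 2) by cont.
have [Y XY hY] := bounded_integral_tail cf (fun x => sqr_ge0 (d x)) hM e'0.
have ee : e / (2 + 2 * C) * (2 + 2 * C) = e by rewrite divfK // gt_eqF //; lra.
have hd1 a b : Y + 1 <= a -> a <= b -> ig a b (fun x => d1 x ^+ 2) <= C * (e / (2 + 2 * C)).
  move=> ha ab; apply: (le_trans (caccioppoli dd dd1 cd2 hP ab)).
  by apply: ler_wpM2l; [exact: ltW|apply: hY; lra].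
have Ce : 0 <= C * (e / (2 + 2 * C)) by rewrite mulr_ge0 // ltW.
exists (Y + 1) => a b ha ab; split.
- have := hY a b ltac:(lra) ab; lra.
- have := hd1 a b ha ab; lra.
- have h1 := hY a (a + 1) ltac:(lra) ltac:(lra).
  have h2 := hd1 a (a + 1) ha ltac:(lra).
  have := @sobolev_sup _ d d1 a a dd cd1 ltac:(by rewrite lexx /= lerDl).
  lra.
Qed.

Lemma ig_opp_arg f a b : continuous f -> ig a b (fun x => f (- x)) = ig (- b) (- a) f.
Proof.
move=> cf; have h := hasder_opp_arg (hasder_prim cf).
have c : continuous (fun x : R => - x) by cont; exact: cont_id.
rewrite (@ig_ftc _ (fun x => - prim f (- x))); [by rewrite /ig; ring|by cont; exact: cont_comp|].
by hder; move=> x /=; rewrite opprK.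
Qed.

(** The left tail is the right tail of the reflected function. *)
Lemma tail_decay2 (d d1 d2 : R -> R) P (X M : R) : hasder d d1 -> hasder d1 d2 ->
  continuous d2 -> 0 <= P -> (forall x, `|d2 x| <= P * `|d x|) ->
  (forall a b, X <= a -> a < b -> ig a b (fun x => d x ^+ 2) <= M) ->
  (forall a b, b <= - X -> a < b -> ig a b (fun x => d x ^+ 2) <= M) ->
  forall e, 0 < e -> exists Y,
    [/\ forall a b, Y <= a -> a <= b ->
      ig a b (fun x => d x ^+ 2) <= e /\ ig a b (fun x => d1 x ^+ 2) <= e,
     forall a b, b <= - Y -> a <= b ->
      ig a b (fun x => d x ^+ 2) <= e /\ ig a b (fun x => d1 x ^+ 2) <= e &
     forall x, Y <= `|x| -> d x ^+ 2 <= e].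
Proof.
move=> dd dd1 cd2 P0 hP hM hM' e e0.
have [Y1 h1] := tail_decay dd dd1 cd2 P0 hP hM e0.
have cd := hasder_cont dd; have cd1 := hasder_cont dd1.
have c2 : continuous (fun x => d x ^+ 2) by cont.
have c12 : continuous (fun x => d1 x ^+ 2) by cont.
have du := hasder_opp_arg dd.
have du1 : hasder (fun x => - d1 (- x)) (fun x => d2 (- x)).
  have h := hasder_opp_arg dd1; hder.
  by move=> x; rewrite opprK.
have cN : continuous (fun x : R => - x) by cont; exact: cont_id.
have cu2 : continuous (fun x => d2 (- x)) by exact: cont_comp.
have hMu a b : X <= a -> a < b -> ig a b (fun x => d (- x) ^+ 2) <= M.
  by move=> Xa ab; rewrite (ig_opp_arg a b c2); apply: hM'; lra.
have [Y2 h2] := tail_decay du du1 cu2 P0 (fun x => hP (- x)) hMu e0.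
exists (Num.max Y1 Y2); split.
- by move=> a b; rewrite ge_max => /andP[ha _] ab; have [] := h1 a b ha ab.
- move=> a b hb ab.
  have hb2 : Y2 <= - b by rewrite lerNr (le_trans hb) // lerN2 le_max lexx orbT.
  have [i1 i2 _] := h2 (- b) (- a) hb2 ltac:(lra).
  move: i1 i2; rewrite (ig_opp_arg _ _ c2) !opprK => i1.
  have -> : (fun x => (- d1 (- x)) ^+ 2) = (fun x => d1 (- x) ^+ 2).
    by apply/funext => x; rewrite sqrrN.
  by rewrite (ig_opp_arg _ _ c12) !opprK.
- move=> x; rewrite ge_max => /andP[x1 x2].
  case: (ger0P x) x1 x2 => x0 x1 x2; first by have [] := h1 x x x1 (lexx x).
  by have [_ _] := h2 (- x) (- x) x2 (lexx _); rewrite opprK.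
Qed.

End tails.

(** * Gluing *)

Section periodization.
Context {R : realType}.
Implicit Types (f g : R -> R) (a b c x y S : R).

Definition cell S x : int := Num.floor ((x + S / 2) / S).

Definition periodize S g x := g (x - (cell S x)%:~R * S).

Lemma cellP S x : 0 < S -> - (S / 2) <= x - (cell S x)%:~R * S < S / 2.
Proof.
move=> S0; rewrite /cell; have := Num.Theory.floor_itv ((x + S / 2) / S); move: (Num.floor _) => k.
rewrite intrD ler_pdivlMr // ltr_pdivrMr // mulr1z mulrDl mul1r => /andP[h1 h2].
by apply/andP; split; lra.
Qed.

Lemma periodize_periodic S g : 0 < S -> periodic (periodize S g) S.
Proof.
move=> S0 x; rewrite /periodize /cell; congr g.
have -> : (x + S + S / 2) / S = (x + S / 2) / S + 1%:~R by rewrite mulr1z; field; rewrite gt_eqF.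
rewrite Num.Theory.floorDrz ?intr_int // Num.Theory.intrKfloor intrD mulr1z; ring.
Qed.

(* Vanishing slightly beyond S/2 makes the periodization of the restriction of g
   to [-S/2, S/2[ as smooth as g. *)
Definition ring_zero S g := forall x, S / 3 < `|x| -> `|x| < 2 / 3 * S -> g x = 0.

(** The translate need not be that of the cell of [x]. Two admissible translates that differ are at
    least [S] apart, which forces both points into the ring where [g] vanishes. *)
Lemma periodizeE S g (k : int) x : 0 < S -> ring_zero S g ->
  `|x - k%:~R * S| < 2 / 3 * S -> periodize S g x = g (x - k%:~R * S).
Proof.
move=> S0 gz; rewrite /periodize; have := cellP x S0; move: (cell S x) => l.
have [->//|lk] := eqVneq l k.
move: lk; rewrite -subr_eq0 => lk.
have : (1 : R) <= `|(l - k)%:~R|.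
  by rewrite -intr_norm -[1]/(1%:~R) ler_int -gtz0_ge1 normr_gt0.
rewrite intrB; move: (l%:~R) (k%:~R) => lr kr h1 /andP[h2 h3] h4.
have e : (x - kr * S) - (x - lr * S) = (lr - kr) * S by ring.
move: h2 h3 h4 e; move: (x - kr * S) (x - lr * S) => u w h2 h3 h4 e.
have h5 : S <= `|u - w| by rewrite e normrM (gtr0_norm S0) ler_peMl // ltW.
rewrite !gz // ?normr0.
- move: h5 h4; case: (ger0P u) => ?; case: (ger0P (u - w)) => *; lra.
- move: h5 h4; rewrite ltr_normr; case: (ger0P u) => ?; case: (ger0P (u - w)) => *; apply/orP; (left; lra) || (right; lra).
- by rewrite ltr_norml; apply/andP; split; lra.
Qed.

Lemma periodize_near S g x : 0 < S -> ring_zero S g ->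
  \forall y \near x, g (y + - ((cell S x)%:~R * S)) = periodize S g y.
Proof.
(* The room [S/6 = 2S/3 - S/2] lets one translate represent the periodization on a whole
   neighbourhood, so that derivatives and continuity carry over. *)
move=> S0 gz; have S6 : 0 < S / 6 by lra.
have B : \forall y \near x, ball x (S / 6) y by exact: (nbhsx_ballx x (S / 6) S6).
near=> y; have : ball x (S / 6) y by near: y.
rewrite /ball /= ltr_distlC => /andP[h1 h2].
have /andP[h3 h4] := cellP x S0.
by rewrite (periodizeE S0 gz (k := cell S x)) // ltr_norml; apply/andP; split; lra.
Unshelve. all: by end_near. Qed.

Lemma ring_zero_deriv S g (g1 : R -> R) : 0 < S -> hasder g g1 -> ring_zero S g -> ring_zero S g1.
Proof.
move=> S0 dg gz x hx1 hx2; rewrite -(hasder_derive1 dg).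
rewrite derive1E (@near_eq_derive _ _ _ _ (fun=> 0)) ?derive_cst //.
pose e := Num.min (`|x| - S / 3) (2 / 3 * S - `|x|).
have e0 : 0 < e by rewrite /e lt_min; apply/andP; split; lra.
have B : \forall y \near x, ball x e y by exact: (nbhsx_ballx x e e0).
near=> y; have : ball x e y by near: y.
rewrite /ball /= /e lt_min => /andP[h1 h2].
have := ler_dist_dist x y; rewrite ler_norml => /andP[h3 h4].
by apply: gz; lra.
Unshelve. all: by end_near. Qed.

Lemma hasder_periodize S g (g1 : R -> R) : 0 < S -> hasder g g1 -> ring_zero S g ->
  hasder (periodize S g) (periodize S g1).
Proof.
move=> S0 dg gz x.
exact: (hasder_near (hasder_shift (- ((cell S x)%:~R * S)) dg) (periodize_near x S0 gz)).
Qed.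

Lemma cont_periodize S g : 0 < S -> continuous g -> ring_zero S g ->
  continuous (periodize S g).
Proof.
move=> S0 cg gz x; have near := periodize_near x S0 gz.
have c : continuous (fun y => g (y + - ((cell S x)%:~R * S))) by cont.
have := c x; rewrite /continuous_at {2}/periodize => h.
by apply: cvg_trans h; exact: near_eq_cvg.
Qed.

Lemma periodize_center S g x : 0 < S -> ring_zero S g -> `|x| < 2 / 3 * S ->
  periodize S g x = g x.
Proof.
by move=> S0 gz hx; rewrite (periodizeE S0 gz (k := 0)) mul0r subr0.
Qed.

End periodization.

(** * The glued periodic profile and its residual *)

Section gluing.
Context {R : realType}.
Implicit Types (a b c x y S B e : R).

(** This is the residual of [v + c d] after the linear terms have cancelled. Convexity keeps
    [v + c d] within [B], so each cubic difference is at most [3 B^2 |d|]; the derivatives of the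
    cut-off add [|d| + 2 |d1|]. *)
Lemma residual_bound (B v p c c1 c2 d d1 : R) : `|v| <= B -> `|p| <= B -> d = p - v ->
  0 <= c <= 1 -> `|c1| <= 1 -> `|c2| <= 1 ->
  ((v + c * d) ^+ 3 - v ^+ 3 - c2 * d - 2 * c1 * d1 - c * (p ^+ 3 - v ^+ 3)) ^+ 2
   <= (2 * (1 + 6 * B ^+ 2) ^+ 2 + 8) * (d ^+ 2 + d1 ^+ 2).
Proof.
move=> hv hp dE /andP[c0 c1'] hc1 hc2.
have sqB (z : R) : `|z| <= B -> z ^+ 2 <= B ^+ 2.
  move=> h; rewrite -[X in X <= _]real_normK ?num_real // lerXn2r ?nnegrE //.
  exact: le_trans (normr_ge0 _) h.
have cub (y z : R) : `|y| <= B -> `|z| <= B -> `|y ^+ 3 - z ^+ 3| <= 3 * B ^+ 2 * `|y - z|.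
  move=> hy hz; have -> : y ^+ 3 - z ^+ 3 = (y ^+ 2 + y * z + z ^+ 2) * (y - z) by ring.
  rewrite normrM; apply: ler_wpM2r => //.
  have := sqB _ hy; have := sqB _ hz; have := sqr_ge0 (y - z); have := sqr_ge0 (y + z).
  by rewrite ler_norml => *; apply/andP; split; nra.
have hw : `|v + c * d| <= B.
  have -> : v + c * d = (1 - c) * v + c * p by rewrite dE; ring.
  rewrite (le_trans (ler_normD _ _)) // !normrM (ger0_norm c0) ger0_norm; last by lra.
  have : (1 - c) * `|v| <= (1 - c) * B by apply: ler_wpM2l => //; lra.
  have : c * `|p| <= c * B by apply: ler_wpM2l.
  by lra.
have d0 := normr_ge0 d; have B0 := sqr_ge0 B.
have k1 : `|(v + c * d) ^+ 3 - v ^+ 3| <= 3 * B ^+ 2 * `|d|.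
  apply: (le_trans (cub _ _ hw hv)); rewrite addrC addKr normrM (ger0_norm c0).
  by apply: ler_wpM2l; [exact: mulr_ge0|rewrite ler_piMl].
have k2 : `|c * (p ^+ 3 - v ^+ 3)| <= 3 * B ^+ 2 * `|d|.
  rewrite normrM (ger0_norm c0); have h := cub _ _ hp hv; rewrite -dE in h.
  by apply: le_trans h; rewrite ler_piMl.
have k3 : `|c2 * d| <= `|d| by rewrite normrM ler_piMl.
have k4 : `|2 * c1 * d1| <= 2 * `|d1|.
  by rewrite !normrM (ger0_norm (ler0n _ 2)) -mulrA; apply: ler_wpM2l => //; rewrite ler_piMl.
set Z := (v + c * d) ^+ 3 - _ - _ - _ - _.
have k5 : `|Z| <= (1 + 6 * B ^+ 2) * `|d| + 2 * `|d1|.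
  rewrite /Z (le_trans (ler_normB _ _)) // (le_trans (lerD (ler_normB _ _) (lexx _))) //.
  rewrite (le_trans (lerD (lerD (ler_normB _ _) (lexx _)) (lexx _))) //.
  by lra.
have n1 := normr_ge0 d1.
have k6 : `|Z| ^+ 2 <= ((1 + 6 * B ^+ 2) * `|d| + 2 * `|d1|) ^+ 2.
  by rewrite lerXn2r ?nnegrE // addr_ge0 // mulr_ge0 //; lra.
rewrite real_normK ?num_real // in k6; apply: (le_trans k6).
rewrite -[d ^+ 2]real_normK ?num_real // -[d1 ^+ 2]real_normK ?num_real //.
move: (`|d|) (`|d1|) (1 + 6 * B ^+ 2) => u w b.
have := sqr_ge0 (b * u - 2 * w); have := sqr_ge0 u; have := sqr_ge0 (b * w); nra.
Qed.

(** Since [v] is already periodic, only [chi d] has to be periodized. The tails start at [S/8],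
    short of [S/6], so that [chi] is 1 in a neighbourhood of [-S/8, S/8] and the residual vanishes
    there. *)
Lemma glued_profile (W v v1 v2 psi psi1 psi2 chi chi1 chi2 : R -> R) (S B e : R) :
  0 < S -> continuous W -> periodic W S ->
  hasder v v1 -> hasder v1 v2 -> (forall x, v2 x = W x * v x + v x ^+ 3) -> periodic v S ->
  hasder psi psi1 -> hasder psi1 psi2 -> (forall x, psi2 x = W x * psi x + psi x ^+ 3) ->
  hasder chi chi1 -> hasder chi1 chi2 -> continuous chi2 -> periodic chi S ->
  (forall x, 0 <= chi x <= 1) -> (forall x, `|chi1 x| <= 1) -> (forall x, `|chi2 x| <= 1) ->
  (forall x, - (S / 6) <= x <= S / 6 -> chi x = 1) ->
  (forall x, - (S / 2) <= x <= - (S / 3) \/ S / 3 <= x <= S / 2 -> chi x = 0) ->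
  (forall x, `|v x| <= B) -> (forall x, `|psi x| <= B) ->
  let d := fun x => psi x - v x in let d1 := fun x => psi1 x - v1 x in
  (forall x, S / 8 <= `|x| -> d x ^+ 2 <= e ^+ 2) -> 0 <= e ->
  exists w w1 w2 : R -> R, let r := fun x => W x * w x + w x ^+ 3 - w2 x in
  [/\ hasder w w1, hasder w1 w2, continuous w2, periodic w S &
    [/\ forall x, `|w x| <= B,
      forall x, - (S / 2) <= x < S / 2 -> w x = chi x * psi x + (1 - chi x) * v x,
      forall x, - (S / 2) <= x <= 5 / 6 * S -> `|w x - psi x| <= 2 * e &
      ig 0 S (fun x => r x ^+ 2) <= (2 * (1 + 6 * B ^+ 2) ^+ 2 + 8) *
       (ig (S / 8) (S / 2) (fun x => d x ^+ 2) + ig (S / 8) (S / 2) (fun x => d1 x ^+ 2) +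
        (ig (- (S / 2)) (- (S / 8)) (fun x => d x ^+ 2) + ig (- (S / 2)) (- (S / 8)) (fun x => d1 x ^+ 2)))]].
Proof.
move=> S0 cW pW dv dv1 v2E pv dp dp1 p2E dc dc1 cc2 pc c01 c1b c2b cone czero vB pB d d1 small e0.
have cv := hasder_cont dv; have cp := hasder_cont dp.
have cv2 : continuous v2 by rewrite (funext v2E); cont.
have cp2 : continuous psi2 by rewrite (funext p2E); cont.
pose d2 x := psi2 x - v2 x.
have dd : hasder d d1 by rewrite /d; hder.
have dd1 : hasder d1 d2 by rewrite /d1; hder.
have cd := hasder_cont dd; have cd1 := hasder_cont dd1.
have cd2 : continuous d2 by rewrite /d2; cont.
pose g x := chi x * d x; pose g1 x := chi1 x * d x + chi x * d1 x.
pose g2 x := chi2 x * d x + 2 * chi1 x * d1 x + chi x * d2 x.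
have dg : hasder g g1 by rewrite /g; hder; move=> x; rewrite /g1; ring.
have dg1 : hasder g1 g2 by rewrite /g1; hder; move=> x; rewrite /g2; ring.
have cc := hasder_cont dc; have cc1 := hasder_cont dc1.
have cg2 : continuous g2 by rewrite /g2; cont.
(* The hypothesis on [chi] stops at [S/2]; periodicity carries the zero set on to [2S/3], which
   gives the ring needed for periodization. *)
have czero' x : S / 3 <= `|x| -> `|x| <= 2 / 3 * S -> chi x = 0.
  move=> h1 h2; have [x0|x0] := ger0P x.
    have [h3|h3] := leP x (S / 2).
      by apply: czero; right; apply/andP; split=> //; move: h1; rewrite ger0_norm.
    have -> : x = x - S + S by ring.
    rewrite pc; apply: czero; left; apply/andP; split; last by move: h2; rewrite ger0_norm //; lra.
    lra.
  have [h3|h3] := leP (- (S / 2)) x.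
    by apply: czero; left; apply/andP; split=> //; move: h1; rewrite ltr0_norm //; lra.
  rewrite -pc; apply: czero; right; apply/andP; split; move: h2; rewrite ltr0_norm //; lra.
have gz : ring_zero S g.
  by move=> x h1 h2; rewrite /g czero' ?mul0r // ltW.
have g1z := ring_zero_deriv S0 dg gz; have g2z := ring_zero_deriv S0 dg1 g1z.
pose w x := v x + periodize S g x; pose w1 x := v1 x + periodize S g1 x.
pose w2 x := v2 x + periodize S g2 x.
have dw : hasder w w1 := hasderD dv (hasder_periodize S0 dg gz).
have dw1 : hasder w1 w2 := hasderD dv1 (hasder_periodize S0 dg1 g1z).
have cw := hasder_cont dw.
have cw2 : continuous w2 := contD cv2 (cont_periodize S0 cg2 g2z).
have pw : periodic w S by move=> x; rewrite /w pv periodize_periodic.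
have wE x : `|x| < 2 / 3 * S -> w x = v x + chi x * d x.
  by move=> hx; rewrite /w periodize_center.
have wB' x : `|v x + chi x * d x| <= B.
  have /andP[h1 h2] := c01 x.
  have -> : v x + chi x * d x = (1 - chi x) * v x + chi x * psi x by rewrite /d; ring.
  rewrite (le_trans (ler_normD _ _)) // !normrM (ger0_norm h1) ger0_norm; last by lra.
  have : (1 - chi x) * `|v x| <= (1 - chi x) * B by apply: ler_wpM2l => //; lra.
  have : chi x * `|psi x| <= chi x * B by apply: ler_wpM2l.
  by lra.
have dsm x : S / 8 <= `|x| -> `|d x| <= e.
  move=> hx; have h := small x hx.
  by rewrite -(@ler_pXn2r _ 2) ?nnegrE // real_normK ?num_real.
have chid x : `|chi x * d x| <= `|d x|.
  have /andP[h1 h2] := c01 x; by rewrite normrM (ger0_norm h1) ler_piMl.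
exists w, w1, w2 => r; split => //; split.
- move=> x; have [k /andP[h1 h2]] := period_reduce x (- (S / 2)) S0.
  rewrite -[x](subrK (k%:~R * S)) (periodicz pw) wE ?wB' //.
  by rewrite ltr_norml; apply/andP; split; lra.
- move=> x /andP[h1 h2]; rewrite wE; last by rewrite ltr_norml; apply/andP; split; lra.
  by rewrite /d; ring.
- move=> x /andP[h1 h2]; have [h3|h3] := leP x (S / 2).
    rewrite wE; last by rewrite ltr_norml; apply/andP; split; lra.
    have -> : v x + chi x * d x - psi x = - ((1 - chi x) * d x) by rewrite /d; ring.
    rewrite normrN normrM; have /andP[c0 c1] := c01 x.
    rewrite ger0_norm; last by lra.
    have [h4|h4] := leP `|x| (S / 6).
      by rewrite cone -?ler_norml // subrr mul0r mulr_ge0.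
    have := dsm x ltac:(lra) => h5.
    have : (1 - chi x) * `|d x| <= 1 * `|d x| by apply: ler_wpM2r => //; lra.
    by lra.
  (* Past the seam, [w] is read off at [x - S], which lies in the left tail, while [psi] at [x] lies
     in the right tail. Both differ from the same value of [v] by at most [e]. *)
  have xE : x = x - S + S by ring.
  have -> : w x = w (x - S) by rewrite {1}xE pw.
  have -> : psi x = v (x - S) + d x by rewrite -pv -xE /d; ring.
  rewrite wE; last by rewrite ltr_norml; apply/andP; split; lra.
  have -> : v (x - S) + chi (x - S) * d (x - S) - (v (x - S) + d x) = chi (x - S) * d (x - S) - d x by ring.
  rewrite (le_trans (ler_normB _ _)) //.
  have := chid (x - S); have := dsm (x - S) ltac:(rewrite ler0_norm; lra).
  have := dsm x ltac:(rewrite ger0_norm; lra).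
  by lra.
- have rE x : `|x| < 2 / 3 * S -> r x = (v x + chi x * d x) ^+ 3 - v x ^+ 3
      - chi2 x * d x - 2 * chi1 x * d1 x - chi x * (psi x ^+ 3 - v x ^+ 3).
    move=> hx; rewrite /r wE // /w2 periodize_center // /g2 /d2 p2E v2E /d; ring.
  have cr : continuous r by rewrite /r; cont.
  have pr : periodic r S.
    have pw1 := periodic_hasder dw pw; have pw2 := periodic_hasder dw1 pw1.
    by move=> x; rewrite /r pW pw pw2.
  have cr2 : continuous (fun x => r x ^+ 2) by cont.
  have pr2 : periodic (fun x => r x ^+ 2) S by move=> x; rewrite pr.
  rewrite -(ig_period 0 cr2 pr2) !add0r.
  rewrite (ig_split _ _ (- (S / 8))) (ig_split _ (- (S / 8)) (S / 8)).
  have z0 : ig (- (S / 8)) (S / 8) (fun x => r x ^+ 2) = 0.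
    have -> : 0 = ig (- (S / 8)) (S / 8) (fun=> 0 : R) by rewrite ig_cst mul0r.
    apply: ig_eq; [exact: cr2|exact: cont_cst|lra|move=> x /andP[h1 h2]].
    have near1 : \forall y \near x, chi y = 1.
      have S24 : 0 < S / 24 by lra.
      have BB : \forall y \near x, ball x (S / 24) y by exact: (nbhsx_ballx x (S / 24) S24).
      near=> y; have : ball x (S / 24) y by near: y.
      rewrite /ball /= ltr_distlC => /andP[h3 h4].
      by apply: cone; apply/andP; split; lra.
    have c1z : \forall y \near x, chi1 y = 0.
      have S48 : 0 < S / 48 by lra.
      have BB : \forall y \near x, ball x (S / 48) y by exact: (nbhsx_ballx x (S / 48) S48).
      near=> y; have : ball x (S / 48) y by near: y.
      rewrite /ball /= ltr_distlC => /andP[h3 h4].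
      rewrite -(hasder_derive1 dc) derive1E (@near_eq_derive _ _ _ _ (cst (1 : R))) ?derive_cst //.
      have B2 : \forall z \near y, ball y (S / 48) z by exact: (nbhsx_ballx y (S / 48) S48).
      near=> z; have : ball y (S / 48) z by near: z.
      rewrite /ball /= ltr_distlC => /andP[h5 h6].
      by apply: cone; apply/andP; split; lra.
    have e1 : chi1 x = 0 by exact: nbhs_singleton c1z.
    have e2 : chi2 x = 0.
      by rewrite -(hasder_derive1 dc1) derive1E (@near_eq_derive _ _ _ _ (fun=> 0)) ?derive_cst.
    have e3 : chi x = 1 by exact: nbhs_singleton near1.
    rewrite rE; last by rewrite ltr_norml; apply/andP; split; lra.
    by rewrite e1 e2 e3 /d; ring.
  rewrite z0 add0r.
  set C := 2 * _ + 8.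
  have bnd a b : - (2 / 3 * S) < a -> b < 2 / 3 * S -> a <= b ->
     ig a b (fun x => r x ^+ 2) <= C * (ig a b (fun x => d x ^+ 2) + ig a b (fun x => d1 x ^+ 2)).
    move=> ha hb ab; rewrite -igD; [|by cont|by cont]; rewrite -igZ; last by cont.
    apply: ig_le; [exact: cr2|by cont|exact: ab|move=> x /andP[h1 h2] /=].
    rewrite rE; last by rewrite ltr_norml; apply/andP; split; lra.
    exact: residual_bound.
  have b1 := bnd (- (S / 2)) (- (S / 8)) ltac:(lra) ltac:(lra) ltac:(lra).
  have b2 := bnd (S / 8) (S / 2) ltac:(lra) ltac:(lra) ltac:(lra).
  by rewrite [C * _]mulrDr [leRHS]addrC; apply: lerD.
Unshelve. all: by end_near. Qed.

End gluing.

(** * Existence *)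

Section existence.
Context {R : realType}.
Implicit Types (a b c x y S B e K Q : R).

(** The squared H^1-norm of [d] on the part of the cell where the glued profile may fail to solve
    the equation; it bounds the residual and, in the end, the correction. *)
Definition tail_mass (d d1 : R -> R) (S : R) : R :=
  ig (S / 8) (S / 2) (fun x => d x ^+ 2) + ig (S / 8) (S / 2) (fun x => d1 x ^+ 2) +
  (ig (- (S / 2)) (- (S / 8)) (fun x => d x ^+ 2) +
   ig (- (S / 2)) (- (S / 8)) (fun x => d1 x ^+ 2)).

Definition C2_solution (W u : R -> R) := exists u1 u2 : R -> R,
  [/\ hasder u u1, hasder u1 u2 & forall x, u2 x = W x * u x + u x ^+ 3].

Definition C2_cutoff (S : R) (chi : R -> R) := exists chi1 chi2 : R -> R,
  [/\ hasder chi chi1, hasder chi1 chi2, continuous chi2 & periodic chi S] /\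
  [/\ forall x, 0 <= chi x <= 1, forall x, `|chi1 x| <= 1, forall x, `|chi2 x| <= 1,
      forall x, - (S / 6) <= x <= S / 6 -> chi x = 1 &
      forall x, - (S / 2) <= x <= - (S / 3) \/ S / 3 <= x <= S / 2 -> chi x = 0].

(** The order of quantifiers is the point: [C] and [Y] are fixed before the period and the cut-off,
    so the bound on the correction is uniform in both. *)
Lemma periodic_solution_exists (W v v1 v2 psi psi1 psi2 : R -> R) (K B Wb : R) :
  continuous W -> (forall x, `|W x| <= Wb) ->
  hasder v v1 -> hasder v1 v2 -> (forall x, v2 x = W x * v x + v x ^+ 3) ->
  hasder psi psi1 -> hasder psi1 psi2 -> (forall x, psi2 x = W x * psi x + psi x ^+ 3) ->
  (forall x, `|v x| <= B) -> (forall x, `|psi x| <= B) ->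
  0 <= K -> line_coercive (fun x => W x + 3 * psi x ^+ 2) K ->
  let d := fun x => psi x - v x in let d1 := fun x => psi1 x - v1 x in
  (forall e, 0 < e -> exists Y, forall S, Y <= S -> tail_mass d d1 S <= e /\
     forall x, S / 8 <= `|x| -> d x ^+ 2 <= e) ->
  exists C Y, forall S chi, Y <= S -> periodic W S -> periodic v S -> C2_cutoff S chi ->
    exists u a a1 a2 : R -> R,
    [/\ C2_solution W u /\ periodic u S,
      [/\ hasder a a1, hasder a1 a2, continuous a2 & periodic a S],
      forall x, - (S / 2) <= x < S / 2 -> u x = chi x * psi x + (1 - chi x) * v x + a x &
      ig 0 S (fun x => a x ^+ 2) + ig 0 S (fun x => a1 x ^+ 2) + ig 0 S (fun x => a2 x ^+ 2)
       <= C * tail_mass d d1 S].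
Proof.
move=> cW Wbd dv dv1 v2E dp dp1 p2E vB pB K0 lc d d1 tails.
have cv := hasder_cont dv; have cp := hasder_cont dp.
have B0 : 0 <= B by exact: le_trans (normr_ge0 _) (vB 0).
have Wb0 : 0 <= Wb by exact: le_trans (normr_ge0 _) (Wbd 0).
pose Q := Wb + 3 * B ^+ 2.
have B20 := sqr_ge0 B.
have Q0 : 0 <= Q by rewrite /Q; lra.
have [kap kapE] : exists k : R, k = (7 / 144) ^+ 6 by exists ((7 / 144) ^+ 6).
have kap0 : 0 < kap by rewrite kapE exprn_gt0 //; lra.
have kap1 : kap <= 1 by rewrite kapE exprn_ile1 //; lra.
(* The potentials differ by at most [12 B e], which enters the coercivity condition as
   [16 K (12 B e)^2 = L e^2]. This term gets half of [kap]; the other half is left to the [1/S^2]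
   term and secured by [Y3]. *)
have [L LE] : exists l, l = K * (48 * B) ^+ 2 by exists (K * (48 * B) ^+ 2).
have L0 : 0 <= L by rewrite LE; apply: mulr_ge0 => //; exact: sqr_ge0.
have den0 : 0 < 2 * (1 + L) by lra.
have [e [e0 e1 e2]] : exists e, [/\ 0 < e, e <= 1 & L * e ^+ 2 <= kap / 2].
  exists (kap / (2 * (1 + L))).
  have e0 : 0 < kap / (2 * (1 + L)) by exact: divr_gt0.
  have e1 : kap / (2 * (1 + L)) <= 1 by rewrite ler_pdivrMr //; lra.
  have ee : kap / (2 * (1 + L)) * (2 * (1 + L)) = kap by rewrite divfK // gt_eqF.
  split => //; move: (kap / _) e0 e1 ee => e e0 e1 ee.
  have : L * (e * e) <= L * e.
    by apply: ler_wpM2l => //; rewrite ler_piMl // ltW.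
  by rewrite expr2; lra.
pose K1 := 48 * K / kap.
have K10 : 0 <= K1 by rewrite /K1 divr_ge0 ?mulr_ge0 // ltW.
pose C1 := 2 * (K1 + (1 / 2 + (1 / 2 + Q) * K1)).
have QK1 : 0 <= Q * K1 by exact: mulr_ge0.
have C10 : 0 <= C1 by rewrite /C1; lra.
pose Cr := 2 * (1 + 6 * B ^+ 2) ^+ 2 + 8.
have Cr0 : 0 <= Cr by rewrite /Cr; have := sqr_ge0 (1 + 6 * B ^+ 2); lra.
have CB0 : 0 <= C1 * (72 * B ^+ 2 + 18) by apply: mulr_ge0 => //; lra.
have CC0 : 0 <= C1 * Cr by exact: mulr_ge0.
(* [m0] bounds the admissible radius of the contraction; [m0 <= 1] reduces its condition to a linear
   one. The next threshold [e'] makes the tail mass small enough for the radius to stay below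
   [m0]. *)
have [m0 [m00 m01 m0E]] : exists m0, [/\ 0 < m0, m0 <= 1 & m0 * (C1 * (72 * B ^+ 2 + 18)) <= 1 / 4].
  move: (C1 * _) CB0 => D D0; exists (1 / (4 * (1 + D))).
  have den : 0 < 4 * (1 + D) by lra.
  by split; [exact: divr_gt0|rewrite ler_pdivrMr; lra|rewrite mulrAC ler_pdivrMr //; lra].
have [e' [e'0 e'E]] : exists e', 0 < e' /\ 4 * (C1 * Cr) * e' <= m0.
  move: (C1 * Cr) CC0 => D D0; exists (m0 / (4 * D + 1)).
  have den : 0 < 4 * D + 1 by lra.
  by split; [exact: divr_gt0|rewrite mulrCA ler_piMr ?ler_pdivrMr //; [exact: ltW|lra]].
have [Y1 hY1] := tails (e ^+ 2) (exprn_gt0 2 e0).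
have [Y2 hY2] := tails e' e'0.
pose Y3 := 32 * K * (3 + 4 * Q) / kap.
pose Y := Num.max (Num.max Y1 Y2) (Num.max Y3 1).
(* The integrals of [a^2] and [a1^2] contribute [2 m], that of [a2^2] contributes [2 Q^2 m] plus 8
   times that of [r^2]; then [m] and [r] are expressed by the tail mass. *)
exists (((2 + 2 * Q ^+ 2) * (4 * C1) + 8) * Cr), Y => S chi hS pW pv [c1 [c2 [[dc dc1 cc2 pc] [c01 c1b c2b cone czero]]]].
move: hS; rewrite !ge_max => /andP[/andP[s1 s2] /andP[s3 s4]].
have S0 : 0 < S by lra.
have [_ dsm] := hY1 S s1; have [tm _] := hY2 S s2.
have [w [w1 [w2 [dw dw1 cw2 pw [wB wE wpsi res]]]]] := glued_profile S0 cW pW dv dv1 v2E pv dp dp1 p2E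
   dc dc1 cc2 pc c01 c1b c2b cone czero vB pB dsm (ltW e0).
have cw := hasder_cont dw.
have pw1 := periodic_hasder dw pw; have pw2 := periodic_hasder dw1 pw1.
pose r x := W x * w x + w x ^+ 3 - w2 x.
have cr : continuous r by rewrite /r; cont.
have pr : periodic r S by move=> x; rewrite /r pW pw pw2.
pose q x := W x + 3 * psi x ^+ 2; pose qn x := W x + 3 * w x ^+ 2.
have cq : continuous q by rewrite /q; cont.
have cqn : continuous qn by rewrite /qn; cont.
have pqn : periodic qn S by move=> x; rewrite /qn pW pw.
have sqB (z : R) : `|z| <= B -> z ^+ 2 <= B ^+ 2.
  by move=> h; rewrite -[X in X <= _]real_normK ?num_real // lerXn2r ?nnegrE.
have hQ x : `|qn x| <= Q.
  rewrite /qn /Q (le_trans (ler_normD _ _)) // lerD // normrM (ger0_norm (ler0n _ 3)).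
  by apply: ler_wpM2l => //; rewrite ger0_norm ?sqr_ge0 // sqB.
have hqq x : - (S / 2) <= x <= 5 / 6 * S -> `|qn x - q x| <= 12 * B * e.
  move=> hx; have -> : qn x - q x = 3 * ((w x - psi x) * (w x + psi x)) by rewrite /qn /q; ring.
  rewrite !normrM (ger0_norm (ler0n _ 3)).
  have h1 : `|w x + psi x| <= 2 * B by rewrite (le_trans (ler_normD _ _)) //; have := wB x; have := pB x; lra.
  have : `|w x - psi x| * `|w x + psi x| <= (2 * e) * (2 * B) by apply: ler_pM => //; exact: wpsi.
  by lra.
have small : 16 * K * ((12 * B * e) ^+ 2 + (3 + 4 * Q) / S ^+ 2) <= kap.
  have t1 : 16 * K * (12 * B * e) ^+ 2 <= kap / 2.
    by apply: le_trans e2; rewrite LE le_eqVlt; apply/orP; left; apply/eqP; ring.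
  have t2 : 16 * K * ((3 + 4 * Q) / S ^+ 2) <= kap / 2.
    have KQ : 0 <= K * (3 + 4 * Q) by apply: mulr_ge0 => //; lra.
    rewrite mulrA ler_pdivrMr ?exprn_gt0 //.
    move: s3; rewrite /Y3 ler_pdivrMr // => s3.
    have : kap * S <= kap * S ^+ 2 by rewrite expr2; apply: ler_wpM2l; [exact: ltW|rewrite ler_peMl // ltW].
    by lra.
  by lra.
have co : coercive qn S K1.
  rewrite kapE in small; rewrite /K1 kapE.
  exact: (periodic_coercive lc K0 s4 cq cqn pqn hQ hqq small).
set m := 4 * C1 * ig 0 S (fun x => r x ^+ 2).
set rho := tail_mass _ _ _ in tm *.
have res' : ig 0 S (fun x => r x ^+ 2) <= Cr * rho by exact: res.
have r0 : 0 <= ig 0 S (fun x => r x ^+ 2).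
  by apply: ig_ge0; [cont|exact: ltW|move=> x _; exact: sqr_ge0].
have mm : m <= 4 * C1 * (Cr * rho) by apply: ler_wpM2l => //; exact: mulr_ge0.
have mm0 : m <= m0.
  apply: (le_trans mm).
  have : C1 * Cr * rho <= C1 * Cr * e' by exact: ler_wpM2l.
  by lra.
have m_ge0 : 0 <= m by apply: mulr_ge0 => //; exact: mulr_ge0.
have sm : C1 * m * (72 * B ^+ 2 + 18 * m) <= 1 / 4.
  have : C1 * m * (72 * B ^+ 2 + 18 * m) <= C1 * m0 * (72 * B ^+ 2 + 18).
    apply: ler_pM; [exact: mulr_ge0|by lra|exact: ler_wpM2l|by lra].
  by lra.
have [||a [a1 [da da1 pa [b0 b1 b2]]]] := nonlinear_solvable s4 C10 cqn cw cr pqn pw pr hQ wB _ _ sm.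
- by move=> f cf pf; exact: (periodic_solvable co cqn pqn s4 K10 cf pf).
- by move=> a a1 f cf da da1 pa; exact: (coercive_bounds co cqn s4 K10 hQ cf da da1 pa).
set a2 := fun x => _ in da1 b2.
have ca := hasder_cont da.
have ca2 : continuous a2 by rewrite /a2 /remainder; cont.
exists (fun x => w x + a x), a, a1, a2; split.
- split; last by move=> x; rewrite pw pa.
  exists (fun x => w1 x + a1 x), (fun x => w2 x + a2 x); split; [by hder|by hder|].
  by move=> x; rewrite /a2 /remainder /r /qn; ring.
- by split.
- by move=> x hx; rewrite wE.
rewrite -/m in b0 b1 b2.
have Q20 := sqr_ge0 Q.
have : Q ^+ 2 * m <= Q ^+ 2 * (4 * C1 * (Cr * rho)) by exact: ler_wpM2l.
by lra.
Qed.

Lemma tail_mass_ge0 (d d1 : R -> R) S : continuous d -> continuous d1 -> 0 <= S ->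
  0 <= tail_mass d d1 S.
Proof.
have p (u : R -> R) a b : continuous u -> a <= b -> 0 <= ig a b (fun x => u x ^+ 2).
  by move=> cu ab; apply: ig_ge0 => //; [cont|move=> x _; exact: sqr_ge0].
move=> cd cd1 S0; rewrite /tail_mass.
have := p d (S / 8) (S / 2) cd ltac:(lra); have := p d1 (S / 8) (S / 2) cd1 ltac:(lra).
have := p d (- (S / 2)) (- (S / 8)) cd ltac:(lra).
by have := p d1 (- (S / 2)) (- (S / 8)) cd1 ltac:(lra); lra.
Qed.

Lemma tail_mass_small (d d1 d2 : R -> R) P (X M : R) : hasder d d1 -> hasder d1 d2 ->
  continuous d2 -> 0 <= P -> (forall x, `|d2 x| <= P * `|d x|) ->
  (forall a b, X <= a -> a < b -> ig a b (fun x => d x ^+ 2) <= M) ->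
  (forall a b, b <= - X -> a < b -> ig a b (fun x => d x ^+ 2) <= M) ->
  forall e, 0 < e -> exists Y, forall S, Y <= S -> tail_mass d d1 S <= e /\
     forall x, S / 8 <= `|x| -> d x ^+ 2 <= e.
Proof.
move=> dd dd1 cd2 P0 hP hM hM' e e0.
have [Y [h1 h2 h3]] := tail_decay2 dd dd1 cd2 P0 hP hM hM' (divr_gt0 e0 (ltr0n R 4)).
(* The factor 8 is there because the tails start at [S/8]; each of the four integrals in [tail_mass]
   gets a quarter of [e]. *)
exists (Num.max (8 * Y) 0) => S; rewrite ge_max => /andP[YS S0]; split.
  have [i1 i2] := h1 (S / 8) (S / 2) ltac:(lra) ltac:(lra).
  have [i3 i4] := h2 (- (S / 2)) (- (S / 8)) ltac:(lra) ltac:(lra).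
  by rewrite /tail_mass; lra.
by move=> x hx; have := h3 x ltac:(lra); lra.
Qed.

End existence.

(** * Between classical functions and the notions of the statement *)

Section translation.
Context {R : realType}.
Notation mu_ := (@lebesgue_measure R).
Implicit Types (f g h : R -> R) (a b c x y S T B e K Q : R).

Lemma GP_solution_hasder (omega mu : R) (V u : R -> R) : GP_solution omega V mu u ->
  hasder u (u^`())%classic /\
  hasder (u^`())%classic (fun x => (mu * V x + omega) * u x + u x ^+ 3).
Proof.
move=> [d1 d2 e]; split; first exact: derivable_hasder.
apply: (hasder_eq (derivable_hasder d2)) => x.
have := e x; rewrite derive1nS derive1n1; lra.
Qed.

Lemma C2_GP_solution (omega mu : R) (V u : R -> R) :
  C2_solution (fun x => mu * V x + omega) u -> GP_solution omega V mu u.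
Proof.
move=> [u1 [u2 [d1 d2 e]]]; split.
- exact: hasder_derivable d1.
- by rewrite (hasder_derive1 d1); exact: hasder_derivable d2.
- move=> x; rewrite derive1nS derive1n1 (hasder_derive1 d1) (hasder_derive1 d2) e.
  by ring.
Qed.

Lemma periodic_cutoff_C2 T n (chi : R -> R) : periodic_cutoff T n chi ->
  C2_cutoff (n%:R * T) chi.
Proof.
move=> [[sm v01] pc w2 one zero].
exists (chi^`())%classic, (chi^`(2))%classic.
have d0 : hasder chi (chi^`())%classic.
  by apply: derivable_hasder => x; have := sm 0%N x; rewrite derive1n0.
have d1 : hasder (chi^`())%classic (chi^`(2))%classic.
  rewrite derive1nS derive1n1; apply: derivable_hasder => x.
  by have := sm 1%N x; rewrite derive1n1.
have d2 : hasder (chi^`(2))%classic (chi^`(3))%classic.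
  by rewrite (derive1nS _ 2); apply: derivable_hasder => x; exact: sm.
split; first by split => //; exact: hasder_cont d2.
split => //.
- by move=> x; have := w2 1%N x isT; rewrite derive1n1.
- by move=> x; exact: (w2 2%N x isT).
- by move=> x /andP[h1 h2]; apply: one; apply/andP; split; lra.
- move=> x h; apply: zero; case: h => /andP[h1 h2]; [left|right]; apply/andP; split; lra.
Qed.

Lemma ae_neq a : {ae mu_, forall x, x != a}.
Proof.
exists [set a]; split => //; first exact: lebesgue_measure_set1.
by move=> x /= /negP; rewrite negbK => /eqP.
Qed.

(** [H2per] quantifies over all pairs of endpoints, so the degenerate segments, which are null sets,
    have to be covered too. *)
Lemma L2_segment f g a b : continuous g -> measurable_fun setT f ->
  {ae mu_, forall x, f x = g x} -> L2 `[a, b] f.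
Proof.
move=> cg mf fg; have [ab|ba] := ltP a b; first by have [] := L2_itv ab cg mf fg.
have mf' : measurable_fun setT (f \_ `[a, b]).
  by apply/(measurable_restrictT _ _).1 => //; exact: measurable_funS mf.
have c0 : continuous (fun _ : R => 0 : R) by cont.
have e : {ae mu_, forall x, (f \_ `[a, b]) x = ((fun _ : R => 0 : R) \_ `[0, 1]) x}.
  apply: (ae_imp (ae_neq a)) => x xa; rewrite !patchE.
  case: ifPn => [|_]; last by case: ifPn.
  rewrite inE /= in_itv /= => /andP[h1 h2]; exfalso.
  by move: xa; rewrite eq_le h1 (le_trans h2 ba).
have N := Lnorm2_supp ltr01 c0 mf' e.
rewrite /L2 /= inE; apply/andP; split; rewrite inE //=.
by rewrite /finite_norm N ltry.
Qed.

Lemma C2_periodic_H2per S (a a1 a2 : R -> R) : 0 < S -> hasder a a1 -> hasder a1 a2 ->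
  continuous a2 -> periodic a S ->
  H2per S a /\ H2per_norm S a = Num.sqrt (ig 0 S (fun x => a x ^+ 2) +
    ig 0 S (fun x => a1 x ^+ 2) + ig 0 S (fun x => a2 x ^+ 2)).
Proof.
move=> S0 d1 d2 c2 pa; have ca := hasder_cont d1; have ca1 := hasder_cont d2.
have [tw e1 e2 [m0 m1 m2]] := C2_wderiv d1 d2 c2.
have e0 : {ae mu_, forall x, a x = a x} by apply: (ae_imp e1).
split.
  split => // b c; split.
  - exact: L2_segment ca m0 e0.
  - exact: L2_segment ca1 m1 e1.
  - exact: L2_segment c2 m2 e2.
rewrite /H2per_norm /H2norm_on.
have [_ ->] := L2_itv S0 ca m0 e0; have [_ ->] := L2_itv S0 ca1 m1 e1.
by have [_ ->] := L2_itv S0 c2 m2 e2.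
Qed.

Lemma smooth_cont f : smooth f -> continuous f.
Proof.
move=> sm; have d : hasder f (f^`())%classic.
  by apply: derivable_hasder => x; have := sm 0%N x; rewrite derive1n0.
exact: hasder_cont d.
Qed.

Lemma cont_sum (F : nat -> R -> R) (m n : nat) :
  (forall j, (m <= j < n)%N -> continuous (F j)) ->
  continuous (fun x => \sum_(m <= j < n) F j x).
Proof.
elim: n => [_|n IH h].
  have -> : (fun x => \sum_(m <= j < 0) F j x) = fun=> 0.
    by apply/funext => x; rewrite big_geq.
  exact: cont_cst.
have [mn|nm] := leqP m n.
  have -> : (fun x => \sum_(m <= j < n.+1) F j x) = fun x => \sum_(m <= j < n) F j x + F n x.
    by apply/funext => x; rewrite big_nat_recr.
  apply: contD; last by apply: h; rewrite mn leqnn.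
  by apply: IH => j /andP[mj jn]; apply: h; rewrite mj ltnS ltnW.
have -> : (fun x => \sum_(m <= j < n.+1) F j x) = fun=> 0.
  by apply/funext => x; rewrite big_geq.
exact: cont_cst.
Qed.

(** The two signs stand for the two orientations of a primary front and vanish on squaring. The
    shift is harmless because the bound on [h] is common to all segments. *)
Lemma sum_shift_bound (d a h : R -> R) c (Ma Mh : R) :
  continuous d -> continuous a -> continuous h ->
  (forall x y, x < y -> ig x y (fun t => a t ^+ 2) <= Ma) ->
  (forall x y, x < y -> ig x y (fun t => h t ^+ 2) <= Mh) ->
  forall x y, x < y -> (forall t, x <= t <= y -> d t = a t + h (t + c) \/ d t = a t - h (t + c)) ->
  ig x y (fun t => d t ^+ 2) <= 2 * Ma + 2 * Mh.
Proof.
move=> cd ca ch ba bh x y xy de.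
have ch2 : continuous (fun t => h t ^+ 2) by cont.
have chc : continuous (fun t => h (t + c)) by apply: cont_comp => //; cont; exact: cont_id.
apply: (@le_trans _ _ (ig x y (fun t => 2 * a t ^+ 2 + 2 * h (t + c) ^+ 2))).
  apply: ig_le; [by cont|by cont|exact: ltW|move=> t ht /=].
  have := sqr_ge0 (a t - h (t + c)); have := sqr_ge0 (a t + h (t + c)).
  by case: (de t ht) => ->; lra.
rewrite igD; [|by cont|by cont]; rewrite igZ; last by cont.
rewrite igZ; last by cont.
rewrite (ig_shift x y c ch2).
have := ba x y xy; have := bh (x + c) (y + c) ltac:(lra); lra.
Qed.

End translation.

(** * Square integrability of psi - v near infinity *)

Section multifront_tails.
Context {R : realType}.
Implicit Types (f g h : R -> R) (a b c x y S T B e K Q : R).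

(** The supports with index [j < M] end at or before [(M - 1/2) n T + 1]. *)
Lemma partition_right T (M n : nat) (chi : nat -> R -> R) x : 0 < T -> (1 <= M)%N ->
  multifront_partition T M n chi -> M%:R * n%:R * T + 1 <= x ->
  chi M x = 1 /\ forall j, (1 <= j < M)%N -> chi j x = 0.
Proof.
move=> T0 M1 [_ sum1 _ vanish] hx.
have z j : (1 <= j < M)%N -> chi j x = 0.
  move=> jM; apply: (vanish j jM) => /=; rewrite in_itv /= => h.
  have jM' : (j%:R : R) + 1 / 2 <= M%:R.
    have : (j.+1%:R : R) <= M%:R by rewrite ler_nat; case/andP: jM.
    by rewrite -natr1; lra.
  have nT : 0 <= n%:R * T by apply: mulr_ge0 => //; exact: ltW.
  have := ler_wpM2r nT jM'; rewrite !mulrA; lra.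
split => //; have := sum1 x; rewrite big_nat_recr //= big_nat big1 ?add0r // => j hj; exact: z.
Qed.

(** The supports with index [j > 1] begin at or after -1, since [(j - 1/2) n T] is non-negative. *)
Lemma partition_left T (M n : nat) (chi : nat -> R -> R) x : 0 < T -> (1 <= M)%N ->
  multifront_partition T M n chi -> x <= -1 ->
  chi 1%N x = 1 /\ forall j, (1 < j <= M)%N -> chi j x = 0.
Proof.
move=> T0 M1 [_ sum1 vanish _] hx.
have z j : (1 < j <= M)%N -> chi j x = 0.
  move=> jM; apply: (vanish j jM) => /=; rewrite in_itv /= andbT => h.
  have jM' : 0 <= (j%:R : R) - 1 / 2.
    have : (1%:R : R) <= j%:R by rewrite ler_nat; case/andP: jM => /ltnW.
    by lra.
  have nT : 0 <= n%:R * T by apply: mulr_ge0 => //; exact: ltW.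
  have := mulr_ge0 jM' nT; rewrite !mulrA; lra.
split => //; have := sum1 x; rewrite big_nat_recl // big_nat big1 ?addr0 // => j hj.
by apply: z; move: hj => /andP[j1 jM]; rewrite ltnS j1.
Qed.

Lemma periodic_natmul f T (k : nat) x : periodic f T -> f (x + - (k%:R * T)) = f x.
Proof.
move=> pf; rewrite -[in RHS](subrK (k%:R * T) x).
by have := periodicz pf (Posz k) (x - k%:R * T); rewrite -pmulrn.
Qed.

(** Far to the right only the last front is present, far to the left only the first. There [psi - v]
    is the L^2 function [al n] plus or minus a translate of the localized difference between [Psi]
    and its end state; [v] does not notice the translation by a multiple of [T]. *)
Lemma multifront_facts (omega T : R) (V chip chim : R -> R) (mu : R) (psi v : R -> R) :
  0 < T -> continuous V -> end_partition chip chim ->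
  multifront omega T V chip chim mu psi v v ->
  [/\ nondegenerate_solution omega V mu psi, GP_solution omega V mu v, periodic v T &
   exists X M : R,
    (forall a b, X <= a -> a < b -> ig a b (fun x => (psi x - v x) ^+ 2) <= M) /\
    (forall a b, b <= - X -> a < b -> ig a b (fun x => (psi x - v x) ^+ 2) <= M)].
Proof.
move=> T0 cV [[smp smm] _ chi1 [chip0 chim0] _].
move=> [C [mu0 [Psi [Vp [Vm [M [phi [N0 [chi [al [n [[C0 mu00 fam] hmu [M1 prim _] [mf [Nn psiE]] [smE spE]]]]]]]]]]]]].
have [[[GPPsi _ _] _] _ [H2p H2m] [VmE [[pVp _ _] _ GPVp _]] [[pVm _ _] _ GPVm _]] := fam mu hmu.
have [part _ sol _] := mf.
have [[_ [La _ _]] nd] := sol n Nn.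
rewrite -psiE in nd.
have [GPpsi psiB inv] := nd.
have prim1 := prim 1%N M1; have primM := prim M ltac:(by rewrite M1 leqnn).
have GPv : GP_solution omega V mu v /\ periodic v T.
  by rewrite -smE; case: prim1 => -> /=.
case: GPv => GPv pv.
have [dpsi _] := GP_solution_hasder GPpsi; have [dv _] := GP_solution_hasder GPv.
have [dPsi _] := GP_solution_hasder GPPsi.
have [dVp _] := GP_solution_hasder GPVp; have [dVm _] := GP_solution_hasder GPVm.
have cpsi := hasder_cont dpsi; have cv := hasder_cont dv; have cPsi := hasder_cont dPsi.
have cVp := hasder_cont dVp; have cVm := hasder_cont dVm.
have cchip := smooth_cont smp; have cchim := smooth_cont smm.
pose d x := psi x - v x.
have cd : continuous d by rewrite /d; cont.
have [psm sum1 _ _] := part n Nn.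
have cprof j : (1 <= j <= M)%N -> continuous (profile (phi j)).
  by move=> /prim[] -> /=; cont.
(* Membership in [H2] does not make this representative continuous; it is continuous as [psi] minus
   a finite sum of continuous functions. *)
have cal : continuous (al n).
  have -> : al n = fun x => psi x - \sum_(1 <= j < M.+1)
      chi n j x * profile (phi j) (x - j%:R * n%:R * T).
    by apply/funext => x; rewrite psiE /multifront_profile addrK.
  apply: contD => //; apply: contN; apply: cont_sum => j; rewrite ltnS => hj.
  have cj := cprof j hj; have cc := smooth_cont (psm j hj).1.
  by apply: contM => //; apply: (cont_comp cj); cont; exact: cont_id.
pose hp x := chip x * (Psi mu x - Vp mu x); pose hm x := chim x * (Psi mu x - Vm mu x).
have chp : continuous hp by rewrite /hp; cont.
have chm : continuous hm by rewrite /hm; cont.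
have [Ma bMa] := L2_ig_bounded cal La.
have [Mp bMp] : exists Mp, forall x y, x < y -> ig x y (fun t => hp t ^+ 2) <= Mp.
  by case: H2p => _ [Lp _ _]; have [Mp hMp] := L2_ig_bounded chp Lp; exists Mp.
have [Mm bMm] : exists Mm, forall x y, x < y -> ig x y (fun t => hm t ^+ 2) <= Mm.
  by case: H2m => _ [Lm _ _]; have [Mm hMm] := L2_ig_bounded chm Lm; exists Mm.
have cMT : 0 <= M%:R * n%:R * T by rewrite !mulr_ge0 // ltW.
have nT0 : 0 <= n%:R * T by rewrite mulr_ge0 // ltW.
have right t : M%:R * n%:R * T + 1 <= t ->
    d t = al n t + hp (t + - ((M * n)%:R * T)) \/ d t = al n t - hp (t + - ((M * n)%:R * T)).
  move=> ht; have [cM cz] := partition_right T0 M1 (part n Nn) ht.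
  have yE : t - M%:R * n%:R * T = t + - ((M * n)%:R * T) by rewrite natrM.
  have pt : psi t = al n t + profile (phi M) (t + - ((M * n)%:R * T)).
    rewrite psiE /multifront_profile big_nat_recr //= big_nat big1 ?add0r.
      by rewrite cM mul1r yE.
    by move=> j hj; rewrite cz ?mul0r.
  have c1 : chip (t + - ((M * n)%:R * T)) = 1.
    have := chi1 (t + - ((M * n)%:R * T)); rewrite chim0 ?addr0 //= in_itv /= => h.
    by move: h; rewrite -yE; lra.
  have vt : v t = v (t + - ((M * n)%:R * T)) by rewrite periodic_natmul.
  rewrite /d pt vt /hp c1 mul1r -spE.
  case: primM => -> /=; [left|right]; first by ring.
  by rewrite VmE; ring.
have left t : t <= -1 ->
    d t = al n t + hm (t + - (n%:R * T)) \/ d t = al n t - hm (t + - (n%:R * T)).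
  move=> ht; have [cM cz] := partition_left T0 M1 (part n Nn) ht.
  have yE : t - 1%:R * n%:R * T = t + - (n%:R * T) by rewrite mul1r.
  have pt : psi t = al n t + profile (phi 1%N) (t + - (n%:R * T)).
    rewrite psiE /multifront_profile big_nat_recl // big_nat big1 ?addr0.
      by rewrite cM mul1r yE.
    by move=> j /andP[j1 j2]; rewrite cz ?mul0r // ltnS j1.
  have c1 : chim (t + - (n%:R * T)) = 1.
    have := chi1 (t + - (n%:R * T)); rewrite chip0 ?add0r //= in_itv /= andbT => h.
    by move: h; lra.
  have vt : v t = v (t + - (n%:R * T)) by rewrite periodic_natmul.
  rewrite /d pt vt /hm c1 mul1r -smE.
  case: prim1 => -> /=; [left|right]; first by ring.
  by rewrite VmE; ring.
split => //; exists (M%:R * n%:R * T + 1), (Num.max (2 * Ma + 2 * Mp) (2 * Ma + 2 * Mm)); split.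
  move=> x y hx xy; rewrite le_max; apply/orP; left.
  by apply: (sum_shift_bound cd cal chp bMa bMp xy) => t /andP[xt ty]; apply: right; lra.
move=> x y hy xy; rewrite le_max; apply/orP; right.
by apply: (sum_shift_bound cd cal chm bMa bMm xy) => t /andP[xt ty]; apply: left; lra.
Qed.

End multifront_tails.

Theorem corollary8p13 (R : realType) (omega T : R) (V : R -> R)
  (homega : omega < 0) (hT : 0 < T)
  (hV : C1 V) (hVeven : even_function V) (hVper : periodic V T)
  (hmelnikov : \int[@lebesgue_measure R]_(x in setT)
                 ((V^`())%classic x * psi0 omega x * ((psi0 omega)^`())%classic x) != 0)
  (chip chim : R -> R) (hchi : end_partition chip chim)
  (mu : R) (hmu : 0 < mu) (psi v : R -> R)
  (hpsi : multifront omega T V chip chim mu psi v v)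
  (chi : nat -> R -> R) (n0 : nat)
  (hcutoff : forall n : nat, (n0 <= n)%N -> periodic_cutoff T n (chi n)) :
  exists (N : nat) (psin a : nat -> R -> R),
    (forall n : nat, (N <= n)%N ->
       [/\ GP_solution omega V mu (psin n),
           periodic (psin n) (n%:R * T),
           H2per (n%:R * T) (a n) &
           forall x : R, - (n%:R / 2 * T) <= x < n%:R / 2 * T ->
             psin n x = chi n x * psi x + (1 - chi n x) * v x + a n x]) /\
    H2per_norm (n%:R * T) (a n) @[n --> \oo] --> (0 : R).
Proof.
have cV : continuous V := hasder_cont (derivable_hasder hV.1).
have [[GPpsi [Bp hBp] inv] GPv pv [X [Mt [tr tl]]]] := multifront_facts hT cV hchi hpsi.
have [dp dp1] := GP_solution_hasder GPpsi; have [dv dv1] := GP_solution_hasder GPv.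
have cp := hasder_cont dp; have cv := hasder_cont dv.
pose W x := mu * V x + omega.
have cW : continuous W by rewrite /W; cont.
have pW : periodic W T by move=> x; rewrite /W hVper.
have [Wb Wb0 hWb] := cont_periodic_bounded cW hT pW.
have [Bv Bv0 hBv] := cont_periodic_bounded cv hT pv.
pose B := Num.max Bv Bp.
have vB x : `|v x| <= B by rewrite le_max hBv.
have pB x : `|psi x| <= B by rewrite le_max hBp orbT.
have [K K0 lc] := invertible_line_coercive cV cp inv.
pose d x := psi x - v x; pose d1 x := (psi^`())%classic x - (v^`())%classic x.
pose d2 x := W x * psi x + psi x ^+ 3 - (W x * v x + v x ^+ 3).
have dd : hasder d d1 by rewrite /d; hder.
have dd1 : hasder d1 d2 by rewrite /d1; hder.
have cd2 : continuous d2 by rewrite /d2; cont.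
(* The constant bounds [W + psi^2 + psi v + v^2], the potential of the linear equation satisfied by
   the difference [d] of the two solutions. *)
have P0 : 0 <= Wb + 3 * B ^+ 2 by rewrite addr_ge0 // mulr_ge0 // sqr_ge0.
have hP x : `|d2 x| <= (Wb + 3 * B ^+ 2) * `|d x|.
  have -> : d2 x = (W x + (psi x ^+ 2 + psi x * v x + v x ^+ 2)) * d x by rewrite /d2 /d; ring.
  rewrite normrM; apply: ler_wpM2r => //; rewrite (le_trans (ler_normD _ _)) // lerD //.
  have sqB (z : R) : `|z| <= B -> z ^+ 2 <= B ^+ 2.
    move=> h; rewrite -[leLHS]real_normK ?num_real // lerXn2r ?nnegrE //.
    exact: le_trans (normr_ge0 _) h.
  have := sqB _ (vB x); have := sqB _ (pB x).
  have := sqr_ge0 (psi x - v x); have := sqr_ge0 (psi x + v x).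
  by rewrite ler_norml => *; apply/andP; split; nra.
have tails := tail_mass_small dd dd1 cd2 P0 hP tr tl.
have [C [Y HY]] := periodic_solution_exists cW hWb dv dv1 (fun=> erefl) dp dp1 (fun=> erefl) vB pB K0 lc tails.
have perN (f : R -> R) (n : nat) : periodic f T -> periodic f (n%:R * T).
  by move=> pf x; have := periodicz pf (Posz n) x; rewrite -pmulrn.
have big (Z : R) : exists N : nat, forall n, (N <= n)%N -> Z <= n%:R * T.
  exists (Num.bound (Z / T)) => n hn; rewrite -ler_pdivrMr //.
  have h1 : (Num.bound (Z / T))%:R <= n%:R :> R by rewrite ler_nat.
  have [Z0|Z0] := leP 0 (Z / T); first by have := archi_boundP Z0; lra.
  by apply: le_trans (ler0n R n); exact: ltW.
(* The 1 makes the period positive, as the identification of the periodic norm with integrals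
   requires. *)
have [N1 hN1] := big (Num.max Y 1).
pose N := maxn n0 N1.
(* Solutions and corrections are chosen for every [n] at once; [(psi, psi)] is a default below
   [N]. *)
have /choice[F hF] (n : nat) : exists p : (R -> R) * (R -> R), (N <= n)%N ->
    [/\ GP_solution omega V mu p.1, periodic p.1 (n%:R * T), H2per (n%:R * T) p.2,
     forall x : R, - (n%:R / 2 * T) <= x < n%:R / 2 * T ->
             p.1 x = chi n x * psi x + (1 - chi n x) * v x + p.2 x &
     H2per_norm (n%:R * T) p.2 <= Num.sqrt (C * tail_mass d d1 (n%:R * T))].
  have [Nn|nN] := leqP N n; last by exists (psi, psi).
  move: Nn; rewrite geq_max => /andP[n0n N1n].
  have := hN1 n N1n; rewrite ge_max => /andP[Yn S1].
  have [u [a [a1 [a2 [[su pu] [da da1 ca2 pa] uE ub]]]]] :=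
    HY (n%:R * T) (chi n) Yn (perN _ _ pW) (perN _ _ pv) (periodic_cutoff_C2 (hcutoff n n0n)).
  have [Ha Na] := C2_periodic_H2per (lt_le_trans ltr01 S1) da da1 ca2 pa.
  exists (u, a) => _; split => //=.
  - exact: C2_GP_solution.
  - by move=> x /andP[h1 h2]; apply: uE; apply/andP; split; lra.
  - by rewrite Na ler_wsqrtr.
exists N, (fun n => (F n).1), (fun n => (F n).2); split.
  by move=> n Nn; have [] := hF n Nn.
apply/cvgrPdist_lt => e e0.
(* The sign of [C] is unknown, so it is replaced by [|C| + 1]; the threshold on the tail mass then
   brings the norm down to the square root of [e^2 / 2], strictly below [e]. *)
have C0 : 0 < `|C| + 1 by rewrite ltr_wpDl.
have E0 : 0 < e ^+ 2 / (2 * (`|C| + 1)).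
  by apply: divr_gt0; [exact: exprn_gt0|exact: mulr_gt0].
have [Y2 hY2] := tails _ E0.
have [N2 hN2] := big Y2.
exists (maxn N N2) => // n /=; rewrite geq_max => /andP[Nn N2n].
have [_ _ _ _ nb] := hF n Nn; have [tm _] := hY2 _ (hN2 n N2n).
rewrite sub0r normrN ger0_norm; last exact: sqrtr_ge0.
apply: (le_lt_trans nb); rewrite -[e]ger0_norm ?(ltW e0) // -sqrtr_sqr ltr_sqrt ?exprn_gt0 //.
have t0 : 0 <= tail_mass d d1 (n%:R * T).
  apply: tail_mass_ge0; [exact: hasder_cont dd|exact: hasder_cont dd1|].
  by rewrite mulr_ge0 // ltW.
have h1 : C * tail_mass d d1 (n%:R * T) <= (`|C| + 1) * tail_mass d d1 (n%:R * T).
  by apply: ler_wpM2r => //; have := ler_norm C; lra.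
have h2 : (`|C| + 1) * tail_mass d d1 (n%:R * T) <= (`|C| + 1) * (e ^+ 2 / (2 * (`|C| + 1))).
  by apply: ler_wpM2l => //; exact: ltW.
have h3 : (`|C| + 1) * (e ^+ 2 / (2 * (`|C| + 1))) = e ^+ 2 / 2.
  by field; rewrite gt_eqF.
have e20 : 0 < e ^+ 2 by rewrite exprn_gt0.
by rewrite h3 in h2; move: (e ^+ 2) e20 h2 => E Epos h2; lra.
Qed.
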